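(* Let $(X,\mathcal{L},E)$ be a compact Riemann surface lamination with isolated singularities in a complex manifold $M$. If $a\in E$ is a linearizable singularity of $X$, then any positive harmonic current $T$ on $X$ has locally finite Poincaré mass near $a$, i.e. there is a neighbourhood of $a$ on which the measure $T\wedge\omega_P$ has finite mass.
   Context: A Riemann surface lamination $(Y,\mathcal{L})$ is a locally compact space $Y$ with an atlas of homeomorphisms (flow boxes) $\Phi_i:\mathbb{U}_i\to\mathbb{B}_i\times\mathbb{T}_i$, with $\mathbb{U}_i\subset Y$ open, $\mathbb{B}_i$ a domain in $\mathbb{C}$, $\mathbb{T}_i$ a locally compact metric space, whose coordinate changes have the form $(x,t)\mapsto(\Psi(x,t),\Lambda(t))$ with $\Psi,\Lambda$ continuous and $\Psi$ holomorphic in $x$. Plaques are the sets $\Phi_i^{-1}(\mathbb{B}_i\times\{t\})$; leaves are the minimal connected subsets containing every plaque they meet. A compact Riemann surface lamination with isolated singularities $(X,\mathcal{L},E)$ in a complex manifold $M$ of dimension $k\ge1$ means: $X\subset M$ compact, $E\subset X$ finite, $(X\setminus E,\mathcal{L})$ is a Riemann surface lamination whose leaves are Riemann surfaces holomorphically immersed in $M$. A vector field on $\mathbb{C}^k$ is generic linear if it is $F(z)=\sum_{j=1}^k\lambda_jz_j\frac{\partial}{\partial z_j}$ with all $\lambda_j\in\mathbb{C}\setminus\{0\}$. A singular point $a\in E$ is linearizable if there is a local holomorphic coordinate system of $M$ near $a$ (with $a$ corresponding to $0$) in which the leaves of $X$ are integral curves of a generic linear vector field. A leaf (of $X\setminus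 E$) is hyperbolic if its universal cover is the unit disc $\mathbb{D}$, parabolic otherwise; $\omega_P$ is the $(1,1)$-form of the Poincaré metric on hyperbolic leaves (induced by $\frac{2}{(1-|\zeta|^2)^2}i\,d\zeta\wedge d\bar\zeta$ on $\mathbb{D}$), and $\omega_P=0$ on parabolic leaves. A positive harmonic current $T$ on $(X,\mathcal{L},E)$ is a positive $\partial\bar\partial$-closed $(0,0)$-current on the lamination $X\setminus E$; in each flow box $\mathbb{B}\times\mathbb{T}$ it is $\langle T,\alpha\rangle=\int_{\mathbb{T}}\big(\int_{\mathbb{B}}h_a\,\alpha(\cdot,a)\big)d\mu(a)$, with $\mu$ a positive Radon measure on $\mathbb{T}$ and $h_a$ positive harmonic on $\mathbb{B}$ for $\mu$-a.e. $a$. The measure $T\wedge\omega_P$ is considered on $X\setminus E$. *)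

(* Defs.v *)
From HB Require Import structures.
From mathcomp Require Import all_boot all_order all_algebra.
From mathcomp Require Import complex.
From mathcomp Require Import all_classical all_reals all_analysis.

Set Implicit Arguments.
Unset Strict Implicit.
Unset Printing Implicit Defensive.
Import Order.TTheory GRing.Theory Num.Theory.
Import numFieldNormedType.Exports.

Local Open Scope classical_set_scope.
Local Open Scope ring_scope.

(* R[i], with the topology that any numClosedFieldType gets from its norm; on
   Cx R and its powers, differentiability over Cx R is holomorphy. *)
Definition Cx (R : realType) : numClosedFieldType := complex R.

Section Plane.
Variable R : realType.

Definition cplx (u : R * R) : Cx R := (u.1 +i* u.2)%C.
Definition reim (z : Cx R) : R * R := (complex.Re z, complex.Im z).
Definition cabs (z : Cx R) : R := complex.Re `|z|.

Definition unit_disc : set (Cx R) := [set z | cabs z < 1].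

Definition leb2 := (@lebesgue_measure R \x @lebesgue_measure R)%E.

Definition axis (b : bool) : R * R := if b then (1, 0) else (0, 1).

Fixpoint pderiv (s : seq bool) (f : R * R -> R) : R * R -> R :=
  if s is b :: s' then 'D_(axis b) (pderiv s' f) else f.

Definition laplacian (f : R * R -> R) (u : R * R) : R :=
  pderiv [:: true; true] f u + pderiv [:: false; false] f u.

Definition harmonic_on (B : set (R * R)) (h : R * R -> R) : Prop :=
  (forall (s : seq bool) u, (size s <= 2)%N -> B u ->
     {for u, continuous (pderiv s h)} /\
     ((size s < 2)%N -> forall b, derivable (pderiv s h) u (axis b))) /\
  (forall u, B u -> laplacian h u = 0).

(* Smooth in the leaf variable, all leafwise derivatives being continuous in
   both variables. *)
Definition leaf_smooth (T : topologicalType) (B : set (R * R))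
    (g : R * R -> T -> R) : Prop :=
  forall (s : seq bool) (u : R * R) (t : T), B u ->
    (forall b, derivable (pderiv s (g^~ t)) u (axis b)) /\
    {for (u, t), continuous (fun q : R * R * T => pderiv s (g^~ q.2) q.1)}.

(* Borel sets of T *)
Definition borel (T : ptopologicalType) := g_sigma_algebraType (@open T).

Definition radon (T : ptopologicalType)
    (mu : {measure set (borel T) -> \bar R}) : Prop :=
  (forall K : set T, compact K -> (mu K < +oo)%E) /\
  (forall A : set (borel T), measurable A ->
     mu A = ereal_sup [set mu K | K in
       [set K : set T | [/\ compact K, measurable (K : set (borel T)) & K `<=` A]]]).

End Plane.

Section ComplexManifold.
Variables (R : realType) (k : nat).

Record chart (M : topologicalType) := Chart {
  cdom : set M ;
  cmap : M -> 'rV[Cx R]_k ;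
  cinv : 'rV[Cx R]_k -> M ;
  _ : open cdom ;
  _ : open (cmap @` cdom) ;
  _ : forall p, cdom p -> cinv (cmap p) = p ;
  _ : {within cdom, continuous cmap} ;
  _ : {within cmap @` cdom, continuous cinv} }.

Definition holo_transition (M : topologicalType) (c d : chart M) : Prop :=
  forall p, cdom c p -> cdom d p -> differentiable (cmap d \o cinv c) (cmap c p).

Record complexManifold := ComplexManifold {
  carrier :> topologicalType ;
  catlas : set (chart carrier) ;
  _ : hausdorff_space carrier ;
  _ : @second_countable carrier ;
  _ : forall p : carrier, exists2 c, catlas c & cdom c p ;
  _ : forall c d, catlas c -> catlas d -> holo_transition c d }.

Definition holo_coordinates (M : complexManifold) (c : chart M) : Prop :=
  forall d, catlas d -> holo_transition c d /\ holo_transition d c.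

End ComplexManifold.

Section Lamination.
Variables (R : realType) (k : nat) (M : complexManifold R k).

(* A Riemann surface lamination on the subspace Y of M, with leaves immersed
   holomorphically in M: i : fbox indexes the flow boxes
   fmap i : fdom i -> fbase i * ftrans i, of inverse finv i.  A Hausdorff
   pseudometric space is a metric space; the point is only there to make its
   Borel sets a measurableType. *)
Record lamination (Y : set M) := Lamination {
  fbox : Type ;
  fdom : fbox -> set M ;
  fbase : fbox -> set (Cx R) ;
  ftrans : fbox -> pseudoPMetricType R ;
  fmap : forall i, M -> Cx R * ftrans i ;
  finv : forall i, Cx R * ftrans i -> M ;
  _ : forall i, exists2 O : set M, open O & fdom i = O `&` Y ;
  _ : forall p, Y p -> exists i, fdom i p ;
  _ : forall i, [/\ open (fbase i), connected (fbase i) & fbase i !=set0] ;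
  _ : forall i, hausdorff_space (ftrans i) /\ locally_compact [set: ftrans i] ;
  _ : forall i p, fdom i p -> fbase i (fmap i p).1 /\ finv (fmap i p) = p ;
  _ : forall i (z : Cx R * ftrans i), fbase i z.1 ->
        fdom i (finv z) /\ fmap i (finv z) = z ;
  _ : forall i, {within fdom i, continuous (fmap i)} ;
  _ : forall i, {within fbase i `*` [set: ftrans i], continuous (@finv i)} ;
  _ : forall i j, exists (Psi : Cx R * ftrans i -> Cx R)
                         (Lam : ftrans i -> ftrans j),
        forall p, fdom i p -> fdom j p ->
          [/\ fmap j p = (Psi (fmap i p), Lam (fmap i p).2),
              {for fmap i p, continuous Psi},
              {for (fmap i p).2, continuous Lam} &
              derivable (fun x : Cx R => Psi (x, (fmap i p).2)) (fmap i p).1 1] ;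
  _ : forall i c p, catlas c -> fdom i p -> cdom c p ->
        let gamma := fun x : Cx R => cmap c (finv (x, (fmap i p).2)) in
        derivable gamma (fmap i p).1 1 /\ derive1 gamma (fmap i p).1 != 0 }.

Section Leaves.
Variables (Y : set M) (L : lamination Y).

Definition plaque (i : fbox L) (t : ftrans i) : set M :=
  @finv _ L i @` (fbase i `*` [set t]).

Definition saturated (A : set M) : Prop :=
  forall (i : fbox L) (t : ftrans i), plaque t `&` A !=set0 -> plaque t `<=` A.

Definition leaf_like (A : set M) : Prop :=
  [/\ A `<=` Y, A !=set0, connected A & saturated A].

Definition is_leaf (A : set M) : Prop :=
  leaf_like A /\ forall A', leaf_like A' -> A' `<=` A -> A' = A.

(* Holomorphic for the Riemann surface structure of the leaves: locally phi
   stays in one plaque, and is holomorphic in the plaque coordinate. *)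
Definition leafwise_holo (S : set (Cx R)) (phi : Cx R -> M) : Prop :=
  forall s, S s -> Y (phi s) /\
    forall i : fbox L, fdom i (phi s) ->
      (\forall s' \near s,
         fdom i (phi s') /\ (fmap i (phi s')).2 = (fmap i (phi s)).2) /\
      derivable (fun s' : Cx R => (fmap i (phi s')).1) s 1.

(* phi : D -> A is a holomorphic covering of the leaf A for the leaf topology.
   The evenly covered neighbourhood of p is the piece of plaque over V, F is
   the set of sheets over it and sigma is the inverse of phi on a sheet. *)
Definition disc_covering (A : set M) (phi : Cx R -> M) : Prop :=
  [/\ leafwise_holo (@unit_disc R) phi,
      phi @` (@unit_disc R) = A &
      forall p, A p -> exists (i : fbox L) (V : set (Cx R)) (F : set (set (Cx R))),
        let t := (fmap i p).2 in
        [/\ fdom i p, [/\ open V, V `<=` fbase i & V (fmap i p).1],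
            trivIset F id,
            \bigcup_(W in F) W =
              @unit_disc R `&` phi @^-1` (@finv _ L i @` (V `*` [set t])) &
            forall W, F W -> open W /\
              exists sigma : Cx R -> Cx R,
                [/\ {within V, continuous sigma},
                    forall v, V v -> W (sigma v) /\ phi (sigma v) = finv (v, t) &
                    forall w, W w -> sigma (fmap i (phi w)).1 = w]]].

(* The density of omega_P with respect to i dx /\ d\bar x, x being the plaque
   coordinate in the flow box i, at p; it is such that phi^* omega_P is
   2 (1 - |zeta|^2)^-2 i d zeta /\ d\bar zeta for any covering phi of the leaf
   of p by the disc (the value depends neither on phi nor on zeta).  When the
   leaf of p is not hyperbolic there is no such phi and the value is 0. *)
Definition poincare_density (i : fbox L) (p : M) : R :=
  xget 0 [set d : R | exists A phi zeta,
    [/\ is_leaf A, disc_covering A phi, unit_disc zeta, phi zeta = p &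
        d = 2 / ((1 - cabs zeta ^+ 2) ^+ 2 *
                 cabs (derive1 (fun s : Cx R => (fmap i (phi s)).1) zeta) ^+ 2)]].

(* A real leafwise (1,1)-form alpha: alpha i p is the coefficient at p of
   i dx /\ d\bar x in the flow box i; only the values for p in fdom i matter. *)
Definition form := fbox L -> M -> R.

Definition base2 (i : fbox L) : set (R * R) := [set u | fbase i (cplx u)].

Definition in_box (i : fbox L) (f : M -> R) : R * R -> ftrans i -> R :=
  fun u t => f (finv (cplx u, t)).

Definition supported_in (alpha : form) (A : set M) : Prop :=
  exists2 K : set M, compact K /\ K `<=` A &
    forall (i : fbox L) p, fdom i p -> ~ K p -> alpha i p = 0.

Definition test_form (alpha : form) : Prop :=
  [/\ forall (i j : fbox L) p, fdom i p -> fdom j p ->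
        alpha i p = alpha j p * cabs (derive1
          (fun x : Cx R => (fmap j (finv (x, (fmap i p).2))).1) (fmap i p).1) ^+ 2,
      forall i, leaf_smooth (base2 i) (@in_box i (alpha i)) &
      supported_in alpha Y].

Definition test_function (f : M -> R) : Prop :=
  (forall i, leaf_smooth (base2 i) (@in_box i f)) /\ supported_in (fun=> f) Y.

(* i \partial\bar\partial f = (1/4) (f_uu + f_vv) i dx /\ d\bar x, x = u + iv *)
Definition ddbar (f : M -> R) : form := fun i p =>
  laplacian ((@in_box i f)^~ (fmap i p).2) (reim (fmap i p).1) / 4.

(* A positive current is real, so it is determined by its values on real
   forms; its positivity entails its continuity.  hc_mu and hc_h describe it in
   the flow boxes; the factor 2 comes from i dx /\ d\bar x = 2 du dv. *)
Record harmonicCurrent := HarmonicCurrent {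
  hc_fun : form -> R ;
  hc_mu : forall i : fbox L, {measure set (borel (ftrans i)) -> \bar R} ;
  hc_h : forall i : fbox L, ftrans i -> R * R -> R ;
  _ : forall (c : R) (alpha beta : form), test_form alpha -> test_form beta ->
        hc_fun (fun i p => c * alpha i p + beta i p) =
        c * hc_fun alpha + hc_fun beta ;
  _ : forall alpha : form, test_form alpha ->
        (forall i p, fdom i p -> 0 <= alpha i p) -> 0 <= hc_fun alpha ;
  _ : forall f, test_function f -> hc_fun (ddbar f) = 0 ;
  _ : forall i, radon (hc_mu i) ;
  _ : forall i u, base2 i u ->
        measurable_fun [set: borel (ftrans i)] (fun t : ftrans i => hc_h t u) ;
  _ : forall i, {ae hc_mu i, forall t,
        harmonic_on (base2 i) (hc_h t) /\ forall u, base2 i u -> 0 <= hc_h t u} ;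
  _ : forall i (alpha : form), test_form alpha -> supported_in alpha (fdom i) ->
        let slice := fun t : borel (ftrans i) =>
          \int[@leb2 R]_(u in base2 i) (hc_h t u * @in_box i (alpha i) u t * 2) in
        (hc_mu i).-integrable setT (EFin \o slice) /\
        hc_fun alpha = \int[hc_mu i]_t slice t }.

(* T /\ omega_P on the part of A in the flow box i *)
Definition box_mass (T : harmonicCurrent) (i : fbox L) (A : set M) : \bar R :=
  (\int[hc_mu T i]_t \int[@leb2 R]_(u in base2 i)
     (\1_A (finv (cplx u, t)) * hc_h T t u *
      poincare_density i (finv (cplx u, t)) * 2)%:E)%E.

(* The measure T /\ omega_P on Y, glued from the flow boxes: the supremum is
   over finite families of disjoint Borel pieces of A, each in a flow box. *)
Definition poincare_mass (T : harmonicCurrent) (A : set M) : \bar R :=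
  ereal_sup [set m | exists (n : nat) (b : 'I_n -> fbox L) (S : 'I_n -> set M),
    [/\ forall j, <<s @open M >> (S j) /\ S j `<=` A `&` fdom (b j),
        trivIset setT S & m = (\sum_(j < n) box_mass T (b j) (S j))%E]].

End Leaves.

Record singLamination := SingLamination {
  supp : set M ;
  sing : set M ;
  lam : lamination (supp `\` sing) ;
  _ : compact supp ;
  _ : finite_set sing ;
  _ : sing `<=` supp }.

(* In the coordinates c, through every point p of X \ E runs, inside its leaf,
   an integral curve of z |-> (lambda_j z_j)_j; as this field does not vanish at
   p, the curve fills a neighbourhood of p in its leaf. *)
Definition linearizable (X : singLamination) (a : M) : Prop :=
  exists (c : chart R k M) (lambda : 'rV[Cx R]_k),
    [/\ holo_coordinates c, cdom c a, cmap c a = 0,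
        forall j, lambda 0 j != 0 &
        forall p, (supp X `\` sing X) p -> cdom c p ->
          exists (S : set (Cx R)) (gamma : Cx R -> M),
            [/\ open S, connected S, S 0, gamma 0 = p &
                leafwise_holo (lam X) S gamma /\
                forall s, S s -> cdom c (gamma s) /\
                  is_derive s (1 : Cx R) (cmap c \o gamma)
                    (\row_j (lambda 0 j * cmap c (gamma s) 0 j))]].

End Lamination.

(* Main.v *)
(* The mass is computed against explicit test forms.  In linearizing coordinates
   z the flow of the vector field gives, through every point p of a leaf, a disc
   whose radius is a multiple of - ln |z(p)|; Schwarz's lemma for its lift to the
   unit disc bounds omega_P by a multiple of kappa / (s (ln s)^2), where s = |z|^2
   and kappa is the restriction to the leaves of i ddbar |z|^2.  This is the
   growth of i ddbar of ln(- ln s), up to sign.  Let u_N be a smooth convex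
   truncation of N - ln(- ln s), vanishing near the singularities (coordinate
   balls are put around all points of E) and constant away from them.  Then
   i ddbar u_N + eta >= 0 for a test form eta independent of N, and near a it
   dominates a multiple of omega_P on larger and larger sets as N grows; since
   <T, i ddbar u_N> = 0, the masses are bounded by a multiple of <T, eta>.  Passing
   from test forms to the Borel pieces defining the measure uses bump functions
   and the inner regularity of the measures in the flow boxes. *)
Require Import Defs.
From HB Require Import structures.
From mathcomp Require Import all_boot all_order all_algebra.
From mathcomp Require Import complex ring lra.
From mathcomp Require Import all_classical all_reals all_analysis measurable_realfun.

Import Defs.

Set Implicit Arguments.
Unset Strict Implicit.
Unset Printing Implicit Defensive.
Import Order.TTheory GRing.Theory Num.Theory.
Import numFieldNormedType.Exports.

Local Open Scope classical_set_scope.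
Local Open Scope ring_scope.

(** * Complex numbers as a plane *)

(** Linearity of the field is used only at [a], to bound the density. The truncated potential must
    vanish near every point of E, because i ddbar has zero integral only for functions with compact
    support in X minus E; at the other points any holomorphic chart will do. Indeed positivity
    reduces to two scalar inequalities: the radial form i d|z|^2 /\ dbar |z|^2 lies between 0 and s
    kappa, so i ddbar of theta(s) is positive as soon as theta' >= 0 and (s theta')' >= 0. The
    second fails only in a fixed annulus, where the potential is bent into a constant, and there by
    an amount independent of N: this is what eta repairs. The other obstacle is that the Poincare
    density is a choice among coverings, with no regularity across the plaques. In each flow box it
    is replaced by its continuous majorant kappa / (s (ln s)^2), and inner regularity is applied to
    the measure having that density. The complex analysis is built from Goursat's theorem: a crude
    bound for residues on squares yields Cauchy's estimate with the constant 16, whence the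
    regularity of holomorphic functions and the role of Schwarz's lemma. *)

Section ComplexModulus.
Variable R : realType.
Implicit Types (x y z : Cx R) (a b : R).

Notation Re := complex.Re.
Notation Im := complex.Im.

Lemma cabsE x : cabs x = Num.sqrt (Re x ^+ 2 + Im x ^+ 2).
Proof. by case: x. Qed.

Lemma normcabs x : `|x| = (cabs x)%:C%C.
Proof. by case: x. Qed.

Lemma cabs_ge0 x : 0 <= cabs x.
Proof. by rewrite cabsE sqrtr_ge0. Qed.

Lemma cabsM x y : cabs (x * y) = cabs x * cabs y.
Proof. exact: Normc.normcM. Qed.

Lemma cabsD x y : cabs (x + y) <= cabs x + cabs y.
Proof. exact: complex.le_normcD. Qed.

Lemma cabsN x : cabs (- x) = cabs x.
Proof. exact: complex.normcN. Qed.

Lemma cabsB x y : cabs (x - y) <= cabs x + cabs y.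
Proof. by rewrite -(cabsN y) cabsD. Qed.

Lemma cabsC x y : cabs (x - y) = cabs (y - x).
Proof. by rewrite -cabsN opprB. Qed.

Lemma cabs_triangle y x z : cabs (x - z) <= cabs (x - y) + cabs (y - z).
Proof. by rewrite (le_trans _ (cabsD _ _)) // addrA subrK. Qed.

Lemma cabs0 : cabs (0 : Cx R) = 0.
Proof. exact: Normc.normc0. Qed.

Lemma cabs1 : cabs (1 : Cx R) = 1.
Proof. exact: Normc.normc1. Qed.

Lemma cabs_eq0 x : (cabs x == 0) = (x == 0).
Proof.
apply/idP/idP => [/eqP /Normc.eq0_normc -> //|/eqP ->]; by rewrite ?cabs0 eqxx.
Qed.

Lemma cabs_gt0 x : (0 < cabs x) = (x != 0).
Proof. by rewrite lt_neqAle cabs_ge0 andbT eq_sym cabs_eq0. Qed.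

Lemma cabsV x : cabs (x^-1) = (cabs x)^-1.
Proof. exact: Normc.normcV. Qed.

Lemma cabsX x n : cabs (x ^+ n) = cabs x ^+ n.
Proof.
elim: n => [|n IH]; first by rewrite !expr0 cabs1.
by rewrite !exprS cabsM IH.
Qed.

Lemma cabsR a : cabs (a%:C%C : Cx R) = `|a|.
Proof. by rewrite cabsE /= expr0n /= addr0 sqrtr_sqr. Qed.

Lemma cabs2 x : cabs x ^+ 2 = Re x ^+ 2 + Im x ^+ 2.
Proof. by rewrite cabsE sqr_sqrtr // addr_ge0 // sqr_ge0. Qed.

Lemma Re_le_cabs x : `|Re x| <= cabs x.
Proof.
rewrite -(@ler_pXn2r _ 2) // ?nnegrE ?cabs_ge0 //.
by rewrite real_normK ?num_real // cabs2 lerDl sqr_ge0.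
Qed.

Lemma Im_le_cabs x : `|Im x| <= cabs x.
Proof.
rewrite -(@ler_pXn2r _ 2) // ?nnegrE ?cabs_ge0 //.
by rewrite real_normK ?num_real // cabs2 lerDr sqr_ge0.
Qed.

Lemma cabs_le_ReIm x : cabs x <= `|Re x| + `|Im x|.
Proof.
rewrite -(@ler_pXn2r _ 2) // ?nnegrE ?cabs_ge0 ?addr_ge0 //.
rewrite cabs2 sqrrD !real_normK ?num_real //.
by rewrite -addrA lerD2l lerDr mulrn_wge0 // mulr_ge0.
Qed.

Lemma cabs_dist x y : `|cabs x - cabs y| <= cabs (x - y).
Proof.
rewrite ler_norml; apply/andP; split.
  by rewrite lerNl opprB lerBlDr cabsC (le_trans _ (cabsD _ _)) // subrK.
by rewrite lerBlDr (le_trans _ (cabsD _ _)) // subrK.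
Qed.

Lemma cReD x y : Re (x + y) = Re x + Re y.
Proof. by case: x => ? ?; case: y. Qed.
Lemma cImD x y : Im (x + y) = Im x + Im y.
Proof. by case: x => ? ?; case: y. Qed.
Lemma cReN x : Re (- x) = - Re x. Proof. by case: x. Qed.
Lemma cImN x : Im (- x) = - Im x. Proof. by case: x. Qed.
Lemma cReM x y : Re (x * y) = Re x * Re y - Im x * Im y.
Proof. by case: x => ? ?; case: y. Qed.
Lemma cImM x y : Im (x * y) = Re x * Im y + Im x * Re y.
Proof. by case: x => ? ?; case: y. Qed.

Lemma cReB x y : Re (x - y) = Re x - Re y. Proof. by rewrite cReD cReN. Qed.
Lemma cImB x y : Im (x - y) = Im x - Im y. Proof. by rewrite cImD cImN. Qed.

Lemma cx_eq x y : Re x = Re y -> Im x = Im y -> x = y.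
Proof. by case: x => ? ?; case: y => ? ? /= -> ->. Qed.

Lemma cplxK (u : R * R) : reim (cplx u) = u. Proof. by case: u. Qed.
Lemma reimK x : cplx (reim x) = x. Proof. by case: x. Qed.

(** The norm of [Cx R] has values in [Cx R], so the radius of a ball is a complex number; being
    positive it is real, and its real part is the radius in [R]. *)
Lemma nbhs_cabsP x (A : set (Cx R)) :
  nbhs x A <-> exists2 e : R, 0 < e & forall y, cabs (y - x) < e -> A y.
Proof.
split=> [/nbhs_normP [e /= e0 eA]|[e e0 eA]].
  have eR : e = (Re e)%:C%C.
    move: e0; rewrite ltcE /=; case: e {eA} => a b /= /andP[/eqP -> _] //.
  exists (Re e) => [|y ye]; first by move: e0; rewrite ltcE => /andP[].
  apply: eA => /=; rewrite eR normcabs cabsC ltcR //.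
apply/nbhs_normP; exists e%:C%C => /=; first by rewrite ltcR.
by move=> y /=; rewrite normcabs ltcR cabsC => /eA.
Qed.

Lemma cvg_cabsP (T : Type) (F : set_system T) (FF : Filter F) (f : T -> Cx R) x :
  f @ F --> x <-> forall e : R, 0 < e -> \forall t \near F, cabs (f t - x) < e.
Proof.
split=> [fx e e0|fx A].
  by have /fx : nbhs x [set y | cabs (y - x) < e] by apply/nbhs_cabsP; exists e.
move=> /nbhs_cabsP [e e0 eA]; apply: filterS (fx _ e0) => t; exact: eA.
Qed.

Lemma near_cabs x (r : R) : 0 < r -> \forall y \near x, cabs (y - x) < r.
Proof. by move=> r0; apply/nbhs_cabsP; exists r. Qed.

Lemma open_disc x (r : R) : open [set y : Cx R | cabs (y - x) < r].
Proof.
rewrite openE => y /= yr; apply/nbhs_cabsP; exists (r - cabs (y - x)).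
  by rewrite subr_gt0.
move=> w wr; rewrite /= (le_lt_trans (cabs_triangle y _ _)) // -ltrBrDr //.
Qed.

Lemma continuous_cplx : continuous (@cplx R).
Proof.
move=> u; apply/cvg_cabsP => e e0.
have e20 : 0 < e / 2 by rewrite divr_gt0.
exists (ball u.1 (e / 2), ball u.2 (e / 2)).
  by split; apply: nbhsx_ballx.
move=> v [] /=; rewrite /ball /= => v1 v2.
rewrite (le_lt_trans (cabs_le_ReIm _)) //= (splitr e) ltrD // distrC //.
Qed.

Lemma continuous_Re : continuous (fun x : Cx R => Re x).
Proof.
move=> x; apply/(@cvgrPdist_lt _ _ _ _ (nbhs_filter x)) => e e0; apply/nbhs_cabsP; exists e => // y yx.
by rewrite (le_lt_trans _ yx) // -cReB cabsC Re_le_cabs.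
Qed.

Lemma continuous_Im : continuous (fun x : Cx R => Im x).
Proof.
move=> x; apply/(@cvgrPdist_lt _ _ _ _ (nbhs_filter x)) => e e0; apply/nbhs_cabsP; exists e => // y yx.
by rewrite (le_lt_trans _ yx) // -cImB cabsC Im_le_cabs.
Qed.

Lemma continuous_reim : continuous (@reim R).
Proof.
move=> x; exact: (cvg_pair (@continuous_Re x) (@continuous_Im x)).
Qed.

Lemma continuous_cabs : continuous (@cabs R).
Proof.
move=> x; apply/(@cvgrPdist_lt _ _ _ _ (nbhs_filter x)) => e e0; apply/nbhs_cabsP; exists e => // y yx.
by rewrite (le_lt_trans _ yx) // cabsC cabs_dist.
Qed.

Lemma compact_square (r : R) :
  compact [set x : Cx R | `|Re x| <= r /\ `|Im x| <= r].
Proof.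
have -> : [set x : Cx R | `|Re x| <= r /\ `|Im x| <= r] =
          @cplx R @` (`[-r, r]%classic `*` `[-r, r]%classic).
  apply/seteqP; split=> [x [xr xi]|_ [u [/= u1 u2] <-]] /=.
    exists (reim x); last exact: reimK.
    by split; rewrite /= in_itv /= -ler_norml.
  by move: u1 u2; rewrite !in_itv /= -!ler_norml.
apply: continuous_compact.
  by apply: continuous_subspaceT; exact: continuous_cplx.
by apply: compact_setX; exact: segment_compact.
Qed.

Lemma compact_cdisc x (r : R) : compact [set y : Cx R | cabs (y - x) <= r].
Proof.
have -> : [set y : Cx R | cabs (y - x) <= r] =
          (fun y => y + x) @` [set y : Cx R | cabs y <= r].
  apply/seteqP; split=> [y yr|_ [y yr <-]] /=; last by rewrite addrK.
  by exists (y - x); rewrite ?subrK.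
apply: continuous_compact.
  apply: continuous_subspaceT => y; apply/(cvg_cabsP (nbhs_filter y)) => e e0.
  by apply/nbhs_cabsP; exists e => // w; rewrite /= opprD addrACA subrr addr0.
apply: (subclosed_compact _ (@compact_square r)).
  rewrite (_ : [set _ | _] = (@cabs R) @^-1` [set s | s <= r]) //.
  by apply: closed_comp => [y _|]; [exact: continuous_cabs|exact: closed_le].
move=> y /= yr; split; apply: le_trans yr; [exact: Re_le_cabs|exact: Im_le_cabs].
Qed.

End ComplexModulus.

(** * Integrals of continuous functions over a segment *)

Section SegmentIntegral.
Variable R : realType.
Implicit Types (f g : R -> R) (a b c : R).

Definition seg_int f a b : R := \int[@lebesgue_measure R]_(x in `[a, b]) f x.

(** Two-sided continuity at each point, the endpoints included: stronger than continuity on the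
    segment, and inherited by subsegments. *)
Definition seg_cont f a b := forall x, a <= x <= b -> {for x, continuous f}.

Lemma seg_cont_integrable f a b : seg_cont f a b ->
  (@lebesgue_measure R).-integrable `[a, b] (EFin \o f).
Proof.
move=> cf; apply: continuous_compact_integrable; first exact: segment_compact.
apply: continuous_in_subspaceT => x; rewrite inE /= in_itv /=; exact: cf.
Qed.

Lemma seg_cont_sub f a b a' b' : a <= a' -> b' <= b ->
  seg_cont f a b -> seg_cont f a' b'.
Proof.
by move=> aa bb cf x /andP[ax xb]; apply: cf; rewrite (le_trans aa) // (le_trans xb).
Qed.

Lemma seg_contB f g a b : seg_cont f a b -> seg_cont g a b ->
  seg_cont (fun x => f x - g x) a b.
Proof. by move=> cf cg x xab; apply: cvgB; [exact: cf|exact: cg]. Qed.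

Lemma seg_int_cat f a b c : a <= b -> b <= c -> seg_cont f a c ->
  seg_int f a c = seg_int f a b + seg_int f b c.
Proof.
move=> ab bc cf; have fi := seg_cont_integrable cf.
have := @Rintegral_itvB _ f (BLeft a) (BRight c) b fi.
rewrite !bnd_simp => /(_ ab bc) H.
rewrite /seg_int -[X in _ = _ + X]Rintegral_itv_obnd_cbnd -?H 1?addrC ?subrK //.
apply: integrableS fi => //= x /=.
by rewrite !in_itv /= => /andP[bx ->]; rewrite (le_trans ab (ltW bx)).
Qed.

Lemma seg_intD f g a b : seg_cont f a b -> seg_cont g a b ->
  seg_int (fun x => f x + g x) a b = seg_int f a b + seg_int g a b.
Proof. by move=> cf cg; rewrite /seg_int RintegralD //; exact: seg_cont_integrable. Qed.

Lemma seg_int_le f a b C : a <= b -> seg_cont f a b ->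
  (forall x, a <= x <= b -> f x <= C) -> seg_int f a b <= C * (b - a).
Proof.
move=> ab cf fC; rewrite /seg_int.
have -> : C * (b - a) = \int[@lebesgue_measure R]_(x in `[a, b]) C.
  rewrite Rintegral_cst //= lebesgue_measure_itv /= lte_fin.
  by move: ab; rewrite le_eqVlt => /predU1P[->|->]; rewrite ?ltxx ?subrr.
apply: le_Rintegral => //; first exact: seg_cont_integrable.
by apply: (@seg_cont_integrable (fun=> C)) => ? _; exact: cvg_cst.
Qed.

Lemma seg_int_ge f a b C : a <= b -> seg_cont f a b ->
  (forall x, a <= x <= b -> C <= f x) -> C * (b - a) <= seg_int f a b.
Proof.
move=> ab cf fC; rewrite /seg_int.
have -> : C * (b - a) = \int[@lebesgue_measure R]_(x in `[a, b]) C.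
  rewrite Rintegral_cst //= lebesgue_measure_itv /= lte_fin.
  by move: ab; rewrite le_eqVlt => /predU1P[->|->]; rewrite ?ltxx ?subrr.
apply: le_Rintegral => //; last exact: seg_cont_integrable.
by apply: (@seg_cont_integrable (fun=> C)) => ? _; exact: cvg_cst.
Qed.

End SegmentIntegral.

(** * Goursat's theorem on rectangles *)

Section Goursat.
Variable R : realType.
Implicit Types (P Q : R -> R -> R) (a b c d : R).

(** The integral of P dx + Q dy along the boundary of the rectangle, counterclockwise, opposite
    sides being grouped into one integral of a difference. *)
Definition form_int P Q a b c d : R :=
  seg_int (fun x => P x c - P x d) a b + seg_int (fun y => Q b y - Q a y) c d.

(* P dx + Q dy is differentiable with d(P dx + Q dy) = 0 at the point. *)
Definition closed_at P Q (x0 y0 : R) := exists p1 p2 q2 : R,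
  forall e, 0 < e -> exists2 r, 0 < r & forall x y,
    `|x - x0| < r -> `|y - y0| < r ->
    `|P x y - P x0 y0 - (p1 * (x - x0) + p2 * (y - y0))| <=
      e * (`|x - x0| + `|y - y0|) /\
    `|Q x y - Q x0 y0 - (p2 * (x - x0) + q2 * (y - y0))| <=
      e * (`|x - x0| + `|y - y0|).

Definition closed_on P Q a b c d :=
  forall x y, a <= x <= b -> c <= y <= d -> closed_at P Q x y.

Lemma lin_bound_cvg (g : R -> R) (x0 p : R) :
  (exists2 r, 0 < r & forall x, `|x - x0| < r ->
    `|g x - g x0 - p * (x - x0)| <= `|x - x0|) -> {for x0, continuous g}.
Proof.
case=> r r0 gr; apply/(@cvgrPdist_lt _ _ _ _ (nbhs_filter x0)) => e e0.
have k0 : 0 < `|p| + 1 by rewrite ltr_wpDl.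
apply/nbhs_ballP; exists (Num.min r (e / (`|p| + 1))) => /=.
  by rewrite lt_min r0 divr_gt0.
move=> x; rewrite /ball /= lt_min => /andP[xr xe].
rewrite distrC in xr xe; rewrite distrC.
have := gr _ xr => H.
rewrite (_ : g x - g x0 = (g x - g x0 - p * (x - x0)) + p * (x - x0)); last by ring.
rewrite (le_lt_trans (ler_normD _ _)) //.
rewrite (@le_lt_trans _ _ ((`|p| + 1) * `|x - x0|)) //.
  by rewrite mulrDl mul1r addrC normrM lerD2l.
by rewrite mulrC -ltr_pdivlMr.
Qed.

Lemma closed_at_cont P Q x0 y0 : closed_at P Q x0 y0 ->
  {for x0, continuous (P ^~ y0)} /\ {for y0, continuous (Q x0)}.
Proof.
move=> [p1 [p2 [q2 /(_ 1 ltr01) [r r0 H]]]]; split.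
  apply: (@lin_bound_cvg _ _ p1); exists r => // x xr.
  have [] := H x y0 xr; first by rewrite subrr normr0.
  by rewrite subrr mulr0 normr0 !addr0 mul1r.
apply: (@lin_bound_cvg _ _ q2); exists r => // y yr.
have [|_] := H x0 y _ yr; first by rewrite subrr normr0.
by rewrite subrr mulr0 normr0 !add0r mul1r.
Qed.

Lemma closed_on_cont P Q a b c d : closed_on P Q a b c d ->
  (forall y, c <= y <= d -> seg_cont (P ^~ y) a b) /\
  (forall x, a <= x <= b -> seg_cont (Q x) c d).
Proof.
move=> H; split=> [y cd x ab|x ab y cd]; by have [] := closed_at_cont (H x y ab cd).
Qed.

Lemma closed_on_sub P Q a b c d a' b' c' d' :
  a <= a' -> b' <= b -> c <= c' -> d' <= d ->
  closed_on P Q a b c d -> closed_on P Q a' b' c' d'.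
Proof.
move=> aa bb cc dd H x y /andP[ax xb] /andP[cy yd].
by apply: H; [rewrite (le_trans aa) // (le_trans xb)|
  rewrite (le_trans cc) // (le_trans yd)].
Qed.

Lemma form_int_splitx P Q a b c d m : a <= m <= b ->
  seg_cont (P ^~ c) a b -> seg_cont (P ^~ d) a b ->
  seg_cont (Q a) c d -> seg_cont (Q m) c d -> seg_cont (Q b) c d ->
  form_int P Q a b c d = form_int P Q a m c d + form_int P Q m b c d.
Proof.
move=> /andP[am mb] Pc Pd Qa Qm Qb; rewrite /form_int.
rewrite (seg_int_cat am mb); last exact: seg_contB.
rewrite addrACA -[in RHS]seg_intD; [|exact: seg_contB..].
by congr (_ + seg_int _ _ _); apply/funext => y; ring.
Qed.

Lemma form_int_splity P Q a b c d m : c <= m <= d ->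
  seg_cont (Q a) c d -> seg_cont (Q b) c d ->
  seg_cont (P ^~ c) a b -> seg_cont (P ^~ m) a b -> seg_cont (P ^~ d) a b ->
  form_int P Q a b c d = form_int P Q a b c m + form_int P Q a b m d.
Proof.
move=> /andP[cm md] Qa Qb Pc Pm Pd; rewrite /form_int.
rewrite (seg_int_cat cm md); last exact: seg_contB.
rewrite addrACA -[in RHS]seg_intD; [|exact: seg_contB..].
by congr (seg_int _ _ _ + _); apply/funext => y; ring.
Qed.

Lemma form_int_quarter P Q x y W V : 0 <= W -> 0 <= V ->
  closed_on P Q x (x + (W + W)) y (y + (V + V)) ->
  form_int P Q x (x + (W + W)) y (y + (V + V)) =
     form_int P Q x (x + W) y (y + V) + form_int P Q x (x + W) (y + V) (y + V + V)
   + (form_int P Q (x + W) (x + W + W) y (y + V) +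
      form_int P Q (x + W) (x + W + W) (y + V) (y + V + V)).
Proof.
move=> W0 V0 Hs; have [cP cQ] := closed_on_cont Hs.
have x1 : x <= x + W by rewrite lerDl.
have x2 : x + W <= x + (W + W) by rewrite addrA lerDl.
have y1 : y <= y + V by rewrite lerDl.
have y2 : y + V <= y + (V + V) by rewrite addrA lerDl.
have x3 := le_trans x1 x2; have y3 := le_trans y1 y2.
have hx : x <= x <= x + (W + W) by rewrite lexx.
have hm : x <= x + W <= x + (W + W) by rewrite x1.
have hX : x <= x + (W + W) <= x + (W + W) by rewrite lexx x3.
have hy : y <= y <= y + (V + V) by rewrite lexx.
have hn : y <= y + V <= y + (V + V) by rewrite y1.
have hY : y <= y + (V + V) <= y + (V + V) by rewrite lexx y3.
have cPl z : y <= z <= y + (V + V) -> seg_cont (P ^~ z) x (x + W).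
  by move=> /cP; apply: seg_cont_sub.
have cPr z : y <= z <= y + (V + V) -> seg_cont (P ^~ z) (x + W) (x + (W + W)).
  by move=> /cP; apply: seg_cont_sub.
rewrite (@form_int_splitx _ _ _ _ _ _ (x + W)) //; [|by auto..].
rewrite (@form_int_splity _ _ x (x + W) _ _ (y + V)) //; [|by auto..].
rewrite (@form_int_splity _ _ (x + W) (x + (W + W)) _ _ (y + V)) //; [|by auto..].
by rewrite !addrA.
Qed.

(** Subtract the affine parts at (x0, y0): the horizontal sides contribute p2 (c' - d') (b' - a')
    and the vertical ones p2 (b' - a') (d' - c'), which cancel because the mixed coefficient is
    shared. Only the remainders are left, over sides of total length comparable to the perimeter. *)
Lemma form_int_small P Q a b c d x0 y0 : closed_on P Q a b c d ->
  a <= x0 <= b -> c <= y0 <= d ->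
  forall e, 0 < e -> exists2 r, 0 < r & forall a' b' c' d',
    a <= a' -> b' <= b -> c <= c' -> d' <= d ->
    a' <= x0 <= b' -> c' <= y0 <= d' ->
    (b' - a') + (d' - c') < r ->
    `|form_int P Q a' b' c' d'| <= e * ((b' - a') + (d' - c')) ^+ 2.
Proof.
move=> H abx cdy e e0; have [p1 [p2 [q2 pq]]] := H _ _ abx cdy.
have e20 : 0 < e / 2 by rewrite divr_gt0.
have [r r0 Hr] := pq _ e20.
exists r => // a' b' c' d' aa bb cc dd /andP[ax xb] /andP[cy yd].
have ab' := le_trans ax xb; have cd' := le_trans cy yd.
set S := (b' - a') + (d' - c') => Sr.
have [cP cQ] := closed_on_cont (closed_on_sub aa bb cc dd H).
have bnd x y : a' <= x <= b' -> c' <= y <= d' ->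
    `|x - x0| + `|y - y0| <= S /\ `|x - x0| < r /\ `|y - y0| < r.
  move=> /andP[x1 x2] /andP[y1 y2].
  have hx : `|x - x0| <= b' - a' by rewrite ler_norml; apply/andP; split; lra.
  have hy : `|y - y0| <= d' - c' by rewrite ler_norml; apply/andP; split; lra.
  split; first exact: lerD.
  by split; [apply: le_lt_trans hx _|apply: le_lt_trans hy _]; rewrite /S in Sr; lra.
have PB x : a' <= x <= b' -> `|P x c' - P x d' - p2 * (c' - d')| <= e * S.
  move=> xab; have cc' : c' <= c' <= d' by rewrite lexx.
  have dd' : c' <= d' <= d' by rewrite lexx cd'.
  have [s1 [x1 y1]] := bnd _ _ xab cc'; have [s2 [x2 y2]] := bnd _ _ xab dd'.
  have [H1 _] := Hr _ _ x1 y1; have [H2 _] := Hr _ _ x2 y2.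
  rewrite (_ : _ - _ = (P x c' - P x0 y0 - (p1 * (x - x0) + p2 * (c' - y0))) -
     (P x d' - P x0 y0 - (p1 * (x - x0) + p2 * (d' - y0)))); last by ring.
  rewrite (le_trans (ler_normB _ _)) // (le_trans (lerD H1 H2)) //.
  by rewrite -mulrDr -mulrA ler_pM2l // ler_pdivrMl // mulr2n mulrDl !mul1r lerD.
have QB y : c' <= y <= d' -> `|Q b' y - Q a' y - p2 * (b' - a')| <= e * S.
  move=> ycd; have cc' : a' <= a' <= b' by rewrite lexx.
  have dd' : a' <= b' <= b' by rewrite lexx ab'.
  have [s1 [x1 y1]] := bnd _ _ cc' ycd; have [s2 [x2 y2]] := bnd _ _ dd' ycd.
  have [_ H1] := Hr _ _ x1 y1; have [_ H2] := Hr _ _ x2 y2.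
  rewrite (_ : _ - _ = (Q b' y - Q x0 y0 - (p2 * (b' - x0) + q2 * (y - y0))) -
     (Q a' y - Q x0 y0 - (p2 * (a' - x0) + q2 * (y - y0)))); last by ring.
  rewrite (le_trans (ler_normB _ _)) // (le_trans (lerD H2 H1)) //.
  by rewrite -mulrDr -mulrA ler_pM2l // ler_pdivrMl // mulr2n mulrDl !mul1r lerD.
have scP : seg_cont (fun x => P x c' - P x d') a' b'.
  by apply: seg_contB; apply: cP; rewrite lexx cd'.
have scQ : seg_cont (fun y => Q b' y - Q a' y) c' d'.
  by apply: seg_contB; apply: cQ; rewrite lexx ab'.
rewrite /form_int ler_norml; apply/andP; split.
  have := @seg_int_ge _ _ _ _ (p2 * (c' - d') - e * S) ab' scP.
  have := @seg_int_ge _ _ _ _ (p2 * (b' - a') - e * S) cd' scQ.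
  move=> I2 I1; have {}I1 := I1 _; have {}I2 := I2 _.
  apply: le_trans (lerD (I1 _) (I2 _)).
  - by rewrite expr2 {1}/S; lra.
  - move=> x /PB; rewrite ler_norml => /andP[]; lra.
  - move=> y /QB; rewrite ler_norml => /andP[]; lra.
have := @seg_int_le _ _ _ _ (p2 * (c' - d') + e * S) ab' scP.
have := @seg_int_le _ _ _ _ (p2 * (b' - a') + e * S) cd' scQ.
move=> I2 I1; apply: le_trans (lerD (I1 _) (I2 _)) _.
- move=> x /PB; rewrite ler_norml => /andP[]; lra.
- move=> y /QB; rewrite ler_norml => /andP[]; lra.
- by rewrite expr2 {3}/S; lra.
Qed.

(** The common point is the supremum of the left ends, of which every right end is an upper
    bound. *)
Lemma nested_halves (x : nat -> R) (w : R) :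
  (forall n, x n <= x n.+1) ->
  (forall n, x n.+1 + w / 2 ^+ n.+1 <= x n + w / 2 ^+ n) -> 0 <= w ->
  exists X, forall n, x n <= X <= x n + w / 2 ^+ n.
Proof.
move=> xS xwS w0.
have xD n m : x n <= x (n + m)%N.
  by elim: m => [|m IH]; rewrite ?addn0 // addnS (le_trans IH).
have wD n m : x (n + m)%N + w / 2 ^+ (n + m) <= x n + w / 2 ^+ n.
  by elim: m => [|m IH]; rewrite ?addn0 // addnS (le_trans (xwS _)).
have xw n m : x m <= x n + w / 2 ^+ n.
  apply: (@le_trans _ _ (x (m + n)%N)) => //.
  rewrite addnC (le_trans _ (wD n m)) // lerDl divr_ge0 // exprn_ge0 //.
have h : has_sup (range x).
  split; first by exists (x 0%N), 0%N.
  by exists (x 0%N + w / 2 ^+ 0) => _ [m _ <-].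
exists (sup (range x)) => n; apply/andP; split.
  by apply: ub_le_sup; [case: h|exists n].
by apply: ge_sup; [case: h|move=> _ [m _ <-]].
Qed.

Lemma Goursat P Q a b c d : a <= b -> c <= d -> closed_on P Q a b c d ->
  form_int P Q a b c d = 0.
Proof.
move=> ab cd H.
pose w := b - a; pose h := d - c.
have w0 : 0 <= w by rewrite subr_ge0.
have h0 : 0 <= h by rewrite subr_ge0.
pose wn n := w / 2 ^+ n; pose hn n := h / 2 ^+ n.
have p2 n : (0 : R) < 2 ^+ n by rewrite exprn_gt0.
have wnS n : wn n = wn n.+1 + wn n.+1.
  by rewrite /wn exprS; field; rewrite gt_eqF.
have hnS n : hn n = hn n.+1 + hn n.+1.
  by rewrite /hn exprS; field; rewrite gt_eqF.
have wn0 n : 0 <= wn n by rewrite divr_ge0 // ltW.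
have hn0 n : 0 <= hn n by rewrite divr_ge0 // ltW.
pose inr (s : R * R * nat) := [/\ a <= s.1.1, s.1.1 + wn s.2 <= b,
  c <= s.1.2 & s.1.2 + hn s.2 <= d].
pose J (s : R * R * nat) :=
  `|form_int P Q s.1.1 (s.1.1 + wn s.2) s.1.2 (s.1.2 + hn s.2)|.
have step s : exists s', inr s ->
   [/\ inr s', s'.2 = s.2.+1, J s <= 4 * J s' &
     (s.1.1 <= s'.1.1 /\ s'.1.1 + wn s'.2 <= s.1.1 + wn s.2) /\
     (s.1.2 <= s'.1.2 /\ s'.1.2 + hn s'.2 <= s.1.2 + hn s.2)].
  (* A state that is not inside the original rectangle gets an arbitrary successor, so that [step]
     is total and choice applies. *)
  have [iN|nin] := pselect (inr s); last by exists s.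
  case: s iN => [[x y] n] [/= ax xb cy yd].
  pose W := wn n.+1; pose V := hn n.+1.
  have W0 : 0 <= W := wn0 _. have V0 : 0 <= V := hn0 _.
  rewrite wnS -/W in xb; rewrite hnS -/V in yd.
  have Hs : closed_on P Q x (x + (W + W)) y (y + (V + V)).
    exact: closed_on_sub H.
  have E := form_int_quarter W0 V0 Hs.
  have JE : J (x, y, n) = `|form_int P Q x (x + (W + W)) y (y + (V + V))|.
    by rewrite /J /= wnS hnS.
  pose j1 := J (x, y, n.+1); pose j2 := J (x, y + V, n.+1).
  pose j3 := J (x + W, y, n.+1); pose j4 := J (x + W, y + V, n.+1).
  have JS : J (x, y, n) <= j1 + j2 + (j3 + j4).
    rewrite JE E (le_trans (ler_normD _ _)) // lerD //;
    by rewrite (le_trans (ler_normD _ _)).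
  (* One of the four quarters carries at least a quarter of the integral. *)
  have : [\/ J (x, y, n) <= 4 * j1, J (x, y, n) <= 4 * j2,
            J (x, y, n) <= 4 * j3 | J (x, y, n) <= 4 * j4].
    have [?|?] := leP (J (x, y, n)) (4 * j1); first by constructor 1.
    have [?|?] := leP (J (x, y, n)) (4 * j2); first by constructor 2.
    have [?|?] := leP (J (x, y, n)) (4 * j3); first by constructor 3.
    by constructor 4; lra.
  rewrite /inr /= in ax cy *; rewrite (wnS n) (hnS n) -/W -/V.
  case=> Hj; [exists (x, y, n.+1)|exists (x, y + V, n.+1)|
      exists (x + W, y, n.+1)|exists (x + W, y + V, n.+1)] => _ /=;
      rewrite -/W -/V; clear -ax xb cy yd W0 V0 Hj; split => //; split => //; lra.
have [f Hf] := choice step.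
pose s n := iter n f (a, c, 0%N).
have s0 : inr (s 0%N).
  by split=> //=; rewrite /wn /hn /w /h expr0 divr1 addrC subrK.
have Hs n : inr (s n) /\ (s n).2 = n.
  elim: n => [|n [IH1 IH2]]; first by split.
  by have [i1 i2 _ _] := Hf _ IH1; split => //; rewrite [LHS]i2 IH2.
have sS n := Hf _ (Hs n).1.
have Jn n : J (s 0%N) <= 4 ^+ n * J (s n).
  elim: n => [|n IH]; first by rewrite expr0 mul1r.
  have [_ _ Jle _] := sS n; apply: le_trans IH _.
  by rewrite exprSr -mulrA ler_pM2l ?exprn_gt0.
have [X HX] := @nested_halves (fun n => (s n).1.1) w
  (fun n => let: And4 _ _ _ (conj (conj i _) _) := sS n in i)
  (fun n => ltac:(have [_ _ _ [[_ i] _]] := sS n;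
     rewrite (Hs n).2 -[f (s n)]/(s n.+1) (Hs n.+1).2 in i; exact i)) w0.
have [Y HY] := @nested_halves (fun n => (s n).1.2) h
  (fun n => let: And4 _ _ _ (conj _ (conj i _)) := sS n in i)
  (fun n => ltac:(have [_ _ _ [_ [_ i]]] := sS n;
     rewrite (Hs n).2 -[f (s n)]/(s n.+1) (Hs n.+1).2 in i; exact i)) h0.
have aX : a <= X <= b.
  have := HX 0%N; rewrite /= expr0 divr1 /w; lra.
have cY : c <= Y <= d.
  have := HY 0%N; rewrite /= expr0 divr1 /h; lra.
have J0E : J (s 0%N) = `|form_int P Q a b c d|.
  by rewrite /J /= /wn /hn expr0 !divr1 /w /h ![_ + (_ - _)]addrC !subrK.
(* The n-th rectangle has half-perimeter (w + h) / 2^n; the square of this in [form_int_small]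
   exactly balances the factor 4^n of [Jn]. *)
have Je e : 0 < e -> `|form_int P Q a b c d| <= e * (w + h) ^+ 2.
  move=> e0; have [r r0 Hr] := form_int_small H aX cY e0.
  have [n Hn] : exists n, (w + h) / 2 ^+ n < r.
    exists (Num.bound ((w + h) / r)).
    have := @archi_boundP _ ((w + h) / r) (divr_ge0 (addr_ge0 w0 h0) (ltW r0)).
    set m := Num.bound _ => Hm.
    rewrite ltr_pdivrMr // mulrC -ltr_pdivrMr // (lt_le_trans Hm) //.
    by rewrite -natrX ler_nat ltnW // ltn_expl.
  apply: (@le_trans _ _ (J (s 0%N))); first by rewrite J0E.
  apply: le_trans (Jn n) _; have [[i1 i2 i3 i4] i5] := Hs n.
  rewrite i5 in i2 i4; rewrite /J i5.
  have EE : (s n).1.1 + wn n - (s n).1.1 + ((s n).1.2 + hn n - (s n).1.2) =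
     (w + h) / 2 ^+ n by rewrite /wn /hn; lra.
  have := Hr _ _ _ _ i1 i2 i3 i4 (HX n) (HY n); rewrite EE => /(_ Hn).
  move=> /(ler_wpM2l (_ : 0 <= 4 ^+ n)) /le_trans; apply; first by rewrite exprn_ge0.
  rewrite expr_div_n mulrCA ler_pM2l // mulrCA -exprM mulnC exprM.
  by rewrite (_ : (2 : R) ^+ 2 = 4) ?mulfV ?mulr1 // ?expf_neq0 //; ring.
apply/eqP; rewrite -normr_eq0 eq_le normr_ge0 andbT; apply/ler_addgt0Pr => e e0; rewrite add0r.
have [S0|S0] := eqVneq (w + h) 0.
  by have := Je _ ltr01; rewrite S0 expr0n /= mulr0 => /le_trans; apply; exact: ltW.
have S2 : 0 < (w + h) ^+ 2 by rewrite exprn_gt0 // lt_neqAle eq_sym S0 addr_ge0.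
have := Je (e / (w + h) ^+ 2) (divr_gt0 e0 S2).
by rewrite divfK // gt_eqF.
Qed.

End Goursat.

(** * Complex derivatives *)

Section ComplexDerivative.
Variable R : realType.
Implicit Types (f g : Cx R -> Cx R) (x y z d : Cx R).

(** The derivative in remainder form, with real radii and errors. Nothing is divided, so y = x is
    allowed and the estimates can be added and composed. *)
Definition cderiv f x d := forall e : R, 0 < e -> exists2 r : R, 0 < r &
  forall y, cabs (y - x) < r -> cabs (f y - f x - d * (y - x)) <= e * cabs (y - x).

Lemma cderivP f x d : is_derive x 1 f d <-> cderiv f x d.
Proof.
split=> [[fx <-] e e0|H].
  have /cvg_cabsP /(_ _ e0) /nbhs_cabsP [r r0 Hr] := fx.
  exists r => // y yr; have [->|yx] := eqVneq y x.
    by rewrite !subrr mulr0 subrr cabs0 mulr0.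
  have yx0 : y - x != 0 by rewrite subr_eq0.
  have := Hr (y - x); rewrite subr0 => /(_ yr yx0).
  rewrite /= /GRing.scale /= mulr1 subrK => H.
  rewrite (_ : f y - f x - _ = ((y - x)^-1 * (f y - f x) - 'D_1 f x) * (y - x)).
    by rewrite cabsM ler_wpM2r ?cabs_ge0 // ltW.
  by rewrite mulrBl mulrAC mulVf // mul1r.
have fd : (fun h : Cx R => h^-1 *: ((f \o shift x) (h *: (1 : Cx R)) - f x)) @ 0^' --> d.
  apply/cvg_cabsP => e e0; have e20 : 0 < e / 2 by rewrite divr_gt0.
  have [r r0 Hr] := H _ e20; apply/nbhs_cabsP; exists r => // h.
  rewrite subr0 => hr h0 /=.
  have := Hr (h + x); rewrite addrK => /(_ hr).
  rewrite /GRing.scale /= mulr1 => H1.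
  rewrite (_ : _ - d = h^-1 * (f (h + x) - f x - d * h)); last first.
    by rewrite [RHS]mulrBr [h^-1 * (d * h)]mulrCA mulVf // mulr1.
  rewrite cabsM cabsV mulrC ltr_pdivrMr ?cabs_gt0 // (le_lt_trans H1) //.
  by rewrite ltr_pM2r ?cabs_gt0 // ltr_pdivrMr // ltr_pMr // ltr1n.
split; first by apply/cvg_ex; exists d.
exact: (cvg_lim _ fd).
Qed.

Lemma derivable_cderiv f x : derivable f x 1 -> cderiv f x (derive1 f x).
Proof. by move=> /derivableP fx; rewrite derive1E; apply/cderivP. Qed.

Lemma cderiv_derivable f x d : cderiv f x d -> derivable f x 1.
Proof. by move=> /cderivP []. Qed.

Lemma cderiv_derive1 f x d : cderiv f x d -> derive1 f x = d.
Proof. by rewrite derive1E => /cderivP []. Qed.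

Lemma cderiv_unique f x d d' : cderiv f x d -> cderiv f x d' -> d = d'.
Proof. by move=> /cderiv_derive1 <- /cderiv_derive1. Qed.

Lemma cderiv_near f g x d : (\forall y \near x, f y = g y) ->
  cderiv f x d -> cderiv g x d.
Proof. by move=> fg /cderivP fd; apply/cderivP; apply: near_eq_is_derive fd. Qed.

Lemma cderiv_cst (c : Cx R) x : cderiv (fun=> c) x 0.
Proof. by apply/cderivP; exact: is_derive_cst. Qed.

Lemma cderiv_id x : cderiv id x 1.
Proof. by apply/cderivP; exact: is_derive_id. Qed.

Lemma cderivD f g x a b : cderiv f x a -> cderiv g x b ->
  cderiv (fun y => f y + g y) x (a + b).
Proof. by move=> /cderivP fa /cderivP gb; apply/cderivP; exact: is_deriveD. Qed.

Lemma cderivB f g x a b : cderiv f x a -> cderiv g x b ->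
  cderiv (fun y => f y - g y) x (a - b).
Proof. by move=> /cderivP fa /cderivP gb; apply/cderivP; exact: is_deriveB. Qed.

Lemma cderivM f g x a b : cderiv f x a -> cderiv g x b ->
  cderiv (fun y => f y * g y) x (f x * b + g x * a).
Proof. by move=> /cderivP fa /cderivP gb; apply/cderivP; exact: is_deriveM. Qed.

Lemma cderiv_lip f x d : cderiv f x d -> exists2 r : R, 0 < r &
  forall y, cabs (y - x) < r -> cabs (f y - f x) <= (cabs d + 1) * cabs (y - x).
Proof.
move=> /(_ 1 ltr01) [r r0 H]; exists r => // y /H; rewrite mul1r => H1.
rewrite -[f y - f x](subrK (d * (y - x))) (le_trans (cabsD _ _)) //.
by rewrite cabsM mulrDl mul1r addrC lerD2l.
Qed.

Lemma cderiv_cont f x d : cderiv f x d -> {for x, continuous f}.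
Proof.
move=> /cderiv_lip [r r0 H]; apply/(cvg_cabsP (nbhs_filter x)) => e e0.
have d0 : 0 < cabs d + 1 by rewrite ltr_wpDl ?cabs_ge0.
apply/nbhs_cabsP; exists (Num.min r (e / (cabs d + 1))).
  by rewrite lt_min r0 divr_gt0.
move=> y; rewrite lt_min => /andP[/H H1 H2]; apply: le_lt_trans H1 _.
by rewrite mulrC -ltr_pdivlMr.
Qed.

Lemma cderiv_comp f g x a b : cderiv f x a -> cderiv g (f x) b ->
  cderiv (g \o f) x (b * a).
Proof.
move=> fa gb e e0; have [r1 r10 L] := cderiv_lip fa.
pose k := cabs a + 1; have k0 : 0 < k by rewrite ltr_wpDl ?cabs_ge0.
pose l := cabs b + 1; have l0 : 0 < l by rewrite ltr_wpDl ?cabs_ge0.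
have e1 : 0 < e / (2 * k) by rewrite divr_gt0 // mulr_gt0.
have e2 : 0 < e / (2 * l) by rewrite divr_gt0 // mulr_gt0.
have [s s0 G] := gb _ e1; have [r2 r20 F] := fa _ e2.
exists (Num.min r1 (Num.min r2 (s / k))).
  by rewrite !lt_min r10 r20 divr_gt0.
move=> y; rewrite !lt_min => /and3P[y1 y2 y3] /=.
have {}L := L _ y1; have {}F := F _ y2.
have {}G := G (f y) _.
have /G {}G : cabs (f y - f x) < s.
  by rewrite (le_lt_trans L) // mulrC -ltr_pdivlMr.
rewrite (_ : _ - _ = (g (f y) - g (f x) - b * (f y - f x)) +
   b * (f y - f x - a * (y - x))); last by ring.
rewrite (le_trans (cabsD _ _)) // (splitr e) mulrDl lerD //.
  rewrite (le_trans G) // (le_trans (ler_wpM2l (ltW e1) L)) //.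
  rewrite -/k le_eqVlt (_ : _ * (k * _) = e / 2 * cabs (y - x)) ?eqxx //.
  by field; rewrite gt_eqF.
rewrite cabsM (@le_trans _ _ (l * cabs (f y - f x - a * (y - x)))) //.
  by rewrite ler_wpM2r ?cabs_ge0 // lerDl.
rewrite (le_trans (ler_wpM2l (ltW l0) F)) // le_eqVlt.
rewrite (_ : l * _ = e / 2 * cabs (y - x)) ?eqxx //.
by field; rewrite gt_eqF.
Qed.

Lemma cderiv_inv z : z != 0 -> cderiv (fun y => y^-1) z (- (z ^+ 2)^-1).
Proof.
move=> z0; have az : 0 < cabs z by rewrite cabs_gt0.
move=> e e0; pose q := e * cabs z ^+ 3 / 2.
have q0 : 0 < q by rewrite divr_gt0 // mulr_gt0 // exprn_gt0.
exists (Num.min (cabs z / 2) q); first by rewrite lt_min divr_gt0.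
move=> y; rewrite lt_min => /andP[y1 y2].
have yz : cabs z / 2 <= cabs y.
  have := cabs_dist z y; rewrite ler_norml cabsC => /andP[_]; lra.
have y0 : y != 0 by rewrite -cabs_gt0 (lt_le_trans _ yz) // divr_gt0.
rewrite (_ : _ - _ = (y - z) * ((y - z) / (y * z ^+ 2))); last first.
  by field; rewrite y0 z0.
rewrite cabsM mulrC ler_wpM2r ?cabs_ge0 // cabsM cabsV cabsM cabsX.
rewrite ler_pdivrMr ?mulr_gt0 ?exprn_gt0 //; last first.
  by rewrite (lt_le_trans _ yz) // divr_gt0.
rewrite (le_trans (ltW y2)) // /q -mulrA ler_pM2l //.
rewrite mulrC (exprS _ 2) mulrA ler_wpM2r ?exprn_ge0 ?cabs_ge0 // mulrC //.
Qed.

Lemma cderivV f x a : f x != 0 -> cderiv f x a ->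
  cderiv (fun y => (f y)^-1) x (- (f x ^+ 2)^-1 * a).
Proof. by move=> fx0 fa; exact: (cderiv_comp fa (cderiv_inv fx0)). Qed.

(** The form is Im (f dz) = Im f dx + Re f dy. The derivative of Im f in y and that of Re f in x are
    both Re d: this Cauchy-Riemann equation is the equality of the mixed coefficients. *)
Lemma cderiv_closed_at f (x y : R) d : cderiv f (x +i* y)%C d ->
  closed_at (fun s t => complex.Im (f (s +i* t)%C))
            (fun s t => complex.Re (f (s +i* t)%C)) x y.
Proof.
move=> H; exists (complex.Im d), (complex.Re d), (- complex.Im d) => e e0.
have [r r0 Hr] := H _ e0; exists (r / 2); first by rewrite divr_gt0.
move=> s t sx ty; set w : Cx R := (s +i* t)%C; set z : Cx R := (x +i* y)%C.
have wz : cabs (w - z) <= `|s - x| + `|t - y| by exact: cabs_le_ReIm.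
have wr : cabs (w - z) < r.
  by rewrite (le_lt_trans wz) // (splitr r) ltrD.
have {}Hr := le_trans (Hr _ wr) (ler_wpM2l (ltW e0) wz).
split; apply: le_trans Hr.
  rewrite (_ : _ - _ = complex.Im (f w - f z - d * (w - z))) ?Im_le_cabs //.
  by rewrite cImB cImB cImM /=; ring.
rewrite (_ : _ - _ = complex.Re (f w - f z - d * (w - z))) ?Re_le_cabs //.
by rewrite cReB cReB cReM /=; ring.
Qed.

End ComplexDerivative.

(** * Residues and Cauchy's estimate *)

Section Residue.
Variable R : realType.
Implicit Types (h : Cx R -> Cx R) (z l : Cx R).

Notation Re := complex.Re.
Notation Im := complex.Im.

Lemma cabs_box_ge z (r : R) : 0 < r -> `|Re z| = r \/ `|Im z| = r -> r <= cabs z.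
Proof. by move=> r0 [<-|<-]; [exact: Re_le_cabs|exact: Im_le_cabs]. Qed.

(* The boundary integral of Im (h dz) over the square of radius r0 is at most
   8 r0 M, it does not change when the square shrinks to 0, and it tends to the
   one of Im (l dz / z), which is at least 4 l. *)
Lemma residue_bound_real h (l r0 M : R) : 0 < r0 -> 0 <= l ->
  (forall z, `|Re z| <= r0 -> `|Im z| <= r0 -> z != 0 -> exists d, cderiv h z d) ->
  (forall e : R, 0 < e -> exists2 r : R, 0 < r & forall z, z != 0 -> cabs z < r ->
     cabs (z * h z - l%:C%C) <= e) ->
  (forall z, `|Re z| <= r0 -> `|Im z| <= r0 -> `|Re z| = r0 \/ `|Im z| = r0 ->
     cabs (h z) <= M) ->
  l <= 2 * r0 * M.
Proof.
move=> r00 l0 hd hl hM.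
pose P s t := Im (h (s +i* t)%C); pose Q s t := Re (h (s +i* t)%C).
have box (x y : R) : - r0 <= x <= r0 -> - r0 <= y <= r0 -> x != 0 \/ y != 0 ->
    closed_at P Q x y.
  rewrite -!ler_norml => hx hy xy.
  have [|d /cderiv_closed_at //] := hd (x +i* y)%C hx hy.
  by rewrite eq_complex /= negb_and; apply/orP.
have cP (y : R) : - r0 <= y <= r0 -> y != 0 -> seg_cont (P ^~ y) (- r0) r0.
  move=> hy y0 x hx; by have [] := closed_at_cont (box x y hx hy (or_intror y0)).
have cQ (x : R) : - r0 <= x <= r0 -> x != 0 -> seg_cont (Q x) (- r0) r0.
  move=> hx x0 y hy; by have [] := closed_at_cont (box x y hx hy (or_introl x0)).
(* The frame between the two squares is cut into four rectangles avoiding 0: two of full height at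
   the sides, two above and below the small square. *)
have shrink (r : R) : 0 < r -> r <= r0 ->
    form_int P Q (- r0) r0 (- r0) r0 = form_int P Q (- r) r (- r) r.
  move=> rp rr0.
  have rN : - r0 <= - r by rewrite lerN2.
  have rm : - r <= r by rewrite (le_trans _ (ltW rp)) // oppr_le0 ltW.
  have h1 : - r0 <= - r0 <= r0 by rewrite lexx; lra.
  have h2 : - r0 <= - r <= r0 by rewrite rN; lra.
  have h3 : - r0 <= r <= r0 by rewrite rr0; lra.
  have h4 : - r0 <= r0 <= r0 by rewrite lexx; lra.
  have n1 : - r0 != 0 by rewrite oppr_eq0 gt_eqF.
  have n2 : - r != 0 by rewrite oppr_eq0 gt_eqF.
  have n3 : r != 0 by rewrite gt_eqF.
  have n4 : r0 != 0 by rewrite gt_eqF.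
  have cP' y x x' : - r0 <= y <= r0 -> y != 0 -> - r0 <= x -> x' <= r0 ->
      seg_cont (P ^~ y) x x'.
    by move=> hy y0 hx hx'; apply: seg_cont_sub (cP y hy y0).
  have cQ' x y y' : - r0 <= x <= r0 -> x != 0 -> - r0 <= y -> y' <= r0 ->
      seg_cont (Q x) y y'.
    by move=> hy y0 hx hx'; apply: seg_cont_sub (cQ x hy y0).
  have m1 : - r0 <= - r <= r0 by [].
  have m2 : - r <= r <= r0 by rewrite rm.
  have rle := le_trans rN rm; have rle2 := le_trans rm rr0.
  have r00' : - r0 <= r0 by rewrite (le_trans rN).
  have g1 : closed_on P Q (- r0) (- r) (- r0) r0.
    move=> x y /andP[x1 x2] /andP[y1 y2]; apply: box; last 1 first.
    + by left; rewrite lt_eqF // (le_lt_trans x2) // oppr_lt0.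
    + by rewrite x1 /= (le_trans x2) // (le_trans rm).
    + by rewrite y1.
  have g2 : closed_on P Q r r0 (- r0) r0.
    move=> x y /andP[x1 x2] /andP[y1 y2]; apply: box; last 1 first.
    + by left; rewrite gt_eqF // (lt_le_trans rp).
    + by rewrite x2 (le_trans _ x1).
    + by rewrite y1.
  have g3 : closed_on P Q (- r) r (- r0) (- r).
    move=> x y /andP[x1 x2] /andP[y1 y2]; apply: box; last 1 first.
    + by right; rewrite lt_eqF // (le_lt_trans y2) // oppr_lt0.
    + by rewrite (le_trans rN) //= (le_trans x2).
    + by rewrite y1 /= (le_trans y2) // (le_trans rm).
  have g4 : closed_on P Q (- r) r r r0.
    move=> x y /andP[x1 x2] /andP[y1 y2]; apply: box; last 1 first.
    + by right; rewrite gt_eqF // (lt_le_trans rp).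
    + by rewrite (le_trans rN) //= (le_trans x2).
    + by rewrite y2 (le_trans _ y1).
  rewrite (@form_int_splitx _ _ _ _ _ _ _ (- r)); [|by auto..].
  rewrite (@form_int_splitx _ _ _ (- r) r0 _ _ r); [|by auto..].
  rewrite (@form_int_splity _ _ _ (- r) r _ _ (- r)); [|by auto..].
  rewrite (@form_int_splity _ _ _ (- r) r (- r) r0 r); [|by auto..].
  rewrite (Goursat rN _ g1) // (Goursat rr0 _ g2) // (Goursat rm _ g3) //.
  by rewrite (Goursat rm _ g4) // !(addr0, add0r).
have r0N : - r0 <= r0 by rewrite (le_trans _ (ltW r00)) // oppr_le0 ltW.
have e1 : - r0 <= - r0 <= r0 by rewrite lexx.
have e2 : - r0 <= r0 <= r0 by rewrite lexx andbT.
have nN : - r0 != 0 by rewrite oppr_eq0 gt_eqF.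
have np : r0 != 0 by rewrite gt_eqF.
have up : form_int P Q (- r0) r0 (- r0) r0 <= 8 * r0 * M.
  have PM x y : `|x| <= r0 -> `|y| <= r0 -> `|x| = r0 \/ `|y| = r0 ->
      `|P x y| <= M /\ `|Q x y| <= M.
    move=> hx hy xy; have := hM (x +i* y)%C hx hy xy => H.
    by split; apply: le_trans H; [exact: Im_le_cabs|exact: Re_le_cabs].
  have aN : `|- r0| = r0 by rewrite normrN gtr0_norm.
  have aP : `|r0| = r0 by rewrite gtr0_norm.
  rewrite (_ : 8 * r0 * M = (2 * M) * (r0 - - r0) + (2 * M) * (r0 - - r0)); last by ring.
  apply: lerD; apply: seg_int_le => //.
  - by apply: seg_contB; apply: cP.
  - move=> x; rewrite -ler_norml => hx.
    have [|p1 _] := PM x (- r0) hx _ (or_intror aN); first by rewrite aN.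
    have [|p2 _] := PM x r0 hx _ (or_intror aP); first by rewrite aP.
    move: p1 p2; rewrite !ler_norml => /andP[_ p1] /andP[p2 _]; clear -p1 p2; lra.
  - by apply: seg_contB; apply: cQ.
  - move=> y; rewrite -ler_norml => hy.
    have [|_ p1] := PM (- r0) y _ hy (or_introl aN); first by rewrite aN.
    have [|_ p2] := PM r0 y _ hy (or_introl aP); first by rewrite aP.
    move: p1 p2; rewrite !ler_norml => /andP[p1 _] /andP[_ p2]; clear -p1 p2; lra.
suff low e : 0 < e -> 4 * (l - 2 * e) <= form_int P Q (- r0) r0 (- r0) r0.
  apply/ler_addgt0Pr => e ep.
  have e20 : 0 < e / 2 by rewrite divr_gt0.
  have := le_trans (low _ e20) up; clear; lra.
move=> ep; have [r1 r10 H1] := hl _ ep.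
(* On the small square the modulus is at most 2 r, which has to stay below r1. *)
pose r := Num.min r0 (r1 / 3).
have rp : 0 < r by rewrite lt_min r00 divr_gt0.
have rr0 : r <= r0 by rewrite ge_min lexx.
have r3 : r <= r1 / 3 by rewrite ge_min lexx orbT.
rewrite (shrink r) //.
have rmN : - r0 <= - r by rewrite lerN2.
have rm : - r <= r by rewrite (le_trans _ (ltW rp)) // oppr_le0 ltW.
have est z : `|Re z| <= r -> `|Im z| <= r -> `|Re z| = r \/ `|Im z| = r ->
    `|Re (h z) - l * Re z / cabs z ^+ 2| <= e / r /\
    `|Im (h z) + l * Im z / cabs z ^+ 2| <= e / r.
  move=> zr zi zb; have zr' := cabs_box_ge rp zb.
  have cz0 := lt_le_trans rp zr'.
  have z0 : z != 0 by rewrite -cabs_gt0.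
  have zr1 : cabs z < r1.
    rewrite (le_lt_trans (cabs_le_ReIm z)) // (le_lt_trans (lerD zr zi)) //.
    by clear -r3 r10; lra.
  have := H1 _ z0 zr1 => H.
  have E : h z - l%:C%C * z^-1 = (z * h z - l%:C%C) / z.
    by rewrite mulrBl mulrAC mulfV // mul1r.
  have EB : cabs (h z - l%:C%C * z^-1) <= e / r.
    rewrite E cabsM cabsV ler_pM ?cabs_ge0 ?invr_ge0 ?cabs_ge0 //.
    by rewrite lef_pV2.
  have zi2 : z^-1 = (Re z / cabs z ^+ 2 +i* (- Im z / cabs z ^+ 2))%C.
    rewrite cabs2; case: {+}z => u v /=.
    by apply: cx_eq; rewrite /= ?mulNr.
  split; apply: le_trans EB.
    apply: le_trans (Re_le_cabs _); rewrite zi2 cReB cReM /= mul0r subr0 mulrA.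
    exact: lexx.
  apply: le_trans (Im_le_cabs _); rewrite zi2 cImB cImM /= mul0r addr0.
  by rewrite mulNr mulrN opprK mulrA.
(* On the boundary x^2 + y^2 <= 2 r^2, so each of the four sides, of length 2 r, contributes at
   least l to the integral of Im (l dz / z). The exact total is 2 pi l; 4 l is enough. *)
have low2 (x y : R) : `|x| <= r -> `|y| <= r -> `|x| = r \/ `|y| = r ->
    l / (2 * r) <= l * r / (x ^+ 2 + y ^+ 2).
  move=> hx hy xy.
  have x2 : x ^+ 2 <= r ^+ 2 by rewrite -real_normK ?num_real // ler_pXn2r ?nnegrE // ltW.
  have y2 : y ^+ 2 <= r ^+ 2 by rewrite -real_normK ?num_real // ler_pXn2r ?nnegrE // ltW.
  have s0 : 0 < x ^+ 2 + y ^+ 2.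
    case: xy => E.
      by rewrite ltr_wpDr ?sqr_ge0 // -real_normK ?num_real // E exprn_gt0.
    by rewrite ltr_wpDl ?sqr_ge0 // -[y ^+ 2]real_normK ?num_real // E exprn_gt0.
  rewrite -mulrA ler_wpM2l // ler_pdivlMr // mulrC ler_pdivrMr ?mulr_gt0 //.
  by clear -x2 y2; rewrite expr2 in x2 y2 *; lra.
have aN : `|- r| = r by rewrite normrN gtr0_norm.
have aP : `|r| = r by rewrite gtr0_norm.
have B (x y : R) : `|x| <= r -> `|y| <= r -> `|x| = r \/ `|y| = r ->
    [/\ `|Q x y - l * x / (x ^+ 2 + y ^+ 2)| <= e / r,
        `|P x y + l * y / (x ^+ 2 + y ^+ 2)| <= e / r &
        l / (2 * r) <= l * r / (x ^+ 2 + y ^+ 2)].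
  move=> hx hy xy; have [Q1 P1] := est (x +i* y)%C hx hy xy.
  rewrite cabs2 /= in Q1 P1; split => //; exact: low2.
have lE : 4 * (l - 2 * e) = ((l - 2 * e) / r) * (r - - r) + ((l - 2 * e) / r) * (r - - r).
  by field; rewrite gt_eqF.
have rE : (l - 2 * e) / r = 2 * (l / (2 * r)) - 2 * (e / r).
  by field; rewrite gt_eqF.
have mN : - r0 <= - r <= r0 by rewrite rmN (le_trans rm).
have mP : - r0 <= r <= r0 by rewrite (le_trans rmN).
have n2 : - r != 0 by rewrite oppr_eq0 gt_eqF.
have n3 : r != 0 by rewrite gt_eqF.
rewrite lE; apply: lerD; apply: seg_int_ge => //.
- by apply: seg_contB; (apply: seg_cont_sub; last by apply: cP).
- move=> x; rewrite -ler_norml => hx; rewrite rE.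
  have [|_ p1 q1] := B x (- r) hx _ (or_intror aN); first by rewrite aN.
  have [|_ p2 q2] := B x r hx _ (or_intror aP); first by rewrite aP.
  move: p1 p2 q1 q2; rewrite sqrrN mulrN mulNr !ler_norml.
  set A := l * r / _; clear => /andP[a1 a2] /andP[b1 b2]; lra.
- by apply: seg_contB; (apply: seg_cont_sub; last by apply: cQ).
move=> y; rewrite -ler_norml => hy; rewrite rE.
have [|p1 _ q1] := B (- r) y _ hy (or_introl aN); first by rewrite aN.
have [|p2 _ q2] := B r y _ hy (or_introl aP); first by rewrite aP.
move: p1 p2 q1 q2; rewrite sqrrN mulrN mulNr !ler_norml.
set A := l * r / _; clear => /andP[a1 a2] /andP[b1 b2]; lra.
Qed.

Lemma residue_bound h l (r0 M : R) : 0 < r0 ->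
  (forall z, `|Re z| <= r0 -> `|Im z| <= r0 -> z != 0 -> exists d, cderiv h z d) ->
  (forall e : R, 0 < e -> exists2 r : R, 0 < r & forall z, z != 0 -> cabs z < r ->
     cabs (z * h z - l) <= e) ->
  (forall z, `|Re z| <= r0 -> `|Im z| <= r0 -> `|Re z| = r0 \/ `|Im z| = r0 ->
     cabs (h z) <= M) ->
  cabs l <= 2 * r0 * M.
Proof.
move=> r00 hd hl hM.
(* For l = 0 no rotation exists; M >= 0 suffices, and it is read at the boundary point r0. *)
have [l0|l0] := eqVneq l 0.
  have := hM r0%:C%C; rewrite /= normr0 gtr0_norm //.
  move=> /(_ (lexx _) (ltW r00) (or_introl erefl)) /(le_trans (cabs_ge0 _)) M0.
  by rewrite l0 cabs0 mulr_ge0 // mulr_ge0 // ltW.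
have cl0 : 0 < cabs l by rewrite cabs_gt0.
(* The unimodular number that turns l into its modulus. *)
pose u : Cx R := (cabs l)%:C%C / l.
have u1 : cabs u = 1.
  by rewrite cabsM cabsV cabsR ger0_norm ?cabs_ge0 // mulfV // gt_eqF.
apply: (@residue_bound_real (fun z => u * h z)) => //.
- exact: cabs_ge0.
- move=> z zr zi z0; have [d hzd] := hd z zr zi z0.
  by exists (u * d + h z * 0); apply: cderivM => //; exact: cderiv_cst.
- move=> e e0; have [r rp Hr] := hl _ e0; exists r => // z z0 zr.
  rewrite (_ : _ - _ = u * (z * h z - l)); first by rewrite cabsM u1 mul1r; exact: Hr.
  by rewrite mulrBr mulrCA /u divfK.
- by move=> z zr zi zb; rewrite cabsM u1 mul1r; exact: hM.
Qed.

(** The derivative d is the residue at 0 of (h (w + z) - h z) / w^2, which has a simple pole. On the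
    square of half-side s = r / 4, inside the disc, this function is at most 2 M / s^2, and
    [residue_bound] gives 2 s * 2 M / s^2 = 16 M / r. *)
Lemma Cauchy_estimate h z d (r M : R) : 0 < r ->
  (forall w, cabs (w - z) < r -> exists d', cderiv h w d') ->
  (forall w, cabs (w - z) < r -> cabs (h w) <= M) ->
  cderiv h z d -> cabs d <= 16 * M / r.
Proof.
move=> r0 hd hM hz; pose s := r / 4.
have s0 : 0 < s by rewrite divr_gt0.
have M0 : 0 <= M.
  by apply: le_trans (cabs_ge0 _) (hM z _); rewrite subrr cabs0.
have inD w : `|Re w| <= s -> `|Im w| <= s -> cabs ((w + z) - z) < r.
  move=> wr wi; rewrite addrK (le_lt_trans (cabs_le_ReIm _)) //.
  by rewrite (le_lt_trans (lerD wr wi)) // /s; clear -r0; lra.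
have sh w a : cderiv h (w + z) a -> cderiv (fun y => h (y + z)) w a.
  move=> ha; rewrite -[a]mulr1; apply: (@cderiv_comp _ (fun y => y + z)) ha.
  by rewrite -[1]addr0; apply: cderivD; [exact: cderiv_id|exact: cderiv_cst].
rewrite (_ : 16 * M / r = 2 * s * (2 * M / s ^+ 2)); last first.
  by rewrite /s; field; rewrite gt_eqF.
apply: (@residue_bound (fun w => (h (w + z) - h z) * (w ^+ 2)^-1)) => //.
- move=> w wr wi w0; have [a ha] := hd _ (inD w wr wi).
  eexists; apply: cderivM.
    by apply: cderivB; [exact: sh ha|exact: cderiv_cst].
  apply: cderivV; first by rewrite expf_neq0.
  rewrite (_ : (fun y => y ^+ 2) = (fun y : Cx R => y * y)); last first.
    by apply/funext => y; rewrite expr2.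
  by apply: cderivM; exact: cderiv_id.
- move=> e e0; have [t t0 Ht] := hz _ e0; exists t => // w w0 wt.
  have wzz : w + z - z = w by rewrite addrK.
  have := Ht (w + z); rewrite wzz => /(_ wt) H.
  rewrite (_ : _ - d = (h (w + z) - h z - d * w) / w); last by field.
  by rewrite cabsM cabsV ler_pdivrMr // cabs_gt0.
move=> w wr wi wb; rewrite cabsM cabsV cabsX.
have sw := cabs_box_ge s0 wb; have w0 := lt_le_trans s0 sw.
apply: ler_pM; rewrite ?cabs_ge0 ?invr_ge0 ?exprn_ge0 ?cabs_ge0 //.
  rewrite (le_trans (cabsB _ _)) // mulr2n mulrDl mul1r lerD //.
    by apply: hM; exact: inD.
  by apply: hM; rewrite subrr cabs0.
rewrite lef_pV2 ?posrE ?exprn_gt0 // ler_pXn2r ?nnegrE ?(ltW s0) ?(ltW w0) //.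
Qed.

End Residue.

(** * Regularity of holomorphic functions, from Cauchy's estimate *)

Section HolomorphicRegularity.
Variable R : realType.
Implicit Types (f : Cx R -> Cx R) (x w z d c : Cx R).

Notation Re := complex.Re.
Notation Im := complex.Im.

(** The factor [L] selects the real part for 1 and the imaginary part for - i. The map [g] is affine
    in the direction v with complex slope c: a segment for the mean value theorem, the
    identification of the plane with [Cx R] for partial derivatives. *)
Lemma cderiv_along (V : normedModType R) (g : V -> Cx R) (u v : V) f c d :
  (forall h : R, g (h *: v + u) = h%:C%C * c + g u) ->
  cderiv f (g u) d -> forall L : Cx R,
  is_derive u v (fun q => Re (L * f (g q))) (Re (L * (d * c))).
Proof.
move=> gv fd L.
have fL : cderiv (fun w => L * f w) (g u) (L * d).
  rewrite -[L * d]addr0 -(mulr0 (f (g u))); apply: cderivM fd.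
  exact: cderiv_cst.
have H : (fun h : R => h^-1 *: (((fun q => Re (L * f (g q))) \o shift u) (h *: v)
    - Re (L * f (g u)))) @ 0^' --> Re (L * (d * c)).
  apply/cvgrPdist_lt => e e0.
  have c0 : 0 < cabs c + 1 by rewrite ltr_wpDl ?cabs_ge0.
  have [r r0 Hr] := fL _ (divr_gt0 e0 c0).
  apply/nbhs_ballP; exists (r / (cabs c + 1)) => /=; first exact: divr_gt0.
  move=> h; rewrite /ball /= sub0r normrN => hr h0.
  have hc : cabs (h%:C%C * c) <= `|h| * (cabs c + 1).
    by rewrite cabsM cabsR ler_wpM2l // lerDl.
  have := Hr (h%:C%C * c + g u); rewrite addrK => /(_ _) H1.
  have {}H1 := H1 (le_lt_trans hc _).
  have {}H1 : cabs (L * f (h%:C%C * c + g u) - L * f (g u) - L * d * (h%:C%C * c)) <=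
      e / (cabs c + 1) * cabs (h%:C%C * c) by apply: H1; rewrite -ltr_pdivlMr.
  rewrite /= gv /GRing.scale /= distrC.
  have hN : `|h|^-1 * (e / (cabs c + 1) * cabs (h%:C%C * c)) < e.
    have E : `|h|^-1 * (e / (cabs c + 1) * (`|h| * cabs c)) = e * (cabs c / (cabs c + 1)).
      by field; rewrite normr_eq0 h0 gt_eqF.
    rewrite cabsM cabsR E.
    by rewrite gtr_pMr // ltr_pdivrMr // mul1r ltrDl.
  apply: le_lt_trans hN.
  rewrite -[X in _ - X](mulKf h0) -mulrBr normrM normfV.
  rewrite ler_wpM2l ?invr_ge0 //; apply: le_trans H1.
  apply: le_trans (Re_le_cabs _); rewrite le_eqVlt; apply/orP; left; apply/eqP.
  congr `|_|; rewrite !cReB; congr (_ - _).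
  rewrite (_ : L * d * (h%:C%C * c) = h%:C%C * (L * (d * c))); last by ring.
  by rewrite [in RHS]cReM /= mul0r subr0.
split; first by apply/cvg_ex; exists (Re (L * (d * c))).
exact: (cvg_lim _ H).
Qed.

Lemma Re_cderiv_along (V : normedModType R) (g : V -> Cx R) (u v : V) f c d :
  (forall h : R, g (h *: v + u) = h%:C%C * c + g u) ->
  cderiv f (g u) d -> is_derive u v (fun q => Re (f (g q))) (Re (d * c)).
Proof.
move=> gv fd; have := cderiv_along gv fd 1.
by rewrite mul1r; under eq_fun do rewrite mul1r.
Qed.

Lemma Im_cderiv_along (V : normedModType R) (g : V -> Cx R) (u v : V) f c d :
  (forall h : R, g (h *: v + u) = h%:C%C * c + g u) ->
  cderiv f (g u) d -> is_derive u v (fun q => Im (f (g q))) (Im (d * c)).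
Proof.
move=> gv fd; have := cderiv_along gv fd (0 -i* 1)%C.
have E z : Re ((0 -i* 1)%C * z) = Im z by case: z => a b /=; ring.
by rewrite E; under eq_fun do rewrite E.
Qed.

(** The real mean value theorem is applied along the segment to the real part of u * f, where the
    unimodular u makes the increment of f positive. *)
Lemma cderiv_mvt f w h (M : R) :
  (forall t : R, 0 <= t <= 1 -> exists2 d, cderiv f (w + t%:C%C * h) d & cabs d <= M) ->
  cabs (f (w + h) - f w) <= M * cabs h.
Proof.
move=> H; pose D := f (w + h) - f w.
have [D0|D0] := eqVneq D 0.
  rewrite -/D D0 cabs0 mulr_ge0 ?cabs_ge0 //.
  by have [|d _ /(le_trans (cabs_ge0 _))] := H 0; rewrite ?lexx ?ler01.
pose u := (cabs D)%:C%C / D.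
have u1 : cabs u = 1.
  by rewrite cabsM cabsV cabsR ger0_norm ?cabs_ge0 // mulfV // gt_eqF // cabs_gt0.
pose g (t : R) := w + t%:C%C * h.
have gv (t k : R) : g (k *: 1 + t) = k%:C%C * h + g t.
  by rewrite /g /GRing.scale /= mulr1 rmorphD /=; ring.
pose phi (t : R) := Re (u * f (g t)).
pose df (t : R) := xget 0 [set d | cderiv f (g t) d].
have fdf (t : R) : 0 <= t <= 1 -> cderiv f (g t) (df t) /\ cabs (df t) <= M.
  move=> t01; have [d fd dM] := H t t01.
  suff -> : df t = d by [].
  by rewrite /df; case: xgetP => [d' _ /= /cderiv_unique|/(_ d)] //; apply.
have phid (t : R) : 0 <= t <= 1 -> is_derive t 1 phi (Re (u * (df t * h))).
  by move=> /fdf [fd _]; exact: (cderiv_along (gv t) fd).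
have [||t t01 Ht] := @MVT_segment R phi (fun t => Re (u * (df t * h))) 0 1 ler01.
- move=> t; rewrite in_itv /= => /andP[t0 t1]; apply: phid.
  by rewrite (ltW t0) (ltW t1).
- apply: derivable_within_continuous => t; rewrite in_itv /= => t01.
  by have [] := phid t t01.
have E : phi 1 - phi 0 = cabs D.
  rewrite /phi /g -cReB -mulrBr mul1r mul0r addr0 -/D.
  by rewrite /u divfK.
rewrite -/D -E Ht subr0 mulr1 (le_trans (ler_norm _)) //.
rewrite (le_trans (Re_le_cabs _)) // cabsM u1 mul1r cabsM ler_wpM2r ?cabs_ge0 //.
by move: t01; rewrite in_itv /= => /fdf [].
Qed.

Lemma cderiv_zero_cst f x (r : R) :
  (forall w, cabs (w - x) < r -> cderiv f w 0) ->
  forall w, cabs (w - x) < r -> f w = f x.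
Proof.
move=> f0 w wr; apply/eqP; rewrite -subr_eq0 -cabs_eq0 eq_le cabs_ge0 andbT.
have := @cderiv_mvt f x (w - x) 0; rewrite mul0r [x + _]addrC subrK; apply.
move=> t /andP[t0 t1]; exists 0; last by rewrite cabs0.
apply: f0; rewrite [x + _]addrC addrK cabsM cabsR ger0_norm // (le_lt_trans _ wr) //.
by rewrite ler_piMl ?cabs_ge0.
Qed.

Lemma disc_segment x w h (r t : R) : cabs (w - x) < r -> cabs (w + h - x) < r ->
  0 <= t <= 1 -> cabs (w + t%:C%C * h - x) < r.
Proof.
move=> w1 w2 /andP[t0 t1].
rewrite (_ : _ - _ = (1 - t)%:C%C * (w - x) + t%:C%C * (w + h - x)); last first.
  by rewrite rmorphB rmorph1 /=; ring.
rewrite (le_lt_trans (cabsD _ _)) // !cabsM !cabsR !ger0_norm ?subr_ge0 //.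
have [->|tn] := eqVneq t 0; first by rewrite subr0 mul1r mul0r addr0.
rewrite (@lt_le_trans _ _ ((1 - t) * r + t * r)) //; last by rewrite -mulrDl subrK mul1r.
apply: ler_ltD; first by rewrite ler_wpM2l ?subr_ge0 // ltW.
by rewrite ltr_pM2l // lt_neqAle eq_sym tn.
Qed.

Section OneVariable.
Variables (f : Cx R -> Cx R) (x : Cx R) (r : R).
Hypothesis r0 : 0 < r.
Hypothesis fd : forall w, cabs (w - x) < r -> exists d, cderiv f w d.

Let f' := derive1 f.

Let ff' w : cabs (w - x) < r -> cderiv f w (f' w).
Proof. by move=> /fd [d wd]; rewrite /f' (cderiv_derive1 wd). Qed.

Let shiftd h w a : cderiv f (w + h) a -> cderiv (fun y => f (y + h)) w a.
Proof.
move=> ha; rewrite -[a]mulr1; apply: (@cderiv_comp _ (fun y => y + h)) ha.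
by rewrite -[1]addr0; apply: cderivD; [exact: cderiv_id|exact: cderiv_cst].
Qed.

(** Cauchy's estimate is used twice: for f, bounded near x by continuity, it bounds f'; for y |-> f
    (y + h) - f y, which the mean value theorem then bounds by M1 |h|, it gives the Lipschitz bound
    for f'. The second-order estimate is the mean value theorem for f minus its linear part at w. *)
Lemma cderiv_lipschitz : exists (s K : R), [/\ 0 < s, s <= r, 0 <= K &
  forall w h, cabs (w - x) < s -> cabs (w + h - x) < s ->
    cabs (f' (w + h) - f' w) <= K * cabs h /\
    cabs (f (w + h) - f w - f' w * h) <= K * cabs h ^+ 2].
Proof.
have fx : {for x, continuous f}.
  by apply: (@cderiv_cont _ _ _ (f' x)); apply: ff'; rewrite subrr cabs0.
have /(cvg_cabsP (nbhs_filter x)) /(_ 1 ltr01) /nbhs_cabsP [r1 r10 H1] := fx.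
pose r2 := Num.min r r1.
have r20 : 0 < r2 by rewrite lt_min r0.
pose M := cabs (f x) + 1.
have M0 : 0 <= M by rewrite addr_ge0 ?cabs_ge0.
have fM w : cabs (w - x) < r2 -> cabs (f w) <= M.
  rewrite lt_min => /andP[_ /H1 wx]; rewrite -[f w](subrK (f x)) addrC.
  by rewrite (le_trans (cabsD _ _)) // lerD2l ltW.
have r2r w : cabs (w - x) < r2 -> cabs (w - x) < r.
  by rewrite lt_min => /andP[].
have near2 (a b : R) z w : cabs (z - x) < a -> cabs (w - z) < b -> cabs (w - x) < a + b.
  by move=> za wb; rewrite (le_lt_trans (cabs_triangle z _ _)) // addrC ltrD.
pose M1 := 16 * M / (r2 / 2).
have fM1 w : cabs (w - x) < r2 / 2 -> cabs (f' w) <= M1.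
  move=> wx; apply: (@Cauchy_estimate _ f w).
  - by rewrite divr_gt0.
  - by move=> y yw; apply: fd; apply: r2r; rewrite (splitr r2); exact: near2 wx yw.
  - by move=> y yw; apply: fM; rewrite (splitr r2); exact: near2 wx yw.
  - by apply: ff'; apply: r2r; rewrite (lt_trans wx) // ltr_pdivrMr // ltr_pMr // ltr1n.
have M10 : 0 <= M1 by rewrite /M1 divr_ge0 ?mulr_ge0 // ltW // divr_gt0.
pose s := r2 / 4 / 2 / 2; have s0 : 0 < s by rewrite !divr_gt0.
have s4 : s + s = r2 / 4 / 2 by rewrite /s; lra.
pose K := 16 * M1 / s.
have K0 : 0 <= K by exact: (divr_ge0 (mulr_ge0 (ler0n _ 16) M10) (ltW s0)).
have sr2 : s < r2 by rewrite /s; lra.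
have L w h : cabs (w - x) < s -> cabs (w + h - x) < s ->
    cabs (f' (w + h) - f' w) <= K * cabs h.
  move=> ws whs.
  rewrite (_ : K * cabs h = 16 * (M1 * cabs h) / s); last by rewrite /K; ring.
  apply: (@Cauchy_estimate _ (fun y => f (y + h) - f y) w) => //.
  - move=> y yw; have y2 := near2 _ _ _ _ ws yw.
    have yh : cabs (y + h - (w + h)) < s by rewrite opprD addrACA subrr addr0.
    have y3 := near2 _ _ _ _ whs yh.
    exists (f' (y + h) - f' y); apply: cderivB; [apply: shiftd|]; apply: ff'; apply: r2r;
      [apply: lt_trans y3 _|apply: lt_trans y2 _]; rewrite s4; lra.
  - move=> y yw; have y2 := near2 _ _ _ _ ws yw.
    have yh : cabs (y + h - (w + h)) < s by rewrite opprD addrACA subrr addr0.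
    have y3 := near2 _ _ _ _ whs yh.
    apply: cderiv_mvt => t t01; exists (f' (y + t%:C%C * h)).
      apply: ff'; apply: r2r; apply: lt_trans (disc_segment y2 y3 t01) _.
      by rewrite s4; lra.
    apply: fM1; apply: lt_trans (disc_segment y2 y3 t01) _.
    by rewrite s4; lra.
  - apply: cderivB; [apply: shiftd|]; apply: ff'; apply: r2r.
      exact: lt_trans whs sr2.
    exact: lt_trans ws sr2.
exists s, K; split => //; first by rewrite (le_trans (ltW sr2)) // ge_min lexx.
move=> w h ws whs; split; first exact: L.
rewrite expr2 mulrA.
have := @cderiv_mvt (fun y => f y - f' w * y) w h (K * cabs h).
rewrite (_ : _ - _ - _ = f (w + h) - f w - f' w * h); last by ring.
apply => t t01; exists (f' (w + t%:C%C * h) - f' w).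
  have fwd : cderiv ( *%R (f' w)) (w + t%:C%C * h) (f' w).
    have := cderivM (cderiv_cst (f' w) (w + t%:C%C * h)) (cderiv_id (w + t%:C%C * h)).
    by rewrite mulr1 mulr0 addr0.
  refine (@cderivB _ f ( *%R (f' w)) _ _ _ (ff' (r2r _ _)) fwd).
  exact: lt_trans (disc_segment ws whs t01) sr2.
apply: le_trans (L w (t%:C%C * h) ws (disc_segment ws whs t01)) _.
rewrite ler_wpM2l // cabsM cabsR.
by move/andP: t01 => [t0 t1]; rewrite ger0_norm // ler_piMl ?cabs_ge0.
Qed.

(** The difference quotients [q h] approach f' uniformly, with error K |h|. By Cauchy's estimate
    their derivatives at x, which are the difference quotients [D h] of f', satisfy Cauchy's
    criterion as h tends to 0. *)
Lemma cderiv_second : exists d, cderiv f' x d.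
Proof.
have [s [K [s0 sr K0 HK]]] := cderiv_lipschitz.
pose q h := fun w => (f (w + h) - f w) / h.
pose D h := (f' (x + h) - f' x) / h.
pose s2 := s / 2; have s20 : 0 < s2 by rewrite divr_gt0.
have inD w h : cabs (w - x) < s2 -> cabs h < s2 -> cabs (w - x) < s /\ cabs (w + h - x) < s.
  move=> w1 h1; split; first by rewrite (lt_trans w1) // /s2; lra.
  by rewrite addrAC (le_lt_trans (cabsD _ _)) // (splitr s) ltrD.
have qd h w : h != 0 -> cabs h < s2 -> cabs (w - x) < s2 ->
    cderiv (q h) w ((f' (w + h) - f' w) / h).
  move=> h0 hs ws; have [w1 w2] := inD w h ws hs.
  have := @cderivM _ (fun y => f (y + h) - f y) (fun=> h^-1) w (f' (w + h) - f' w) 0.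
  rewrite mulr0 add0r [_^-1 * _]mulrC; apply; last exact: cderiv_cst.
  apply: cderivB; [apply: shiftd|]; apply: ff'.
    exact: lt_le_trans w2 sr.
  exact: lt_le_trans w1 sr.
have qf h w : h != 0 -> cabs h < s2 -> cabs (w - x) < s2 -> cabs (q h w - f' w) <= K * cabs h.
  move=> h0 hs ws; have [w1 w2] := inD w h ws hs; have [_ H2] := HK w h w1 w2.
  rewrite /q (_ : _ - _ = (f (w + h) - f w - f' w * h) / h).
    by rewrite cabsM cabsV ler_pdivrMr ?cabs_gt0 // -mulrA -expr2.
  by field.
have xs : cabs (x - x) < s2 by rewrite subrr cabs0.
have DD h k : h != 0 -> k != 0 -> cabs h < s2 -> cabs k < s2 ->
    cabs (D h - D k) <= 16 * (K * (cabs h + cabs k)) / s2.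
  move=> h0 k0 hs ks; apply: (@Cauchy_estimate _ (fun w => q h w - q k w) x) => //.
  - by move=> w ws; eexists; apply: cderivB; apply: qd.
  - move=> w ws; rewrite mulrDr.
    rewrite (_ : _ - _ = (q h w - f' w) - (q k w - f' w)); last by ring.
    by rewrite (le_trans (cabsB _ _)) // lerD // qf.
  - by apply: cderivB; apply: qd.
pose C := 16 * K / s2 + 1.
have C0 : 0 < C by rewrite ltr_wpDl // (divr_ge0 (mulr_ge0 (ler0n _ 16) K0) (ltW s20)).
have DC h k : h != 0 -> k != 0 -> cabs h < s2 -> cabs k < s2 ->
    cabs (D h - D k) <= C * (cabs h + cabs k).
  move=> h0 k0 hs ks; apply: le_trans (DD h k h0 k0 hs ks) _.
  rewrite (_ : 16 * (K * _) / s2 = 16 * K / s2 * (cabs h + cabs k)); last by ring.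
  by rewrite /C [leRHS]mulrDl mul1r lerDl addr_ge0 ?cabs_ge0.
(* Completeness is used in [R], for the real and the imaginary part of [D] separately. *)
have cau (p : Cx R -> R) : (forall a b, `|p a - p b| <= cabs (a - b)) ->
    cvg ((p \o D) @ (0 : Cx R)^').
  move=> pl; apply: cauchy_cvg; apply: cauchy_exP => e e0.
  pose t := Num.min s2 (e / (2 * C)) / 2.
  have t0 : 0 < t by rewrite divr_gt0 // lt_min s20 divr_gt0 // mulr_gt0.
  have tn : (t%:C%C : Cx R) != 0 by rewrite -cabs_gt0 cabsR normr_gt0 gt_eqF.
  have ts : t < Num.min s2 (e / (2 * C)) by rewrite ltr_pdivrMr // ltr_pMr ?ltr1n // -(@pmulr_lgt0 _ 2^-1) // .
  move: (ts); rewrite lt_min => /andP[ts2 te].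
  exists (p (D t%:C%C)); apply/nbhs_cabsP; exists t => // h; rewrite subr0 => ht h0.
  rewrite /ball /= (le_lt_trans (pl _ _)) //.
  have ct : cabs (t%:C%C : Cx R) = t by rewrite cabsR gtr0_norm.
  apply: le_lt_trans (DC _ _ tn h0 _ (lt_trans ht ts2)) _; first by rewrite ct.
  rewrite ct mulrC -ltr_pdivlMr //.
  rewrite (_ : e / C = e / (2 * C) + e / (2 * C)); last by field; rewrite gt_eqF.
  by rewrite ltrD // (lt_trans ht).
have cRe := cau (@complex.Re R) (fun a b => ltac:(by rewrite -cReB Re_le_cabs)).
have cIm := cau (@complex.Im R) (fun a b => ltac:(by rewrite -cImB Im_le_cabs)).
pose d : Cx R := (lim ((@complex.Re R \o D) @ (0 : Cx R)^') +i* lim ((@complex.Im R \o D) @ (0 : Cx R)^'))%C.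
exists d => e e0.
have e20 : 0 < e / 2 by rewrite divr_gt0.
have /cvgrPdist_lt /(_ _ e20) /nbhs_cabsP [t1 t10 H1] := cRe.
have /cvgrPdist_lt /(_ _ e20) /nbhs_cabsP [t2 t20 H2] := cIm.
exists (Num.min t1 t2); first by rewrite lt_min t10.
move=> y; rewrite lt_min => /andP[y1 y2]; have [->|yx] := eqVneq y x.
  by rewrite !subrr mulr0 subrr cabs0 mulr0.
have h0 : y - x != 0 by rewrite subr_eq0.
have := H1 (y - x); have := H2 (y - x); rewrite subr0 => /(_ y2 h0) i2 /(_ y1 h0) i1.
rewrite (_ : _ - _ = (D (y - x) - d) * (y - x)); last first.
  by rewrite /D [x + _]addrC subrK mulrBl divfK.
rewrite cabsM ler_wpM2r ?cabs_ge0 // ltW // (le_lt_trans (cabs_le_ReIm _)) //.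
by rewrite (splitr e) ltrD // ?cReB ?cImB distrC.
Qed.

End OneVariable.

(** By compactness of a closed disc, f (., u) is uniformly close to f (., t) there when u is near t;
    Cauchy's estimate carries this over to the derivatives, and f' (., t) is itself continuous. *)
Lemma cderiv_joint_cont (T : topologicalType) (f : Cx R -> T -> Cx R) x (t : T) :
  (\forall q \near (x, t), (exists d, cderiv (f ^~ q.2) q.1 d) /\
     {for q, continuous (fun q : Cx R * T => f q.1 q.2)}) ->
  {for (x, t), continuous (fun q : Cx R * T => derive1 (f ^~ q.2) q.1)}.
Proof.
move=> [[A U] /= [/nbhs_cabsP [r r0 rA] Ut] AU].
have fd w u : cabs (w - x) < r -> U u -> exists d, cderiv (f ^~ u) w d.
  by move=> wr Uu; have [] := AU (w, u) (conj (rA _ wr) Uu).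
have fc w u : cabs (w - x) < r -> U u ->
    {for (w, u), continuous (fun q : Cx R * T => f q.1 q.2)}.
  by move=> wr Uu; have [] := AU (w, u) (conj (rA _ wr) Uu).
have tU := nbhs_singleton Ut.
have [d2 /cderiv_cont c2] := cderiv_second r0 (fun w wr => fd w t wr tU).
apply/(cvg_cabsP (nbhs_filter (x, t))) => e e0.
have e20 : 0 < e / 2 by rewrite divr_gt0.
have /(cvg_cabsP (nbhs_filter x)) /(_ _ e20) /nbhs_cabsP [s s0 Hs] := c2.
pose r2 := r / 2; have r20 : 0 < r2 by rewrite divr_gt0.
pose r4 := r2 / 2; have r40 : 0 < r4 by rewrite divr_gt0.
pose k := e / 2 * r4 / 16 / 2; have k0 : 0 < k by rewrite !divr_gt0 // mulr_gt0.
have r2r : r2 < r by rewrite /r2; lra.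
have unif : \forall u \near t, [set w | cabs (w - x) <= r2] `<=`
    (fun w => cabs (f w u - f w t) <= k).
  have /compact_near_coveringP cK := @compact_cdisc R x r2.
  apply: cK => w /= wr2; have wr := le_lt_trans wr2 r2r.
  have k20 : 0 < k / 2 by rewrite divr_gt0.
  have /(cvg_cabsP (nbhs_filter (w, t))) /(_ _ k20) [[B V] /= [Bw Vt] BV] := fc _ _ wr tU.
  exists (B, V) => // -[w' u] /= [Bw' Vu].
  have h1 := BV (w', u) (conj Bw' Vu); have h2 := BV (w', t) (conj Bw' (nbhs_singleton Vt)).
  rewrite ltW // (le_lt_trans (cabs_triangle (f w t) _ _)) // (splitr k) ltrD //.
  by rewrite cabsC.
have xs := near_cabs x (_ : 0 < Num.min s r4).
have {}xs := xs ltac:(by rewrite lt_min s0).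
exists ([set y | cabs (y - x) < Num.min s r4],
        [set u | [set w | cabs (w - x) <= r2] `<=` (fun w => cabs (f w u - f w t) <= k)] `&` U) => /=.
  by split => //; apply: filterI.
move=> -[y u] /= []; rewrite lt_min => /andP[ys yr] [Hu Uu].
apply: le_lt_trans (cabs_triangle (derive1 (f ^~ t) y) _ _) _.
rewrite (splitr e) ler_ltD // ?Hs //.
have yr' w : cabs (w - y) < r4 -> cabs (w - x) < r2.
  by move=> wy; rewrite (le_lt_trans (cabs_triangle y _ _)) // (splitr r2) ltrD.
have yr'' w : cabs (w - y) < r4 -> cabs (w - x) < r.
  by move=> /yr' wy; exact: lt_trans wy r2r.
have yy : cabs (y - y) < r4 by rewrite subrr cabs0.
have cd w v : cabs (w - x) < r -> U v -> cderiv (f ^~ v) w (derive1 (f ^~ v) w).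
  by move=> wr Uv; have [d wd] := fd w v wr Uv; rewrite (cderiv_derive1 wd).
apply: le_trans (@Cauchy_estimate _ (fun w => f w u - f w t) y _ r4 k r40 _ _ _) _.
- by move=> w /yr'' wr; eexists; apply: cderivB; apply: cd.
- by move=> w /yr' wr; apply: Hu; exact: ltW.
- by apply: cderivB; apply: cd => //; exact: yr''.
have p0 : 0 < e / 2 * r4 by rewrite mulr_gt0.
by rewrite ler_pdivrMr // /k; clear -p0; lra.
Qed.

(** Near x, either f' w = 0 or |f' w| >= 1 / B, since 1 / (f - f w) has a simple pole at w whose
    residue is bounded uniformly in w. If f' x were 0, continuity of f' would exclude the second
    case near x, so f would be constant on a disc and not injective. *)
Lemma injective_cderiv_neq0 f x (r : R) d : 0 < r ->
  (forall w, cabs (w - x) < r -> exists d, cderiv f w d) ->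
  (forall w w', cabs (w - x) < r -> cabs (w' - x) < r -> f w = f w' -> w = w') ->
  cderiv f x d -> d != 0.
Proof.
move=> r0 fd finj fxd.
have ff' w : cabs (w - x) < r -> cderiv f w (derive1 f w).
  by move=> /fd [a wa]; rewrite (cderiv_derive1 wa).
have [d2 /cderiv_cont c2] := cderiv_second r0 fd.
pose s := r / 4; have s0 : 0 < s by rewrite divr_gt0.
pose K : set (Cx R) := [set z | (`|Re z| <= s /\ `|Im z| <= s) /\ (`|Re z| = s \/ `|Im z| = s)].
have Ks z : K z -> cabs z <= s + s.
  by move=> [[zr zi] _]; rewrite (le_trans (cabs_le_ReIm _)) // lerD.
have inr w z : cabs (w - x) < s -> K z -> cabs (z + w - x) < r.
  move=> ws /Ks zs; rewrite -addrA (le_lt_trans (cabsD _ _)) //.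
  by rewrite (le_lt_trans (lerD zs (lexx _))) //; move: ws r0; rewrite /s; clear; lra.
have xs : cabs (x - x) < s by rewrite subrr cabs0.
(* |f - f x| is bounded below on the square, by compactness. *)
have [c c0 Hc] : exists2 c : R, 0 < c & forall z, K z -> c <= cabs (f (z + x) - f x).
  have cK : compact K.
    apply: (subclosed_compact _ (@compact_square R s)); last by move=> z [].
    apply: closedI.
      by apply: compact_closed; [exact: norm_hausdorff|exact: compact_square].
    apply: (@closedU _ [set z : Cx R | `|Re z| = s] [set z : Cx R | `|Im z| = s]).
      apply: (@closed_comp _ _ (fun z : Cx R => `|Re z|) [set s]); last exact: closed_eq.
      by move=> z _; apply: continuous_comp; [exact: continuous_Re|exact: norm_continuous].
    apply: (@closed_comp _ _ (fun z : Cx R => `|Im z|) [set s]); last exact: closed_eq.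
    by move=> z _; apply: continuous_comp; [exact: continuous_Im|exact: norm_continuous].
  have [] := @compact_near_coveringP _ K; move=> /(_ cK) nK _.
  have : \forall c \near (0 : R)^'+, K `<=` (fun z => c <= cabs (f (z + x) - f x)).
    apply: nK => z Kz; have zr := inr x z xs Kz.
    have zx : z + x != x.
      rewrite -subr_eq0 addrK -cabs_gt0 (lt_le_trans s0) //.
      by apply: cabs_box_ge => //; case: Kz.
    pose m := cabs (f (z + x) - f x) / 2.
    have m0 : 0 < m.
      rewrite divr_gt0 // cabs_gt0 subr_eq0; apply: contra zx => /eqP fE.
      by rewrite (finj _ _ zr _ fE) // subrr cabs0.
    have /(cvg_cabsP (nbhs_filter _)) /(_ _ m0) /nbhs_cabsP [t t0 Ht] := cderiv_cont (ff' _ zr).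
    exists ([set z' | cabs (z' - z) < t], [set c | c < m]) => /=.
      split; first exact: near_cabs.
      by apply: nbhs_right_lt.
    move=> [z' c] /= [z't cm]; rewrite ltW // (lt_le_trans cm) //.
    have := Ht (z' + x); rewrite opprD addrACA subrr addr0 => /(_ z't).
    have := cabs_dist (f (z + x) - f x) (f (z' + x) - f x).
    rewrite opprD opprK addrACA [- f x + _]addrC subrr addr0.
    rewrite ler_norml [cabs (f (z + x) - f (z' + x))]cabsC /m => /andP[_]; lra.
  move=> H; have [c [Hc c0]] := filter_ex (filterI H (nbhs_right_gt (0 : R))).
  by exists c.
pose B := 2 * s * (2 / c).
have B0 : 0 < B by rewrite !mulr_gt0 // invr_gt0.
have fxc : {for x, continuous f} by exact: cderiv_cont fxd.
have c20 : 0 < c / 2 by rewrite divr_gt0.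
(* Cauchy's formula for 1 / (f - f w), whose residue at w is 1 / f'(w). *)
have low : \forall w \near x, derive1 f w != 0 -> B^-1 <= cabs (derive1 f w).
  have /(cvg_cabsP (nbhs_filter _)) /(_ _ c20) fxn := fxc.
  have xn := near_cabs x s0.
  have : \forall w \near x, forall z, K z -> c / 2 <= cabs (f (z + w) - f w).
    have cK : compact [set z : Cx R | `|Re z| <= s /\ `|Im z| <= s] by exact: compact_square.
    have c40 : 0 < c / 4 by rewrite divr_gt0.
    have /(cvg_cabsP (nbhs_filter _)) /(_ _ c40) fx4 := fxc.
    have [] := @compact_near_coveringP _ [set z : Cx R | `|Re z| <= s /\ `|Im z| <= s].
    move=> /(_ cK) nK _.
    have : \forall w \near x, [set z : Cx R | `|Re z| <= s /\ `|Im z| <= s] `<=`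
        (fun z => K z -> cabs (f (z + w) - f (z + x)) <= c / 4).
      apply: (nK _ (nbhs x) (fun w z => K z -> cabs (f (z + w) - f (z + x)) <= c / 4)).
      move=> z [zr zi].
      have zs : cabs (z + x - x) < r.
        rewrite addrK (le_lt_trans (cabs_le_ReIm z)) // (le_lt_trans (lerD zr zi)) //.
        by rewrite /s; lra.
      have c80 : 0 < c / 4 / 2 by rewrite divr_gt0.
      have /(cvg_cabsP (nbhs_filter _)) /(_ _ c80) /nbhs_cabsP [t t0 Ht] := cderiv_cont (ff' _ zs).
      have t20 : 0 < t / 2 by rewrite divr_gt0.
      exists ([set z' | cabs (z' - z) < t / 2], [set w | cabs (w - x) < t / 2]) => /=.
        by split; exact: near_cabs.
      move=> [z' w] /= [z't wt] _; rewrite ltW //.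
      apply: le_lt_trans (cabs_triangle (f (z + x)) _ _) _.
      rewrite (splitr (c / 4)) ltrD //.
        by apply: Ht; rewrite opprD addrACA (le_lt_trans (cabsD _ _)) // (splitr t) ltrD.
      rewrite cabsC; apply: Ht; rewrite opprD addrACA subrr addr0 (lt_trans z't) //.
      by clear -t0; lra.
    apply: filterS2 fx4 => w fw Hw z Kz.
    have := Hw z (proj1 Kz) Kz; have := Hc z Kz; move: fw.
    have := cabs_triangle (f (z + w)) (f (z + x)) (f x).
    have := cabs_triangle (f w) (f (z + w)) (f x).
    rewrite [cabs (f (z + x) - f (z + w))]cabsC; lra.
  apply: filterS2 xn => w /= wx Hw w0.
  have wr' z : `|Re z| <= s -> `|Im z| <= s -> cabs (z + w - x) < r.
    move=> zr zi; rewrite -addrA (le_lt_trans (cabsD _ _)) //.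
    rewrite (le_lt_trans (lerD (cabs_le_ReIm _) (lexx _))) //.
    by rewrite (le_lt_trans (lerD (lerD zr zi) (lexx _))) //; move: wx r0; rewrite /s; clear; lra.
  have wr : cabs (w - x) < r by rewrite (lt_trans wx) // /s; lra.
  have sh a b : cderiv f (a + w) b -> cderiv (fun y => f (y + w)) a b.
    move=> ha; rewrite -[b]mulr1; apply: (@cderiv_comp _ (fun y => y + w)) ha.
    by rewrite -[1]addr0; apply: cderivD; [exact: cderiv_id|exact: cderiv_cst].
  have nz z : `|Re z| <= s -> `|Im z| <= s -> z != 0 -> f (z + w) - f w != 0.
    move=> zr zi z0; rewrite subr_eq0; apply: contra z0 => /eqP fE.
    by have E := finj _ _ (wr' z zr zi) wr fE; rewrite -(addrK w z) E subrr.
  have : cabs (derive1 f w)^-1 <= 2 * s * (2 / c).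
    apply: (@residue_bound _ (fun z => (f (z + w) - f w)^-1)) => //.
    - move=> z zr zi z0; eexists; apply: cderivV; first exact: nz.
      by apply: cderivB; [apply: sh; apply: ff'; exact: wr'|exact: cderiv_cst].
    - move=> e e0; pose a := cabs (derive1 f w).
      have a0 : 0 < a by rewrite cabs_gt0.
      pose e' := Num.min (a / 2) (e * a * (a / 2)).
      have e'0 : 0 < e' by rewrite lt_min !mulr_gt0 // ?invr_gt0.
      have [t t0 Ht] := ff' _ wr _ e'0; exists t => // z z0 zt.
      have := Ht (z + w); rewrite addrK => /(_ zt) H.
      have cz : 0 < cabs z by rewrite cabs_gt0.
      have H1 : a / 2 * cabs z <= cabs (f (z + w) - f w).
        have := cabs_triangle (f (z + w) - f w) (derive1 f w * z) 0.
        rewrite !subr0 cabsM -/a [cabs (derive1 f w * z - _)]cabsC.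
        have : e' * cabs z <= a / 2 * cabs z by rewrite ler_wpM2r ?cabs_ge0 // ge_min lexx.
        by move: H; clear; lra.
      have F0 : f (z + w) - f w != 0.
        by rewrite -cabs_gt0 (lt_le_trans _ H1) // mulr_gt0 // divr_gt0.
      rewrite (_ : _ - _ = - (f (z + w) - f w - derive1 f w * z) /
          ((f (z + w) - f w) * derive1 f w)); last by field; rewrite w0 F0.
      rewrite cabsM cabsN cabsV cabsM -/a ler_pdivrMr ?mulr_gt0 ?cabs_gt0 //.
      apply: le_trans H _.
      apply: (@le_trans _ _ (e * a * (a / 2) * cabs z)).
        by rewrite ler_wpM2r ?cabs_ge0 // ge_min lexx orbT.
      rewrite [e * a * _ * _](_ : _ = e * (a / 2 * cabs z * a)); last by ring.
      by rewrite ler_pM2l // ler_pM2r.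
    - move=> z zr zi zb; rewrite cabsV.
      have Kz : K z by [].
      have Hz := Hw z Kz; have p := lt_le_trans c20 Hz.
      by rewrite -[2 / c]invf_div lef_pV2 ?posrE.
  rewrite cabsV -/B => H; rewrite -[cabs (derive1 f w)]invrK lef_pV2 ?posrE //.
  by rewrite invr_gt0 cabs_gt0.
apply/negP => /eqP d0.
have fx0 : derive1 f x = 0 by rewrite (cderiv_derive1 fxd).
have B10 : 0 < B^-1 by rewrite invr_gt0.
have /(cvg_cabsP (nbhs_filter _)) /(_ _ B10) c2n := c2.
have [t t0 Ht] := iffLR (nbhs_cabsP _ _) (filterI low c2n).
pose t' := Num.min t r.
have t'0 : 0 < t' by rewrite lt_min t0.
have f0 w : cabs (w - x) < t' -> cderiv f w 0.
  rewrite lt_min => /andP[/Ht [/= H1 H2] wr].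
  have [E|E] := eqVneq (derive1 f w) 0; first by rewrite -E; exact: ff'.
  by have := H1 E; rewrite leNgt; move: H2; rewrite fx0 subr0 => ->.
have h0 : ((t' / 2)%:C%C : Cx R) != 0 by rewrite -cabs_gt0 cabsR normr_gt0 gt_eqF // divr_gt0.
have ht : cabs (x + (t' / 2)%:C%C - x) < t'.
  by rewrite addrC addKr cabsR gtr0_norm ?divr_gt0 // ltr_pdivrMr // ltr_pMr // ltr1n.
have := cderiv_zero_cst f0 ht.
have hr : cabs (x + (t' / 2)%:C%C - x) < r.
  by rewrite (lt_le_trans ht) // ge_min lexx orbT.
have xr : cabs (x - x) < r by rewrite subrr cabs0.
move=> /(finj _ _ hr xr) /eqP; rewrite -subr_eq0 addrC addKr.
by move/negP: h0.
Qed.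

End HolomorphicRegularity.

(** * Smooth functions of a real variable *)

Section RealSmooth.
Variable R : realType.
Implicit Types (f g : R -> R) (U V : set R) (n : nat).

(** Class C^n on U, which is meant to be open since the derivatives are two-sided. *)
Fixpoint rsm n U f : Prop :=
  if n is n'.+1 then (forall x, U x -> derivable f x 1) /\ rsm n' U (derive1 f)
  else forall x, U x -> {for x, continuous f}.

Lemma rsm_le n U f : rsm n.+1 U f -> rsm n U f.
Proof.
elim: n f => [|n IH] f [fd f1].
  by move=> x Ux; apply: differentiable_continuous; apply/derivable1_diffP; exact: fd.
by split=> //; exact: IH.
Qed.

Lemma rsm_cont n U f x : rsm n U f -> U x -> {for x, continuous f}.
Proof. by elim: n => [|n IH] fn Ux; [exact: fn|apply: IH => //; exact: rsm_le]. Qed.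

Lemma rsm_sub n U V f : V `<=` U -> rsm n U f -> rsm n V f.
Proof.
move=> VU; elim: n f => [|n IH] f /=; first by move=> fc x /VU; exact: fc.
by move=> [fd f1]; split; [move=> x /VU; exact: fd|exact: IH].
Qed.

Lemma near_open (W : topologicalType) (U : set W) x : open U -> U x -> \forall y \near x, U y.
Proof. by move=> oU Ux; apply: open_nbhs_nbhs. Qed.

Lemma derive1_eq U f g x : open U -> (forall x, U x -> f x = g x) -> U x ->
  (derivable f x 1 -> derivable g x 1) /\ derive1 f x = derive1 g x.
Proof.
move=> oU fg Ux; have E : \near x, f x = g x.
  by apply: filterS (near_open oU Ux) => y; exact: fg.
split; first by move=> /derivableP df; have [] := near_eq_is_derive E df.
by rewrite !derive1E; apply: near_eq_derive.
Qed.

Lemma rsm_eq n U f g : open U -> (forall x, U x -> f x = g x) -> rsm n U f -> rsm n U g.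
Proof.
move=> oU; elim: n f g => [|n IH] f g fg /=.
  move=> fc x Ux; have E : \near x, f x = g x.
    by apply: filterS (near_open oU Ux) => y; exact: fg.
  have := fc x Ux; rewrite /prop_for /continuous_at fg // => fx.
  by apply: cvg_trans fx; apply: near_eq_cvg; apply: filterS E => y.
move=> [fd f1]; split.
  by move=> x Ux; apply: (derive1_eq oU fg Ux).1; exact: fd.
by apply: IH f1 => x Ux; apply: (derive1_eq oU fg Ux).2.
Qed.

Lemma rsm_cst n U (c : R) : open U -> rsm n U (fun=> c).
Proof.
move=> oU; elim: n c => [|n IH] c /=; first by move=> x _; exact: cvg_cst.
split; first by move=> x _; exact: derivable_cst.
by apply: rsm_eq (IH 0) => // x _; rewrite derive1E derive_cst.
Qed.

Lemma rsm_id n U : open U -> rsm n U id.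
Proof.
move=> oU; case: n => [|n] /=; first by move=> x _; exact: cvg_id.
split; first by move=> x _; exact: derivable_id.
by apply: rsm_eq (rsm_cst n 1 oU) => // x _; rewrite derive1_id.
Qed.

Lemma rsmD n U f g : open U -> rsm n U f -> rsm n U g -> rsm n U (fun x => f x + g x).
Proof.
move=> oU; elim: n f g => [|n IH] f g /=.
  by move=> fc gc x Ux; apply: cvgD; [exact: fc|exact: gc].
move=> [fd f1] [gd g1]; split.
  by move=> x Ux; apply: derivableD; [exact: fd|exact: gd].
apply: rsm_eq (IH _ _ f1 g1) => // x Ux.
by rewrite !derive1E [in RHS]deriveD //; [exact: fd|exact: gd].
Qed.

Lemma rsmM n U f g : open U -> rsm n U f -> rsm n U g -> rsm n U (fun x => f x * g x).
Proof.
move=> oU; elim: n f g => [|n IH] f g.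
  by move=> fc gc x Ux; apply: cvgM; [exact: fc|exact: gc].
move=> /[dup] /rsm_le fn [fd f1] /[dup] /rsm_le gn [gd g1]; split.
  by move=> x Ux; apply: derivableM; [exact: fd|exact: gd].
have := rsmD oU (IH _ _ fn g1) (IH _ _ gn f1); apply: rsm_eq => // x Ux.
by rewrite !derive1E [in RHS]deriveM //; [exact: fd|exact: gd].
Qed.

Lemma rsmZ n U (c : R) f : open U -> rsm n U f -> rsm n U (fun x => c * f x).
Proof. by move=> oU; apply: rsmM => //; exact: rsm_cst. Qed.

Lemma rsm_comp n U V f g : open U -> open V -> (forall x, U x -> V (f x)) ->
  rsm n U f -> rsm n V g -> rsm n U (g \o f).
Proof.
move=> oU oV UV; elim: n f g UV => [|n IH] f g UV.
  by move=> fc gc x Ux; apply: continuous_comp; [exact: fc|apply: gc; exact: UV].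
move=> /[dup] /rsm_le fn [fd f1] /[dup] /rsm_le gn [gd g1].
have dgf x : U x -> is_derive x 1 (g \o f) (derive1 g (f x) * derive1 f x).
  move=> Ux; rewrite !derive1E; apply: is_derive1_comp; apply: derivableP.
    by apply: gd; exact: UV.
  exact: fd.
split; first by move=> x Ux; have [] := dgf x Ux.
apply: rsm_eq (rsmM oU (IH f (derive1 g) UV fn g1) f1) => // x Ux.
by have [_ E] := dgf x Ux; rewrite [RHS]derive1E.
Qed.

Lemma rsm_inv n : rsm n [set x : R | 0 < x] (fun x => x^-1).
Proof.
have oU : open [set x : R | 0 < x] by exact: open_gt.
have dV (x : R) : 0 < x -> is_derive x 1 (fun x : R => x^-1) (-1 * (x^-1 * x^-1)).
  move=> x0; have x1 : id x != 0 by rewrite gt_eqF.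
  have := @is_deriveV R id x 1 1 x1 (is_derive_id _ _).
  by rewrite /GRing.scale /= mulr1 mulN1r expr2 invfM.
elim: n => [|n IH] /=.
  move=> x x0; apply: differentiable_continuous; apply/derivable1_diffP.
  by have [] := dV x x0.
split; first by move=> x x0; have [] := dV x x0.
apply: rsm_eq (rsmZ (-1) oU (rsmM oU IH IH)) => // x x0.
by have [_ E] := dV x x0; rewrite [RHS]derive1E.
Qed.

Lemma rsm_ln n : rsm n [set x : R | 0 < x] (@ln R).
Proof.
have dl (x : R) : 0 < x -> is_derive x 1 (@ln R) (x^-1) by exact: is_derive1_ln.
case: n => [|n] /=; first by move=> x x0; exact: continuous_ln.
split; first by move=> x x0; have [] := dl x x0.
apply: rsm_eq (rsm_inv n) => [|x x0]; first exact: open_gt.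
by have [_ E] := dl x x0; rewrite [RHS]derive1E.
Qed.

(** The functions x^-k e^(-1/x), extended by 0: a family whose derivatives are combinations of its
    members, so that smoothness is an induction on the order, for all k at once. *)
Definition flat (k : nat) (x : R) : R :=
  if 0 < x then (x^-1) ^+ k * expR (- x^-1) else 0.

Lemma flat_ge0 k x : 0 <= flat k x.
Proof.
rewrite /flat; case: ifP => // x0.
by rewrite mulr_ge0 ?expR_ge0 // exprn_ge0 // invr_ge0 ltW.
Qed.

Lemma flat_le0 k x : x <= 0 -> flat k x = 0.
Proof. by rewrite /flat leNgt => /negbTE ->. Qed.

Lemma expR_ge_exp k (y : R) : 0 <= y -> y ^+ k <= k`!%:R * expR y.
Proof.
move=> y0; rewrite mulrC -ler_pdivrMr ?ltr0n ?fact_gt0 //.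
case: k => [|k]; first by rewrite fact0 divr1 expr0 -expR0 ler_expR.
by apply: le_trans (expR_ge1Dxn k y0); rewrite lerDr.
Qed.

Lemma flat_le k x : flat k x <= k`!%:R.
Proof.
have [x0|x0] := leP x 0; first by rewrite flat_le0.
rewrite /flat x0 expRN ler_pdivrMr ?expR_gt0 // expR_ge_exp //.
by rewrite invr_ge0 ltW.
Qed.

Lemma flat_mul k x : x * flat k.+1 x = flat k x.
Proof.
rewrite /flat; case: ifP => [x0|]; last by rewrite mulr0.
by rewrite exprS !mulrA mulfV ?gt_eqF // mul1r.
Qed.

Lemma is_derive_flat (k : nat) (x : R) :
  is_derive x 1 (flat k) (flat k.+2 x - k%:R * flat k.+1 x).
Proof.
have [x0|x0|->] := ltgtP x 0.
- rewrite !flat_le0 ?ltW // mulr0 subrr.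
  apply: near_eq_is_derive (is_derive_cst 0 x 1).
  by apply: filterS (near_open (@open_lt R 0) x0) => y /= y0; rewrite (flat_le0 _ (ltW y0)).
- have x1 : id x != 0 by rewrite gt_eqF.
  have dV := @is_deriveV R id x 1 1 x1 (is_derive_id _ _).
  have dVX := is_deriveX k dV.
  have dE := @is_derive1_comp R (@expR R) (fun y => - y^-1) x _ _
    (is_derive_expR _) (is_deriveN dV).
  have dM := is_deriveM dVX dE.
  apply: near_eq_is_derive; last first.
    apply: is_derive_eq dM _.
    rewrite /flat x0 /GRing.scale /= !exprfctE.
    case: k {dVX} => [|k]; rewrite !(expr0, mul0r, subr0, addr0, mul1r, mulr1) /=.
      by field; rewrite gt_eqF.
    rewrite -natr1 !exprS; field; rewrite gt_eqF //.
  by apply: filterS (near_open (@open_gt R 0) x0) => y /= y0; rewrite /flat y0 !fctE.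
rewrite !flat_le0 // mulr0 subrr.
have H : (fun h : R => h^-1 *: ((flat k \o shift 0) (h *: (1 : R)) - flat k 0)) @ 0^' --> (0 : R).
  apply/cvgrPdist_lt => e e0; pose C : R := (k.+2)`!%:R.
  have C0 : 0 < C by rewrite ltr0n fact_gt0.
  apply/nbhs_ballP; exists (e / C) => /=; first exact: divr_gt0.
  move=> h; rewrite /ball /= sub0r normrN => he h0.
  rewrite /GRing.scale /= mulr1 addr0 (@flat_le0 k 0) // subr0 sub0r normrN.
  (* The difference quotient at 0 is [flat k.+1 h], that is h * [flat k.+2 h], hence at most (k +
     2)! |h|. *)
  rewrite -flat_mul mulKf // -flat_mul normrM (ger0_norm (flat_ge0 _ _)).
  rewrite (le_lt_trans (ler_wpM2l (normr_ge0 _) (flat_le _ _))) //.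
  by rewrite -ltr_pdivlMr.
split; first by apply/cvg_ex; exists (0 : R).
exact: (cvg_lim _ H).
Qed.

Lemma rsm_flat n k : rsm n setT (flat k).
Proof.
elim: n k => [|n IH] k /=.
  move=> x _; apply: differentiable_continuous; apply/derivable1_diffP.
  by have [] := is_derive_flat k x.
split; first by move=> x _; have [] := is_derive_flat k x.
have oT : open [set: R] by exact: openT.
apply: rsm_eq (rsmD oT (IH k.+2) (rsmZ (-1) oT (rsmZ k%:R oT (IH k.+1)))) => // x _.
by have [_ E] := is_derive_flat k x; rewrite [RHS]derive1E E mulN1r.
Qed.

(* x e^(-1/x) for 0 < x: smooth, nondecreasing, convex, 0 on the left and
   asymptotically affine on the right. *)
Definition ramp (x : R) : R := x * flat 0 x.

Lemma is_derive_ramp (x : R) : is_derive x 1 ramp (flat 0 x + flat 1 x).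
Proof.
have H := is_deriveM (is_derive_id x 1) (is_derive_flat 0 x).
apply: is_derive_eq H _; rewrite /GRing.scale /= mul0r subr0 mulr1.
by rewrite flat_mul addrC.
Qed.

(** The terms in [flat 2] cancel, and what remains is nonnegative: this is the convexity of
    [ramp]. *)
Lemma is_derive_ramp' (x : R) : is_derive x 1 (fun x => flat 0 x + flat 1 x) (flat 3 x).
Proof.
have H := is_deriveD (is_derive_flat 0 x) (is_derive_flat 1 x).
apply: is_derive_eq H _; ring.
Qed.

Lemma rsm_ramp n : rsm n setT ramp.
Proof. by apply: rsmM; [exact: openT|apply: rsm_id; exact: openT|exact: rsm_flat]. Qed.

Lemma ramp_ge0 x : 0 <= ramp x.
Proof.
have [x0|x0] := leP x 0; first by rewrite /ramp flat_le0 // mulr0.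
by rewrite /ramp mulr_ge0 ?flat_ge0 // ltW.
Qed.

Lemma ramp_le0 x : x <= 0 -> ramp x = 0.
Proof. by move=> x0; rewrite /ramp flat_le0 // mulr0. Qed.

Lemma ramp_gt0 x : 0 < x -> 0 < ramp x.
Proof. by move=> x0; rewrite /ramp /flat x0 expr0 mul1r mulr_gt0 // expR_gt0. Qed.

Lemma ramp_le x y : x <= y -> ramp x <= ramp y.
Proof.
move=> xy; apply: (@ger0_derive1_le_cc _ ramp x y) => //.
- by move=> z _; have [] := is_derive_ramp z.
- by move=> z _; have [_ E] := is_derive_ramp z; rewrite derive1E E addr_ge0 ?flat_ge0.
- apply: continuous_subspaceT => z; apply: differentiable_continuous.
  by apply/derivable1_diffP; have [] := is_derive_ramp z.
- by rewrite in_itv /= lexx.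
- by rewrite in_itv /= lexx andbT.
Qed.

Lemma ramp_lt1 x : x <= 1 -> ramp x < 1.
Proof.
move=> x1; have [x0|x0] := leP x 0; first by rewrite ramp_le0.
rewrite /ramp /flat x0 expr0 mul1r (@le_lt_trans _ _ (1 * expR (- x^-1))) //.
  by rewrite ler_wpM2r ?expR_ge0.
by rewrite mul1r -expR0 ltr_expR oppr_lt0 invr_gt0.
Qed.

(** With y = 1 / x this is (1 + y) e^(-y) <= 1. The bound is uniform in x, and later makes the loss
    in the annulus independent of N. *)
Lemma ramp'_le1 x : flat 0 x + flat 1 x <= 1.
Proof.
have [x0|x0] := leP x 0; first by rewrite !flat_le0 ?addr0.
rewrite /flat x0 expr0 mul1r expr1 -[X in X + _]mul1r -mulrDl expRN.
by rewrite ler_pdivrMr ?expR_gt0 // mul1r expR_ge1Dx.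
Qed.

Lemma ramp'_ge1 x : 1 <= x -> expR (-1) <= flat 0 x + flat 1 x.
Proof.
move=> x1; have x0 := lt_le_trans ltr01 x1.
apply: le_trans (_ : flat 0 x <= _); last by rewrite lerDl flat_ge0.
rewrite /flat x0 expr0 mul1r ler_expR lerN2 invf_le1 //.
Qed.

(** With y = 1 / x <= 1 the right-hand side is (1 + y - y^3) e^(-y). It is ramp' - ramp'', the
    combination produced by the change of variable v = ln (- ln s) in the second derivative of the
    potential. *)
Lemma ramp_convex_gap x : 1 <= x -> expR (-1) <= flat 0 x + flat 1 x - flat 3 x.
Proof.
move=> x1; have x0 := lt_le_trans ltr01 x1.
have y1 : x^-1 <= 1 by rewrite invf_le1.
have y0 : 0 < x^-1 by rewrite invr_gt0.
apply: (@le_trans _ _ (flat 0 x)).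
  by rewrite /flat x0 expr0 mul1r ler_expR lerN2.
rewrite -addrA lerDl subr_ge0 /flat x0 ler_wpM2r ?expR_ge0 //.
by rewrite expr1 exprS ger_pMr // exprn_ile1 // ltW.
Qed.

End RealSmooth.

(** * Leafwise smooth functions *)

Section LeafSmooth.
Variables (R : realType) (T : topologicalType).
Implicit Types (O : set (R * R * T)) (g : R * R -> T -> R) (n : nat).

Notation partial b g := (fun u t => 'D_(axis R b) (g ^~ t) u).
Notation uncurried g := (fun q : R * R * T => g q.1 q.2).

(** Class C^n in the leaf variable u, all the derivatives being continuous in (u, t). The
    transversal T is only a topological space, so nothing is differentiated in t. *)
Fixpoint csm n O g : Prop :=
  (forall q, O q -> {for q, continuous (uncurried g)}) /\
  if n is n'.+1 then
    forall b, (forall q, O q -> derivable (g ^~ q.2) q.1 (axis R b)) /\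
              csm n' O (partial b g)
  else True.

Lemma csm_cont n O g : csm n O g -> forall q, O q -> {for q, continuous (uncurried g)}.
Proof. by case: n => [|n] []. Qed.

Lemma csm_le n O g : csm n.+1 O g -> csm n O g.
Proof.
elim: n g => [|n IH] g [gc gd]; first by split.
by split=> // b; have [gb gn] := gd b; split=> //; exact: IH.
Qed.

(* Smoothness is local in the leaf variable and in the transversal one. *)
Lemma csm_local n O g :
  (forall q, O q -> exists2 O', O' q & csm n O' g) -> csm n O g.
Proof.
elim: n g => [|n IH] g H; split.
- by move=> q /H [W Wq [Wc _]]; exact: Wc.
- by [].
- by move=> q /H [W Wq [Wc _]]; exact: Wc.
move=> b; split.
  by move=> q /H [W Wq [_ /(_ b) [Wd _]]]; exact: Wd.
by apply: IH => q /H [W Wq [_ /(_ b) [_]]]; exists W.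
Qed.

Lemma slice_near O (u : R * R) t : open O -> O (u, t) -> \forall v \near u, O (v, t).
Proof.
move=> oO Ou; have [[A B] /= [Au Bt] AB] := near_open oO Ou.
by apply: filterS Au => v Av; apply: AB; split => //; exact: nbhs_singleton.
Qed.

Lemma csm_eq n O g g' : open O -> (forall q, O q -> g q.1 q.2 = g' q.1 q.2) ->
  csm n O g -> csm n O g'.
Proof.
move=> oO; elim: n g g' => [|n IH] g g' E [gc gd].
  split=> // q Oq; have := gc q Oq; rewrite /prop_for /continuous_at E // => H.
  apply: cvg_trans H; apply: near_eq_cvg.
  by apply: filterS (near_open oO Oq) => p Op; rewrite E.
have nr q : O q -> \forall v \near q.1, g v q.2 = g' v q.2.
  by case: q => u t Oq; apply: filterS (slice_near oO Oq) => v Ov; exact: (E (v, t)).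
split.
  move=> q Oq; have := gc q Oq; rewrite /prop_for /continuous_at E // => H.
  apply: cvg_trans H; apply: near_eq_cvg.
  by apply: filterS (near_open oO Oq) => p Op; rewrite E.
move=> b; have [gb gn] := gd b; split.
  move=> q Oq; have /derivableP H := gb q Oq.
  have nE : \forall v \near q.1, (g ^~ q.2) v = (g' ^~ q.2) v := nr q Oq.
  by have [] := near_eq_is_derive nE H.
apply: IH gn => q Oq.
have nE : \forall v \near q.1, (g ^~ q.2) v = (g' ^~ q.2) v := nr q Oq.
have /derivableP H := gb q Oq.
by have [_ ->] := near_eq_is_derive nE H.
Qed.

Lemma csm_cst n O (c : R) : open O -> csm n O (fun _ _ => c).
Proof.
move=> oO; elim: n c => [|n IH] c; first by split=> // q _; exact: cvg_cst.
split; first by move=> q _; exact: cvg_cst.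
move=> b; split; first by move=> q _; exact: derivable_cst.
by apply: csm_eq (IH 0) => // q _; rewrite derive_cst.
Qed.

Lemma csmD n O g g' : open O -> csm n O g -> csm n O g' ->
  csm n O (fun u t => g u t + g' u t).
Proof.
move=> oO; elim: n g g' => [|n IH] g g' [gc gd] [gc' gd'].
  by split=> // q Oq; apply: cvgD; [exact: gc|exact: gc'].
split; first by move=> q Oq; apply: cvgD; [exact: gc|exact: gc'].
move=> b; have [gb gn] := gd b; have [gb' gn'] := gd' b; split.
  by move=> q Oq; apply: derivableD; [exact: gb|exact: gb'].
apply: csm_eq (IH _ _ gn gn') => // q Oq.
by rewrite [in RHS]deriveD //; [exact: gb|exact: gb'].
Qed.

Lemma csmM n O g g' : open O -> csm n O g -> csm n O g' ->
  csm n O (fun u t => g u t * g' u t).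
Proof.
move=> oO; elim: n g g' => [|n IH] g g'.
  by move=> [gc _] [gc' _]; split=> // q Oq; apply: cvgM; [exact: gc|exact: gc'].
move=> /[dup] /csm_le gn [gc gd] /[dup] /csm_le gn' [gc' gd']; split.
  by move=> q Oq; apply: cvgM; [exact: gc|exact: gc'].
move=> b; have [gb gnb] := gd b; have [gb' gnb'] := gd' b; split.
  by move=> q Oq; apply: derivableM; [exact: gb|exact: gb'].
apply: csm_eq (csmD oO (IH _ _ gn gnb') (IH _ _ gn' gnb)) => // q Oq.
by rewrite [in RHS]deriveM //; [exact: gb|exact: gb'].
Qed.

Lemma csmZ n O (c : R) g : open O -> csm n O g -> csm n O (fun u t => c * g u t).
Proof. by move=> oO; apply: csmM => //; exact: csm_cst. Qed.

Lemma csm_sum n O (m : nat) (g : 'I_m -> R * R -> T -> R) : open O ->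
  (forall j, csm n O (g j)) -> csm n O (fun u t => \sum_(j < m) g j u t).
Proof.
move=> oO; elim: m g => [|m IH] g gj.
  by apply: csm_eq (csm_cst n 0 oO) => // q _; rewrite big_ord0.
have Hm := IH (fun j => g (widen_ord (leqnSn m) j)) (fun j => gj _).
apply: csm_eq (csmD oO Hm (gj ord_max)) => // q _.
by rewrite [RHS]big_ord_recr.
Qed.

(** The chain rule for a derivative in a single direction: g is restricted to the line u + h v,
    which reduces it to one real variable. *)
Lemma is_derive_comp_along (V : normedModType R) (g : V -> R) (phi : R -> R) u v a b :
  is_derive u v g a -> is_derive (g u) (1 : R) phi b ->
  is_derive u v (phi \o g) (b * a).
Proof.
move=> [gd gv] Hphi; pose l (h : R) := g (h *: v + u).
have along (k : V -> R) : (fun h : R => h^-1 *: (((fun h : R => k (h *: v + u)) \o shift 0)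
    (h *: (1 : R)) - k (0 *: v + u))) = (fun h => h^-1 *: ((k \o shift u) (h *: v) - k u)).
  by apply/funext => h /=; rewrite addr0 scale0r add0r /GRing.scale /= mulr1.
have ld : derivable l 0 1 by exact: (iffLR (derivable1P g u v) gd).
have lv : 'D_1 l 0 = a.
  by rewrite -gv /derive (along g).
have Hl : is_derive (0 : R) 1 l a by split.
have Hphi' : is_derive (l 0) (1 : R) phi b by rewrite /l scale0r add0r.
have [cd cv] := is_derive1_comp Hphi' Hl.
split; first exact: (iffRL (derivable1P (phi \o g) u v) cd).
by rewrite -cv /derive -(along (phi \o g)).
Qed.

Lemma csm_comp n O (U : set R) (phi : R -> R) g : open O -> open U ->
  (forall q, O q -> U (g q.1 q.2)) -> rsm n U phi -> csm n O g ->
  csm n O (fun u t => phi (g u t)).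
Proof.
move=> oO oU; elim: n phi g => [|n IH] phi g OU.
  move=> pc [gc _]; split=> // q Oq.
  by apply: (@continuous_comp _ _ _ (uncurried g) phi); [exact: gc|apply: pc; exact: OU].
move=> /[dup] pn [pd p1] /[dup] /csm_le gn [gc gd].
have pc q : O q -> {for g q.1 q.2, continuous phi}.
  by move=> /OU; apply: (rsm_cont pn).
split.
  by move=> q Oq; apply: (@continuous_comp _ _ _ (uncurried g) phi); [exact: gc|exact: pc].
move=> b; have [gb gnb] := gd b.
have H q : O q -> is_derive q.1 (axis R b) (fun u => phi (g u q.2))
    (derive1 phi (g q.1 q.2) * 'D_(axis R b) (g ^~ q.2) q.1).
  move=> Oq; apply: (@is_derive_comp_along _ (g ^~ q.2)).
    by apply: derivableP; exact: gb.
  by rewrite derive1E; apply: derivableP; apply: pd; exact: OU.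
split; first by move=> q /H [].
apply: csm_eq (csmM oO (IH _ _ OU p1 gn) gnb) => // q Oq.
by have [_ ->] := H q Oq.
Qed.

(** The head of the list is the last derivative taken by [pderiv], whereas [csm] exposes the first
    one; the induction is therefore on the end of the list. *)
Lemma pderiv_rcons (s : seq bool) b (f : R * R -> R) :
  pderiv (rcons s b) f = pderiv s ('D_(axis R b) f).
Proof. by elim: s => [//|c s IH] /=; rewrite IH. Qed.

Lemma csm_leaf_smooth (B : set (R * R)) g :
  (forall n, csm n (B `*` [set: T]) g) -> leaf_smooth B g.
Proof.
move=> gn s u t Bu.
have Ou : (B `*` [set: T]) (u, t) by [].
move: (gn (size s).+1); elim/last_ind: s g {gn} => [|s b IH] g.
  move=> [gc gd]; split; last exact: (gc (u, t) Ou).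
  by move=> b; have [H _] := gd b; exact: (H (u, t) Ou).
rewrite size_rcons => -[_ /(_ b) [_ /IH]].
rewrite (_ : (fun q : R * R * T => pderiv (rcons s b) (g ^~ q.2) q.1) =
  (fun q => pderiv s ('D_(axis R b) (g ^~ q.2)) q.1)); last first.
  by apply/funext => q; rewrite pderiv_rcons.
by rewrite pderiv_rcons.
Qed.

Definition leaf_holo (Oc : set (Cx R * T)) (f : Cx R -> T -> Cx R) :=
  forall q, Oc q -> {for q, continuous (fun q => f q.1 q.2)} /\
    exists d, cderiv (f ^~ q.2) q.1 d.

Lemma leaf_holo_cont Oc f q : leaf_holo Oc f -> Oc q ->
  {for q, continuous (fun q => f q.1 q.2)}.
Proof. by move=> H /H []. Qed.

Lemma leaf_holo_cderiv Oc f q : leaf_holo Oc f -> Oc q ->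
  cderiv (f ^~ q.2) q.1 (derive1 (f ^~ q.2) q.1).
Proof. by move=> H /H [_ [d fd]]; rewrite (cderiv_derive1 fd). Qed.

Lemma leaf_holo_derive Oc f : open Oc -> leaf_holo Oc f ->
  leaf_holo Oc (fun x t => derive1 (f ^~ t) x).
Proof.
move=> oO fh [x t] Oq.
have nO := near_open oO Oq; have [[A U] /= [/nbhs_cabsP [r r0 rA] Ut] AU] := nO.
split.
  apply: cderiv_joint_cont; apply: filterS nO => q Oq'.
  by have [? ?] := fh q Oq'.
apply: (cderiv_second r0) => w wr.
by have [] := fh (w, t) (AU (w, t) (conj (rA _ wr) (nbhs_singleton Ut))).
Qed.

Lemma leaf_holoZ Oc f (c : Cx R) : leaf_holo Oc f -> leaf_holo Oc (fun x t => c * f x t).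
Proof.
move=> fh q Oq; have [fc [d fd]] := fh q Oq; split.
  have Hc := cderiv_cont (cderivM (cderiv_cst c (f q.1 q.2)) (cderiv_id _)).
  exact: (@continuous_comp _ _ _ (fun q => f q.1 q.2) (fun z => c * z) q fc Hc).
by eexists; apply: cderivM fd; exact: cderiv_cst.
Qed.

Definition axisC (b : bool) : Cx R := if b then 1%:C%C else (0 +i* 1)%C.

Lemma cplx_axis b (u : R * R) (h : R) :
  cplx (h *: axis R b + u) = h%:C%C * axisC b + cplx u.
Proof.
case: b; case: u => u1 u2; apply: cx_eq; rewrite /= /GRing.scale /=; ring.
Qed.

Lemma continuous_cplx_pair : continuous (fun q : R * R * T => (cplx q.1, q.2)).
Proof.
move=> q; have H : cplx v.1 @[v --> q] --> cplx q.1.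
  apply: (@continuous_comp _ _ _ fst (@cplx R)); first exact: cvg_fst.
  exact: continuous_cplx.
exact: (cvg_pair H cvg_snd).
Qed.

(** A partial derivative of Re f is the real part of a constant times f', so the induction stays
    within the leafwise holomorphic functions, whose derivatives are again jointly continuous. *)
Lemma leaf_holo_Re_csm n Oc f : open Oc -> leaf_holo Oc f ->
  csm n [set q : R * R * T | Oc (cplx q.1, q.2)] (fun u t => complex.Re (f (cplx u) t)).
Proof.
move=> oO.
have oO' : open [set q : R * R * T | Oc (cplx q.1, q.2)].
  apply: (@open_comp _ _ (fun q : R * R * T => (cplx q.1, q.2))) oO => q _.
  exact: continuous_cplx_pair.
have cont (g : Cx R -> T -> Cx R) (q : R * R * T) : leaf_holo Oc g -> Oc (cplx q.1, q.2) ->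
    {for q, continuous (fun q : R * R * T => complex.Re (g (cplx q.1) q.2))}.
  move=> gh Oq; apply: (@continuous_comp _ _ _
    (fun q : R * R * T => g (cplx q.1) q.2) (fun z : Cx R => complex.Re z)); last first.
    exact: continuous_Re.
  apply: (@continuous_comp _ _ _ (fun q : R * R * T => (cplx q.1, q.2))
    (fun q => g q.1 q.2)); last exact: (leaf_holo_cont gh Oq).
  exact: continuous_cplx_pair.
elim: n f => [|n IH] f fh; first by split=> // q Oq; exact: cont.
split; first by move=> q Oq; exact: cont.
move=> b.
have H (q : R * R * T) : Oc (cplx q.1, q.2) -> is_derive q.1 (axis R b)
    (fun u => complex.Re (f (cplx u) q.2))
    (complex.Re (axisC b * derive1 (f ^~ q.2) (cplx q.1))).
  move=> Oq; rewrite mulrC; apply: (@Re_cderiv_along _ _ (@cplx R) _ _ (f ^~ q.2)).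
    by move=> h; exact: cplx_axis.
  exact: (leaf_holo_cderiv fh Oq).
split; first by move=> q /H [].
have := IH _ (leaf_holoZ (axisC b) (leaf_holo_derive oO fh)).
by apply: csm_eq => // q Oq; have [_ ->] := H q Oq.
Qed.

Lemma leaf_holo_Im_csm n Oc f : open Oc -> leaf_holo Oc f ->
  csm n [set q : R * R * T | Oc (cplx q.1, q.2)] (fun u t => complex.Im (f (cplx u) t)).
Proof.
move=> oO fh; have := leaf_holo_Re_csm n oO (leaf_holoZ (0 -i* 1)%C fh).
by congr csm; apply/funext => u; apply/funext => t; case: (f _ _) => a b /=; ring.
Qed.

End LeafSmooth.

(** * Laminations and flow boxes *)

Section CauchySchwarzComplex.
Variable R : realType.

Definition cconj (z : Cx R) : Cx R := (complex.Re z -i* complex.Im z)%C.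

Lemma cabs_conj z : cabs (cconj z) = cabs z.
Proof. by rewrite !cabsE /= sqrrN. Qed.

Definition normsq k (v : 'I_k -> Cx R) : R := \sum_(j < k) cabs (v j) ^+ 2.
Definition herm k (v w : 'I_k -> Cx R) : Cx R := \sum_(j < k) v j * cconj (w j).

Lemma normsq_ge0 k (v : 'I_k -> Cx R) : 0 <= normsq v.
Proof. by apply: sumr_ge0 => j _; rewrite sqr_ge0. Qed.

Lemma normsq_gt0 k (v : 'I_k -> Cx R) j : v j != 0 -> 0 < normsq v.
Proof.
move=> vj; rewrite /normsq (bigD1 j) //= ltr_pwDl //.
  by rewrite exprn_gt0 // cabs_gt0.
by apply: sumr_ge0 => i _; rewrite sqr_ge0.
Qed.

(** Lagrange's identity: the difference of the two sides is half the sum of the squares (a i * b j -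
    a j * b i)^2. *)
Lemma sum_Cauchy_Schwarz k (a b : 'I_k -> R) :
  (\sum_(j < k) a j * b j) ^+ 2 <= (\sum_(j < k) a j ^+ 2) * (\sum_(j < k) b j ^+ 2).
Proof.
rewrite -subr_ge0.
have E : (\sum_j a j ^+ 2) * (\sum_j b j ^+ 2) - (\sum_j a j * b j) ^+ 2 =
    2^-1 * \sum_i \sum_j (a i * b j - a j * b i) ^+ 2.
  have e1 : (\sum_j a j ^+ 2) * (\sum_j b j ^+ 2) = \sum_i \sum_j (a i * b j) ^+ 2.
    rewrite mulr_suml; apply: eq_bigr => i _; rewrite mulr_sumr.
    by apply: eq_bigr => j _; rewrite exprMn.
  have e2 : (\sum_j a j ^+ 2) * (\sum_j b j ^+ 2) = \sum_i \sum_j (a j * b i) ^+ 2.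
    by rewrite e1 exchange_big.
  have e3 : (\sum_j a j * b j) ^+ 2 = \sum_i \sum_j (a i * b j) * (a j * b i).
    rewrite expr2 mulr_suml; apply: eq_bigr => i _; rewrite mulr_sumr.
    by apply: eq_bigr => j _; ring.
  have e4 : \sum_i \sum_j (a i * b j - a j * b i) ^+ 2 = \sum_i \sum_j (a i * b j) ^+ 2
     - 2 * \sum_i \sum_j (a i * b j) * (a j * b i) + \sum_i \sum_j (a j * b i) ^+ 2.
    rewrite mulr_sumr -sumrB -big_split /=; apply: eq_bigr => i _.
    by rewrite mulr_sumr -sumrB -big_split /=; apply: eq_bigr => j _; ring.
  by rewrite e4 -e1 -e2 -e3; field.
rewrite E mulr_ge0 // sumr_ge0 // => i _; rewrite sumr_ge0 // => j _; exact: sqr_ge0.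
Qed.

Lemma cabs_sum k (v : 'I_k -> Cx R) : cabs (\sum_j v j) <= \sum_j cabs (v j).
Proof.
elim/big_rec2: _ => [|j x y _ H]; first by rewrite cabs0.
by rewrite (le_trans (cabsD _ _)) // lerD2l.
Qed.

Lemma herm_Cauchy_Schwarz k (v w : 'I_k -> Cx R) :
  cabs (herm v w) ^+ 2 <= normsq w * normsq v.
Proof.
rewrite mulrC; apply: le_trans (sum_Cauchy_Schwarz _ _).
rewrite ler_pXn2r ?nnegrE ?cabs_ge0 //; last first.
  by apply: sumr_ge0 => j _; rewrite mulr_ge0 ?cabs_ge0.
apply: le_trans (cabs_sum _) _; apply: ler_sum => j _.
by rewrite cabsM cabs_conj.
Qed.

End CauchySchwarzComplex.

Section LaminationBasics.
Variables (R : realType) (k : nat) (M : complexManifold R k) (Y : set M).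
Variable L : lamination Y.
Implicit Types (i j : fbox L) (p : M).

Lemma manifold_hausdorff : hausdorff_space M. Proof. by case: M. Qed.
Lemma manifold_second_countable : @second_countable M. Proof. by case: M. Qed.
Lemma manifold_chart p : exists2 c, catlas c & cdom c p.
Proof. by case: M p => T A h s H p; exact: H. Qed.
Lemma atlas_transition c d : catlas c -> catlas d -> @holo_transition R k M c d.
Proof. by case: M c d => T A h s H H' c d; exact: H'. Qed.

Lemma fdom_relopen i : exists2 O : set M, open O & fdom i = O `&` Y.
Proof. by case: L i => *; auto. Qed.
Lemma fdom_cover p : Y p -> exists i, fdom i p.
Proof. by case: L => *; auto. Qed.
Lemma fbase_open i : open (fbase i).
Proof.
suff [] : [/\ open (fbase i), connected (fbase i) & fbase i !=set0] by [].
by case: L i => *; auto.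
Qed.
Lemma fmapK i p : fdom i p -> fbase i (fmap i p).1 /\ finv (fmap i p) = p.
Proof. by case: L i => *; auto. Qed.
Lemma finvK i (z : Cx R * ftrans i) : fbase i z.1 -> fdom i (finv z) /\ fmap i (finv z) = z.
Proof. by case: L i z => *; auto. Qed.
Lemma fmap_within i : {within fdom i, continuous (fmap i)}.
Proof. by case: L i => *; auto. Qed.
Lemma finv_within i : {within fbase i `*` [set: ftrans i], continuous (@finv _ _ _ _ L i)}.
Proof. by case: L i => *; auto. Qed.
Lemma box_transition i j : exists (Psi : Cx R * ftrans i -> Cx R) (Lam : ftrans i -> ftrans j),
  forall p, fdom i p -> fdom j p ->
    [/\ fmap j p = (Psi (fmap i p), Lam (fmap i p).2),
        {for fmap i p, continuous Psi}, {for (fmap i p).2, continuous Lam} &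
        derivable (fun x : Cx R => Psi (x, (fmap i p).2)) (fmap i p).1 1].
Proof. by case: L i j => *; auto. Qed.
Lemma leaf_immersed i c p : catlas c -> fdom i p -> cdom c p ->
  derivable (fun x : Cx R => cmap c (finv (x, (fmap i p).2))) (fmap i p).1 1.
Proof.
suff H : catlas c -> fdom i p -> cdom c p ->
  let gamma := fun x : Cx R => cmap c (finv (x, (fmap i p).2)) in
  derivable gamma (fmap i p).1 1 /\ derive1 gamma (fmap i p).1 != 0.
  by move=> h1 h2 h3; have [] := H h1 h2 h3.
case: L i => ? ? ? ? ? ? ? ? ? ? ? ? ? ? ? H i h1 h2 h3; exact: (H i c p h1 h2 h3).
Qed.

Lemma fdom_sub i p : fdom i p -> Y p.
Proof. by have [W _ ->] := fdom_relopen i; case. Qed.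

Lemma box_open i : open (fbase i `*` [set: ftrans i]).
Proof.
rewrite openE => -[x t] [/= bx _]; exists (fbase i, setT) => /=; last by [].
by split; [exact: (near_open (@fbase_open i) bx)|exact: filterT].
Qed.

Lemma finv_cont i (q : Cx R * ftrans i) : fbase i q.1 -> {for q, continuous (@finv _ _ _ _ L i)}.
Proof.
move=> bq; have := @finv_within i; rewrite continuous_open_subspace; last exact: box_open.
by apply; rewrite inE.
Qed.

Lemma finv_near i (q : Cx R * ftrans i) (D : set M) : fbase i q.1 -> open D -> D (finv q) ->
  \forall q' \near q, fbase i q'.1 /\ D (finv q').
Proof.
move=> bq oD Dq.
have H1 : \forall q' \near q, D (finv q') by apply: (finv_cont bq); exact: near_open.
have H2 : \forall q' \near q, (fbase i `*` [set: ftrans i]) q'.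
  by apply: near_open; [exact: box_open|].
by apply: filterS2 H2 H1 => q' [].
Qed.

Lemma leaf_near i p (D : set M) : fdom i p -> open D -> D p ->
  \forall x \near (fmap i p).1, fbase i x /\ D (finv (x, (fmap i p).2)).
Proof.
move=> ip oD Dp; have [bp pK] := fmapK ip.
have [[A B] /= [Ap Bp] AB] : \forall q \near fmap i p, fbase i q.1 /\ D (finv q).
  by apply: finv_near => //; rewrite pK.
by apply: filterS Ap => x Ax; apply: (AB (x, _)); split => //; exact: nbhs_singleton.
Qed.

(* In the leaf through p the box j is the box i up to a holomorphic change of
   the plaque coordinate. *)
Lemma change_box i j p : fdom i p -> fdom j p ->
  let g := fun x : Cx R => (fmap j (finv (x, (fmap i p).2))).1 in
  (exists d, cderiv g (fmap i p).1 d) /\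
  \forall x \near (fmap i p).1,
    [/\ fbase i x, fdom j (finv (x, (fmap i p).2)) &
        finv (x, (fmap i p).2) = finv (g x, (fmap j p).2)].
Proof.
move=> ip jp g; have [Psi [Lam H]] := box_transition i j.
have [W oO jO] := fdom_relopen j.
have Op : W p by move: jp; rewrite jO => -[].
have nr : \forall x \near (fmap i p).1, [/\ fbase i x,
    fdom j (finv (x, (fmap i p).2)) &
    fmap j (finv (x, (fmap i p).2)) = (Psi (x, (fmap i p).2), (fmap j p).2)].
  apply: filterS (leaf_near ip oO Op) => x [bx Ox].
  have [ix xK] := @finvK i (x, (fmap i p).2) bx.
  have jx : fdom j (finv (x, (fmap i p).2)) by rewrite jO; split=> //; exact: fdom_sub ix.
  have [E _ _ _] := H _ ix jx; have [E' _ _ _] := H _ ip jp.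
  by split => //; rewrite E xK /= E'.
split; last first.
  by apply: filterS nr => x [bx jx E]; split => //; rewrite /g E -E; have [_ ->] := fmapK jx.
have [_ _ _ /derivable_cderiv dP] := H _ ip jp.
eexists; apply: cderiv_near dP; apply: filterS nr => x [_ _ E].
by rewrite /g E.
Qed.

End LaminationBasics.

(** * Coordinate balls *)

Section CoordinateBall.
Variables (R : realType) (k : nat) (M : complexManifold R k) (Y : set M).
Variable L : lamination Y.
Implicit Types (i : fbox L) (p : M).

(* z is holomorphic along the leaves and identifies D, possibly several sheets
   to one, with part of the unit ball of C^k. *)
Definition coord_ball (z : M -> 'I_k -> Cx R) (D : set M) := [/\ open D,
  forall p j, D p -> {for p, continuous (fun p => z p j)},
  forall p, D p -> normsq (z p) < 1,
  forall r, r < 1 -> compact [set p | D p /\ normsq (z p) <= r] &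
  forall i p j, fdom i p -> D p ->
    exists d, cderiv (fun x => z (finv (x, (fmap i p).2)) j) (fmap i p).1 d].

Variables (z : M -> 'I_k -> Cx R) (D : set M).
Hypothesis cb : coord_ball z D.

Definition dcoord i p : 'I_k -> Cx R := fun j =>
  derive1 (fun x => z (finv (x, (fmap i p).2)) j) (fmap i p).1.
(* The restrictions to the leaves of i ddbar |z|^2 and of
   i d|z|^2 /\ dbar |z|^2. *)
Definition kahler : form L := fun i p => normsq (dcoord i p).
Definition radial : form L := fun i p => cabs (herm (dcoord i p) (z p)) ^+ 2.

(** A function of |z|^2 on D, continued by a constant. Its i ddbar will be [rform] with A = th' and
    B = th''. *)
Definition rfun (th : R -> R) (c : R) (p : M) : R :=
  if `[< D p >] then th (normsq (z p)) else c.
Definition rform (A B : R -> R) : form L := fun i p =>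
  if `[< D p >] then A (normsq (z p)) * kahler i p + B (normsq (z p)) * radial i p
  else 0.

Definition coord_dom i : set (Cx R * ftrans i) := [set q | fbase i q.1 /\ D (finv q)].
Arguments coord_dom : clear implicits.

Definition coord_dom2 i : set (R * R * ftrans i) :=
  [set q | coord_dom i (cplx q.1, q.2)].
Arguments coord_dom2 : clear implicits.

Lemma coord_dom_open i : open (coord_dom i).
Proof. by have [oD _ _ _ _] := cb; rewrite openE => q [bq Dq]; exact: finv_near. Qed.

Lemma open_cplx_pair (T : topologicalType) (W : set (Cx R * T)) : open W ->
  open [set q : R * R * T | W (cplx q.1, q.2)].
Proof.
apply: (@open_comp _ _ (fun q : R * R * T => (cplx q.1, q.2))) => q _.
exact: continuous_cplx_pair.
Qed.

Lemma coord_dom2_open i : open (coord_dom2 i).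
Proof. by apply: open_cplx_pair; exact: coord_dom_open. Qed.

Lemma coord_holo i j : leaf_holo (coord_dom i) (fun x t => z (finv (x, t)) j).
Proof.
have [oD zc _ _ zd] := cb => q [bq Dq]; have [iq qK] := finvK bq; split.
  apply: (@continuous_comp _ _ _ (fun q : Cx R * ftrans i => finv (q.1, q.2))
    (fun p => z p j)); last by case: q bq Dq iq qK => x t bq Dq _ _; exact: zc.
  rewrite (_ : (fun q => _) = @finv _ _ _ _ L i); first exact: finv_cont.
  by apply/funext => -[].
by have := zd _ _ j iq Dq; rewrite qK.
Qed.

Lemma csm_cabs2 (T : topologicalType) n (W : set (R * R * T)) (f : R * R -> T -> Cx R) :
  open W -> csm n W (fun u t => complex.Re (f u t)) ->
  csm n W (fun u t => complex.Im (f u t)) -> csm n W (fun u t => cabs (f u t) ^+ 2).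
Proof.
move=> oW fr fi; apply: csm_eq (csmD oW (csmM oW fr fr) (csmM oW fi fi)) => // q _.
by rewrite cabs2 !expr2.
Qed.

Lemma coord_csm n i j :
  csm n (coord_dom2 i) (fun u t => complex.Re (z (finv (cplx u, t)) j)) /\
  csm n (coord_dom2 i) (fun u t => complex.Im (z (finv (cplx u, t)) j)).
Proof.
have oW := @coord_dom_open i; split.
  exact: (leaf_holo_Re_csm n oW (@coord_holo i j)).
exact: (leaf_holo_Im_csm n oW (@coord_holo i j)).
Qed.

Lemma dcoord_finv i (x : Cx R) (t : ftrans i) j : fbase i x ->
  dcoord i (finv (x, t)) j = derive1 (fun x => z (finv (x, t)) j) x.
Proof. by move=> bx; rewrite /dcoord; have [_ ->] := @finvK _ _ _ _ L i (x, t) bx. Qed.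

Lemma dcoord_csm n i j :
  csm n (coord_dom2 i) (fun u t => complex.Re (dcoord i (finv (cplx u, t)) j)) /\
  csm n (coord_dom2 i) (fun u t => complex.Im (dcoord i (finv (cplx u, t)) j)).
Proof.
have oW := @coord_dom_open i; have hd := leaf_holo_derive oW (@coord_holo i j).
split.
  apply: csm_eq (leaf_holo_Re_csm n oW hd); first exact: coord_dom2_open.
  by move=> q [bq _]; rewrite dcoord_finv.
apply: csm_eq (leaf_holo_Im_csm n oW hd); first exact: coord_dom2_open.
by move=> q [bq _]; rewrite dcoord_finv.
Qed.

Lemma normsq_csm n i : csm n (coord_dom2 i) (in_box (i := i) (fun p => normsq (z p))).
Proof.
have oW := @coord_dom2_open i; apply: csm_sum => // j.
by have [hr hi] := coord_csm n i j; exact: csm_cabs2.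
Qed.

Lemma kahler_csm n i : csm n (coord_dom2 i) (in_box (i := i) (kahler i)).
Proof.
have oW := @coord_dom2_open i; apply: csm_sum => // j.
by have [hr hi] := dcoord_csm n i j; exact: csm_cabs2.
Qed.

Lemma cRe_sum (v : 'I_k -> Cx R) :
  complex.Re (\sum_j v j) = \sum_j complex.Re (v j) :> R.
Proof. by elim/big_rec2: _ => [//|j x y _ <-]; rewrite cReD. Qed.

Lemma cIm_sum (v : 'I_k -> Cx R) :
  complex.Im (\sum_j v j) = \sum_j complex.Im (v j) :> R.
Proof. by elim/big_rec2: _ => [//|j x y _ <-]; rewrite cImD. Qed.

Lemma radial_csm n i : csm n (coord_dom2 i) (in_box (i := i) (radial i)).
Proof.
have oW := @coord_dom2_open i; apply: csm_cabs2 => //.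
  apply: (@csm_eq _ _ _ _ (fun u t => \sum_j complex.Re (dcoord i (finv (cplx u, t)) j *
      cconj (z (finv (cplx u, t)) j)))) => //.
    by move=> q _; rewrite cRe_sum.
  apply: csm_sum => // j; have [hr hi] := coord_csm n i j.
  have [dr di] := dcoord_csm n i j.
  apply: csm_eq (csmD oW (csmM oW dr hr) (csmM oW di hi)) => // q _.
  by rewrite cReM /= mulrN opprK.
apply: (@csm_eq _ _ _ _ (fun u t => \sum_j complex.Im (dcoord i (finv (cplx u, t)) j *
    cconj (z (finv (cplx u, t)) j)))) => //.
  by move=> q _; rewrite cIm_sum.
apply: csm_sum => // j; have [hr hi] := coord_csm n i j.
have [dr di] := dcoord_csm n i j.
apply: csm_eq (csmD oW (csmM oW di hr) (csmZ (-1) oW (csmM oW dr hi))) => // q _.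
by rewrite cImM /= mulrN mulN1r addrC.
Qed.

(** With [coord_dom2] it covers the flow box by two open sets on which a function constant for |z|^2
    >= r is visibly smooth. It is open because {|z|^2 <= r} is compact, which is why [coord_ball]
    includes that compactness. *)
Definition outer_dom i (r : R) : set (R * R * ftrans i) :=
  [set q | base2 i q.1 /\ ~ (D (finv (cplx q.1, q.2)) /\ normsq (z (finv (cplx q.1, q.2))) <= r)].
Arguments outer_dom : clear implicits.

Lemma outer_dom_open i r : r < 1 -> open (outer_dom i r).
Proof.
move=> r1; have [_ _ _ cK _] := cb.
have oK : open (~` [set p | D p /\ normsq (z p) <= r]).
  by rewrite openC; apply: compact_closed; [exact: manifold_hausdorff|exact: cK].
apply: (@open_cplx_pair _ [set q : Cx R * ftrans i | fbase i q.1 /\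
  (~` [set p | D p /\ normsq (z p) <= r]) (finv q)]).
by rewrite openE => q [bq Kq]; exact: finv_near.
Qed.

Lemma csm_glue n i (r : R) g : r < 1 ->
  csm n (coord_dom2 i) g -> csm n (outer_dom i r) g ->
  csm n (base2 i `*` [set: ftrans i]) g.
Proof.
move=> r1 g1 g2; apply: csm_local => q [/= bq _].
have [Dq|Dq] := pselect (D (finv (cplx q.1, q.2))); first by exists (coord_dom2 i).
by exists (outer_dom i r) => //; split => // -[].
Qed.

Section Radial.
Variables (U : set R) (r : R).
Hypotheses (oU : open U) (r1 : r < 1) (YU : forall p, Y p -> D p -> U (normsq (z p))).

Lemma normsq_dom i (q : R * R * ftrans i) : coord_dom2 i q ->
  U (in_box (fun p => normsq (z p)) q.1 q.2).
Proof. by move=> [bq Dq]; apply: YU => //; exact: (fdom_sub (finvK bq).1). Qed.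

Lemma outer_dom_le i (q : R * R * ftrans i) : outer_dom i r q -> D (finv (cplx q.1, q.2)) ->
  U (normsq (z (finv (cplx q.1, q.2)))) /\ r <= normsq (z (finv (cplx q.1, q.2))).
Proof.
move=> [bq nq] Dq; split; first by apply: YU => //; exact: (fdom_sub (finvK _).1).
by rewrite leNgt; apply/negP => /ltW H; apply: nq.
Qed.

Lemma rfun_csm n (th : R -> R) c i : rsm n U th -> (forall x, U x -> r <= x -> th x = c) ->
  csm n (base2 i `*` [set: ftrans i]) (in_box (i := i) (rfun th c)).
Proof.
move=> tU tc; apply: (csm_glue r1).
  have := csm_comp (@coord_dom2_open i) oU (@normsq_dom i) tU (normsq_csm n i).
  apply: csm_eq => [|q [bq Dq]]; first exact: coord_dom2_open.
  by rewrite /in_box /rfun asboolT.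
apply: csm_eq (csm_cst n c (@outer_dom_open i r r1)) => [|q Oq]; first exact: outer_dom_open.
rewrite /in_box /rfun; case: asboolP => // Dq.
by have [h1 h2] := outer_dom_le Oq Dq; rewrite tc.
Qed.

Lemma rform_csm n (A B : R -> R) i : rsm n U A -> rsm n U B ->
  (forall x, U x -> r <= x -> A x = 0 /\ B x = 0) ->
  csm n (base2 i `*` [set: ftrans i]) (in_box (i := i) (rform A B i)).
Proof.
move=> AU BU AB0; apply: (csm_glue r1).
  have oW := @coord_dom2_open i.
  have hA := csm_comp oW oU (@normsq_dom i) AU (normsq_csm n i).
  have hB := csm_comp oW oU (@normsq_dom i) BU (normsq_csm n i).
  have := csmD oW (csmM oW hA (kahler_csm n i)) (csmM oW hB (radial_csm n i)).
  by apply: csm_eq => // q [bq Dq]; rewrite /in_box /rform asboolT.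
apply: csm_eq (csm_cst n 0 (@outer_dom_open i r r1)) => [|q Oq]; first exact: outer_dom_open.
rewrite /in_box /rform; case: asboolP => // Dq.
by have [h1 h2] := outer_dom_le Oq Dq; have [-> ->] := AB0 _ h1 h2; rewrite !mul0r addr0.
Qed.

End Radial.

Lemma dcoord_change i j p m : fdom i p -> fdom j p -> D p ->
  dcoord i p m = dcoord j p m *
    derive1 (fun x : Cx R => (fmap j (finv (x, (fmap i p).2))).1) (fmap i p).1.
Proof.
move=> ip jp Dp; have [[d gd] nr] := change_box ip jp.
set g := fun x : Cx R => _ in gd nr *.
have [_ _ _ _ zd] := cb; have [e ze] := zd _ _ m jp Dp.
have gp : g (fmap i p).1 = (fmap j p).1.
  by rewrite /g -surjective_pairing; have [_ ->] := fmapK ip.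
rewrite /dcoord (cderiv_derive1 ze) (cderiv_derive1 gd).
apply: cderiv_derive1; rewrite -gp in ze.
have := cderiv_comp gd ze; apply: cderiv_near.
by apply: filterS nr => x [_ _ E] /=; rewrite -E.
Qed.

Lemma rform_change A B i j p : fdom i p -> fdom j p ->
  rform A B i p = rform A B j p * cabs (derive1
    (fun x : Cx R => (fmap j (finv (x, (fmap i p).2))).1) (fmap i p).1) ^+ 2.
Proof.
move=> ip jp; rewrite /rform; case: asboolP => [Dp|_]; last by rewrite mul0r.
set g := derive1 _ _.
have dE m : dcoord i p m = dcoord j p m * g by exact: dcoord_change.
have kE : kahler i p = kahler j p * cabs g ^+ 2.
  rewrite /kahler /normsq mulr_suml; apply: eq_bigr => m _.
  by rewrite dE cabsM exprMn.
have rE : radial i p = radial j p * cabs g ^+ 2.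
  rewrite /radial -exprMn -cabsM; congr (cabs _ ^+ 2).
  rewrite /herm mulr_suml; apply: eq_bigr => m _.
  by rewrite dE mulrAC.
by rewrite kE rE; ring.
Qed.

End CoordinateBall.

(** * The Laplacian of a function of |f|^2, for f holomorphic with values in C^k *)

Section RadialLaplacian.
Variables (R : realType) (k : nat).

Notation Re := complex.Re.
Notation Im := complex.Im.

Lemma near_cplx (u : R * R) (P : set (Cx R)) :
  (\forall w \near cplx u, P w) -> \forall v \near u, P (cplx v).
Proof. by move=> H; exact: (continuous_cplx H). Qed.

Lemma cderivZ (c : Cx R) (f : Cx R -> Cx R) x d : cderiv f x d ->
  cderiv (fun w => c * f w) x (c * d).
Proof. by move=> fd; have := cderivM (cderiv_cst c x) fd; rewrite mulr0 addr0. Qed.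

Lemma is_derive_sumf (V : normedModType R) m (h : 'I_m -> V -> R) (x v : V)
  (dh : 'I_m -> R) : (forall i, is_derive x v (h i) (dh i)) ->
  is_derive x v (fun y => \sum_(i < m) h i y) (\sum_(i < m) dh i).
Proof.
move=> H; rewrite (_ : (fun y => _) = \sum_(i < m) h i); first exact: is_derive_sum.
by apply/funext => y; rewrite fct_sumE.
Qed.

Lemma is_derive_mulf (V : normedModType R) (f g : V -> R) (x v : V) (a b : R) :
  is_derive x v f a -> is_derive x v g b ->
  is_derive x v (fun y => f y * g y) (f x * b + g x * a).
Proof. by move=> fa gb; exact: (is_deriveM fa gb). Qed.

Lemma is_derive_addf (V : normedModType R) (f g : V -> R) (x v : V) (a b : R) :
  is_derive x v f a -> is_derive x v g b -> is_derive x v (fun y => f y + g y) (a + b).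
Proof. by move=> fa gb; exact: (is_deriveD fa gb). Qed.

Lemma is_derive_scalef (V : normedModType R) (c : R) (f : V -> R) (x v : V) (a : R) :
  is_derive x v f a -> is_derive x v (fun y => c * f y) (c * a).
Proof. by move=> fa; exact: (is_deriveZ c fa). Qed.

Lemma Re_partial b (f : Cx R -> Cx R) (u : R * R) d : cderiv f (cplx u) d ->
  is_derive u (axis R b) (fun u => Re (f (cplx u))) (Re (axisC R b * d)).
Proof.
move=> fd; rewrite mulrC; apply: (Re_cderiv_along _ fd) => h; exact: cplx_axis.
Qed.

Lemma Im_partial b (f : Cx R -> Cx R) (u : R * R) d : cderiv f (cplx u) d ->
  is_derive u (axis R b) (fun u => Im (f (cplx u))) (Im (axisC R b * d)).
Proof.
move=> fd; rewrite mulrC; apply: (Im_cderiv_along _ fd) => h; exact: cplx_axis.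
Qed.

Variables (f : 'I_k -> Cx R -> Cx R) (u0 : R * R) (U : set R) (th : R -> R).
Hypothesis fd : \forall w \near cplx u0, forall j, exists d, cderiv (f j) w d.
Hypotheses (oU : open U) (tU : rsm 2 U th).
Hypothesis fU : \forall w \near cplx u0, U (\sum_(j < k) cabs (f j w) ^+ 2).

Let S (u : R * R) : R := \sum_(j < k) cabs (f j (cplx u)) ^+ 2.
Let f' j := derive1 (f j).
Let S1 b (u : R * R) : R := \sum_(j < k)
  2 * (Re (axisC R b * f' j (cplx u)) * Re (f j (cplx u)) +
       Im (axisC R b * f' j (cplx u)) * Im (f j (cplx u))).

Let fd' : \forall u \near u0, forall j, cderiv (f j) (cplx u) (f' j (cplx u)).
Proof.
have := near_cplx fd; apply: filterS => u H j.
by have [d fd1] := H j; rewrite /f' (cderiv_derive1 fd1).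
Qed.

Let S_derive b u : (forall j, cderiv (f j) (cplx u) (f' j (cplx u))) ->
  is_derive u (axis R b) S (S1 b u).
Proof.
move=> H; apply: is_derive_sumf => j.
have hr := Re_partial b (H j); have hi := Im_partial b (H j).
rewrite (_ : (fun y => _) = (fun u => Re (f j (cplx u)) * Re (f j (cplx u)) +
   Im (f j (cplx u)) * Im (f j (cplx u)))); last first.
  by apply/funext => v; rewrite cabs2 !expr2.
apply: is_derive_eq (is_derive_addf (is_derive_mulf hr hr) (is_derive_mulf hi hi)) _.
ring.
Qed.

(** The second derivatives of f enter with the squares of the two axes, 1 and i, and cancel in the
    sum. The first derivatives of |f|^2 along the axes are twice the real part and minus twice the
    imaginary part of the Hermitian product, whose squares add up to the last term. *)
Lemma laplacian_radial : laplacian (fun u => th (S u)) u0 =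
  4 * (derive1 th (S u0) * normsq (fun j => f' j (cplx u0)) +
    derive1 (derive1 th) (S u0) *
      cabs (herm (fun j => f' j (cplx u0)) (fun j => f j (cplx u0))) ^+ 2).
Proof.
have [t1 [t2 _]] := tU.
have D1 b : \forall u \near u0, 'D_(axis R b) (fun u => th (S u)) u = derive1 th (S u) * S1 b u.
  apply: filterS2 fd' (near_cplx fU) => u H US.
  have dt : is_derive (S u) (1 : R) th (derive1 th (S u)).
    by rewrite derive1E; apply: derivableP; exact: t1.
  by have [_ ->] := is_derive_comp_along (S_derive b H) dt.
have f'd j : exists d, cderiv (f' j) (cplx u0) d.
  have [r r0 Hr] := iffLR (nbhs_cabsP _ _) fd.
  by apply: (cderiv_second r0) => w /Hr.
pose f2 j := derive1 (f' j) (cplx u0).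
have f2d j : cderiv (f' j) (cplx u0) (f2 j).
  by have [d H] := f'd j; rewrite /f2 (cderiv_derive1 H).
have cstM b j : cderiv (fun w => axisC R b * f' j w) (cplx u0) (axisC R b * f2 j).
  exact: cderivZ (f2d j).
have H0 := nbhs_singleton fd'.
pose c b := axisC R b.
pose S2 b := \sum_(j < k)
  2 * ((Re (c b * (c b * f2 j)) * Re (f j (cplx u0)) + Im (c b * (c b * f2 j)) * Im (f j (cplx u0))) +
    (Re (c b * f' j (cplx u0)) ^+ 2 + Im (c b * f' j (cplx u0)) ^+ 2)).
have S1d b : is_derive u0 (axis R b) (S1 b) (S2 b).
  apply: is_derive_sumf => j.
  have hr := Re_partial b (H0 j); have hi := Im_partial b (H0 j).
  have hr' := Re_partial b (cstM b j); have hi' := Im_partial b (cstM b j).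
  have H := is_derive_scalef 2
    (is_derive_addf (is_derive_mulf hr' hr) (is_derive_mulf hi' hi)).
  apply: is_derive_eq H _; rewrite /c; ring.
have D2 b : 'D_(axis R b) ('D_(axis R b) (fun u => th (S u))) u0 =
    derive1 th (S u0) * S2 b + derive1 (derive1 th) (S u0) * S1 b u0 ^+ 2.
  have dt : is_derive (S u0) (1 : R) (derive1 th) (derive1 (derive1 th) (S u0)).
    rewrite [derive1 (derive1 th) _]derive1E; apply: derivableP; apply: t2.
    exact: (nbhs_singleton (near_cplx fU)).
  have H := is_derive_mulf (is_derive_comp_along (S_derive b H0) dt) (S1d b).
  have E : \forall u \near u0, derive1 th (S u) * S1 b u = 'D_(axis R b) (fun u => th (S u)) u.
    by apply: filterS (D1 b) => u ->.
  by have [_ ->] := near_eq_is_derive E H; rewrite /=; ring.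
have -> : laplacian (fun u => th (S u)) u0 =
  'D_(axis R true) ('D_(axis R true) (fun u => th (S u))) u0 +
  'D_(axis R false) ('D_(axis R false) (fun u => th (S u))) u0 by [].
rewrite (D2 true) (D2 false).
have e1 : S2 true + S2 false = 4 * normsq (fun j => f' j (cplx u0)).
  rewrite /S2 /normsq mulr_sumr -big_split /=; apply: eq_bigr => j _.
  rewrite cabs2 /c /axisC; move: (f' j (cplx u0)) (f j (cplx u0)) (f2 j).
  by move=> [a1 b1] [a2 b2] [a3 b3] /=; ring.
have e2 : S1 true u0 = 2 * Re (herm (fun j => f' j (cplx u0)) (fun j => f j (cplx u0))).
  rewrite /S1 /herm cRe_sum mulr_sumr; apply: eq_bigr => j _.
  rewrite /axisC; move: (f' j (cplx u0)) (f j (cplx u0)).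
  by move=> [a1 b1] [a2 b2] /=; ring.
have e3 : S1 false u0 = - (2 * Im (herm (fun j => f' j (cplx u0)) (fun j => f j (cplx u0)))).
  rewrite /S1 /herm cIm_sum mulr_sumr -sumrN; apply: eq_bigr => j _.
  rewrite /axisC; move: (f' j (cplx u0)) (f j (cplx u0)).
  by move=> [a1 b1] [a2 b2] /=; ring.
rewrite [RHS]mulrDr [4 * (_ * normsq _)]mulrCA -e1 e2 e3 cabs2; ring.
Qed.

End RadialLaplacian.

Section RadialDdbar.
Variables (R : realType) (k : nat) (M : complexManifold R k) (Y : set M).
Variable L : lamination Y.
Variables (z : M -> 'I_k -> Cx R) (D : set M).
Hypothesis cb : coord_ball L z D.
Variables (U : set R) (r : R).
Hypotheses (oU : open U) (r1 : r < 1) (YU : forall p, Y p -> D p -> U (normsq (z p))).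

Lemma laplacianE (f : R * R -> R) u : laplacian f u =
  'D_(axis R true) ('D_(axis R true) f) u + 'D_(axis R false) ('D_(axis R false) f) u.
Proof. by []. Qed.

Lemma near_eq_laplacian (f g : R * R -> R) u : (\forall v \near u, f v = g v) ->
  laplacian f u = laplacian g u.
Proof.
have D1 b (f1 f2 : R * R -> R) v : (\forall w \near v, f1 w = f2 w) ->
    'D_(axis R b) f1 v = 'D_(axis R b) f2 v.
  exact: near_eq_derive.
move=> E; have E2 b : \forall v \near u, 'D_(axis R b) f v = 'D_(axis R b) g v.
  by apply: filterS (near_join E) => v; exact: D1.
rewrite !laplacianE (D1 true _ _ _ (E2 true)) (D1 false _ _ _ (E2 false)) //.
Qed.

Lemma ddbar_rfun (th : R -> R) c i p : rsm 2 U th ->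
  (forall x, U x -> r <= x -> th x = c) -> fdom i p ->
  ddbar (rfun z D th c) i p = @rform _ _ _ _ L z D (derive1 th) (derive1 (derive1 th)) i p.
Proof.
move=> tU tc ip; have [bp pK] := fmapK ip.
have cpK : cplx (reim (fmap i p).1) = (fmap i p).1 by exact: reimK.
have Yp := fdom_sub ip.
have [oD _ _ cK _] := cb; rewrite /ddbar /rform; case: asboolP => [Dp|nDp]; last first.
  (* Outside D, a plaque neighbourhood of p avoids the compact set |z|^2 <= r, and the function is
     the constant c on it. *)
  have oK : open (~` [set p | D p /\ normsq (z p) <= r]).
    by rewrite openC; apply: compact_closed; [exact: manifold_hausdorff|exact: cK].
  have := leaf_near ip oK; move=> H; have {}H := H (fun h => nDp h.1).
  rewrite -cpK in H.
  rewrite (@near_eq_laplacian _ (fun=> c)).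
    have E v : 'D_v (fun=> c) = (fun=> 0) :> (R * R -> R).
      by apply/funext => u; exact: derive_cst.
    have E' v : 'D_v (fun=> 0 : R) (reim (fmap i p).1) = 0 by exact: derive_cst.
    by rewrite laplacianE !E !E' addr0 mul0r.
  apply: filterS (near_cplx H) => v [bv Kv]; rewrite /in_box /rfun.
  case: asboolP => // Dv; apply: tc.
    by apply: YU => //; exact: (fdom_sub (finvK _).1).
  by rewrite leNgt; apply/negP => /ltW h; apply: Kv.
pose f j (x : Cx R) := z (finv (x, (fmap i p).2)) j.
have H := leaf_near ip oD Dp; rewrite -cpK in H.
have EQ : \forall v \near reim (fmap i p).1, (in_box (rfun z D th c))^~ (fmap i p).2 v =
    th (\sum_(j < k) cabs (f j (cplx v)) ^+ 2).
  by apply: filterS (near_cplx H) => v [bv Dv]; rewrite /in_box /rfun asboolT.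
rewrite (near_eq_laplacian EQ) (@laplacian_radial R k f (reim (fmap i p).1) U th) //.
- rewrite cpK mulrC mulKf ?pnatr_eq0 //.
  have E : \sum_(j < k) cabs (f j (fmap i p).1) ^+ 2 = normsq (z p).
    by rewrite /f -surjective_pairing pK.
  rewrite E; congr (_ * _ + _ * cabs _ ^+ 2).
  by rewrite /herm; apply: eq_bigr => j _; rewrite /f -surjective_pairing pK.
- apply: filterS H => w [bw Dw] j.
  by have [_ []] := @coord_holo _ _ _ _ L _ _ cb i j (w, (fmap i p).2) (conj bw Dw) => d; exists d.
- by apply: filterS H => w [bw Dw]; apply: YU => //; exact: (fdom_sub (finvK _).1).
Qed.

End RadialDdbar.

(** * Charts and glued coordinate balls *)

Section ChartBalls.
Variables (R : realType) (k : nat) (M : complexManifold R k) (Y : set M).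
Variable L : lamination Y.

Definition chart_coord (c : chart R k M) (q : M) (rho : R) (p : M) : 'I_k -> Cx R :=
  fun j => (cmap c p 0 j - cmap c q 0 j) * (rho^-1)%:C%C.

Definition chart_ball (c : chart R k M) (q : M) (rho : R) : set M :=
  [set p | cdom c p /\ normsq (chart_coord c q rho p) < 1].

Lemma chart_dom_open (c : chart R k M) : open (cdom c). Proof. by case: c. Qed.
Lemma chart_img_open (c : chart R k M) : open (cmap c @` cdom c). Proof. by case: c. Qed.
Lemma cmapK (c : chart R k M) p : cdom c p -> cinv c (cmap c p) = p.
Proof. by case: c p => *; auto. Qed.
Lemma cmap_cont (c : chart R k M) p : cdom c p -> {for p, continuous (cmap c)}.
Proof.
move=> cp; have : {within cdom c, continuous (cmap c)} by case: c {cp}.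
by rewrite continuous_open_subspace; [apply; rewrite inE|exact: chart_dom_open].
Qed.
Lemma cinv_cont (c : chart R k M) v : (cmap c @` cdom c) v -> {for v, continuous (cinv c)}.
Proof.
move=> cv; have : {within cmap c @` cdom c, continuous (cinv c)} by case: c {cv}.
by rewrite continuous_open_subspace; [apply; rewrite inE|exact: chart_img_open].
Qed.

Lemma rV_nbhsP (v : 'rV[Cx R]_k) A : nbhs v A -> exists2 e : R, 0 < e &
  forall w : 'rV[Cx R]_k, (forall j, cabs (w 0 j - v 0 j) < e) -> A w.
Proof.
move=> /nbhs_ballP [e /= e0 eA].
have eE : e = (complex.Re e)%:C%C.
  by move: e0; rewrite ltcE; case: e {eA} => a b /= /andP[/eqP -> _].
exists (complex.Re e); first by move: e0; rewrite ltcE => /andP[].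
move=> w wv; apply: eA; split=> // i j; rewrite ord1 eE /ball /= normcabs ltcR cabsC.
exact: wv.
Qed.

Lemma continuous_coord (v : 'rV[Cx R]_k) j : {for v, continuous (fun w : 'rV[Cx R]_k => w 0 j)}.
Proof. exact: coord_continuous. Qed.

Lemma derivable_coord (w : Cx R -> 'rV[Cx R]_k) x j : derivable w x 1 ->
  cderiv (fun y => w y 0 j) x ('D_1 w x 0 j).
Proof.
move=> wd; pose l := 'D_1 w x; apply/cderivP.
have wl : (fun h : Cx R => h^-1 *: ((w \o shift x) (h *: (1 : Cx R)) - w x)) @ 0^' --> l.
  exact: wd.
have H : (fun h : Cx R => h^-1 *: (((fun y => w y 0 j) \o shift x) (h *: (1 : Cx R)) - w x 0 j))
    @ 0^' --> l 0 j.
  have := @continuous_cvg _ _ _ _ _ _ (fun v : 'rV[Cx R]_k => v 0 j) _ (@continuous_coord l j) wl.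
  move=> /(_ (dnbhs_filter _)) H; apply/cvg_cabsP => e e0; have /cvg_cabsP /(_ _ e0) := H.
  by apply: filterS => h /=; rewrite !mxE.
split; first by apply/cvg_ex; exists (l 0 j).
exact: (cvg_lim _ H).
Qed.

(** The leaves are immersed with respect to the charts of the atlas, and c is only compatible with
    these: a chart d of the atlas at p is followed by the transition from d to c. *)
Lemma leaf_chart_derivable (c : chart R k M) (i : fbox L) p j :
  holo_coordinates c -> fdom i p -> cdom c p ->
  exists d, cderiv (fun x => cmap c (finv (x, (fmap i p).2)) 0 j) (fmap i p).1 d.
Proof.
move=> hc ip cp; have [d dat dp] := manifold_chart p.
have gd := leaf_immersed dat ip dp; have [tcd tdc] := hc d dat.
set gam := fun x : Cx R => cmap d (finv (x, (fmap i p).2)) in gd.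
have gp : gam (fmap i p).1 = cmap d p.
  by rewrite /gam -surjective_pairing; have [_ ->] := fmapK ip.
have hd := tdc _ dp cp.
have D1 : differentiable ((cmap c \o cinv d) \o gam) (fmap i p).1.
  by apply: differentiable_comp; [exact/derivable1_diffP|rewrite gp].
eexists; apply: cderiv_near (derivable_coord j (iffRL (derivable1_diffP _ _) D1)).
apply: filterS (leaf_near ip (@chart_dom_open d) dp) => x [_ dx] /=.
by rewrite /gam cmapK.
Qed.

Lemma cabs_le_normsq (v : 'I_k -> Cx R) j : cabs (v j) ^+ 2 <= normsq v.
Proof.
rewrite /normsq (bigD1 j) //= lerDl.
by apply: sumr_ge0 => i _; rewrite sqr_ge0.
Qed.

Lemma chart_coord_normsq (c : chart R k M) q rho p : 0 < rho ->
  normsq (chart_coord c q rho p) = (\sum_j cabs (cmap c p 0 j - cmap c q 0 j) ^+ 2) / rho ^+ 2.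
Proof.
move=> r0; rewrite /normsq mulr_suml; apply: eq_bigr => j _.
by rewrite /chart_coord cabsM exprMn cabsR ger0_norm ?invr_ge0 ?(ltW r0) // exprVn.
Qed.

Lemma continuous_sum (T : topologicalType) m (f : 'I_m -> T -> R) (x : T) :
  (forall j, {for x, continuous (f j)}) -> {for x, continuous (fun y => \sum_j f j y)}.
Proof.
elim: m f => [|m IH] f fc.
  rewrite (_ : (fun y => _) = fun=> 0); first exact: cvg_cst.
  by apply/funext => y; rewrite big_ord0.
rewrite (_ : (fun y => _) =
  (fun y => \sum_(j < m) f (widen_ord (leqnSn m) j) y + f ord_max y)).
  by apply: cvgD; [apply: IH => j; exact: fc|exact: fc].
by apply/funext => y; rewrite big_ord_recr.
Qed.

Lemma continuous_cabs2 (T : topologicalType) (f : T -> Cx R) (x : T) :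
  {for x, continuous f} -> {for x, continuous (fun y => cabs (f y) ^+ 2)}.
Proof.
move=> fx; apply: (@continuous_comp _ _ _ f (fun w => cabs w ^+ 2)) => //.
apply: (@continuous_comp _ _ _ (@cabs R) (fun a => a ^+ 2)); first exact: continuous_cabs.
exact: exprn_continuous.
Qed.

Lemma euclid_cont (w : 'I_k -> Cx R) (v : 'rV[Cx R]_k) :
  {for v, continuous (fun v : 'rV[Cx R]_k => \sum_j cabs (v 0 j - w j) ^+ 2)}.
Proof.
apply: continuous_sum => j; apply: continuous_cabs2.
apply: (@continuous_comp _ _ _ (fun v : 'rV[Cx R]_k => v 0 j) (fun a : Cx R => a - w j)).
  exact: continuous_coord.
exact: cderiv_cont (cderivB (cderiv_id _) (cderiv_cst (w j) _)).
Qed.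

Lemma euclid_compact (w : 'I_k -> Cx R) (r : R) : 0 <= r ->
  compact [set v : 'rV[Cx R]_k | \sum_j cabs (v 0 j - w j) ^+ 2 <= r ^+ 2].
Proof.
move=> r0.
have cP := @rV_compact (Cx R) k (fun j => [set y : Cx R | cabs (y - w j) <= r])
  (fun j => @compact_cdisc R (w j) r).
apply: (subclosed_compact _ cP).
  apply: (@closed_comp _ _ (fun v : 'rV[Cx R]_k => \sum_j cabs (v 0 j - w j) ^+ 2)
    [set s | s <= r ^+ 2]); last exact: closed_le.
  by move=> v _; exact: euclid_cont.
move=> v /= H j; rewrite -(@ler_pXn2r _ 2) ?nnegrE ?cabs_ge0 //.
apply: le_trans H; rewrite (bigD1 j) //= lerDl.
by apply: sumr_ge0 => i _; rewrite sqr_ge0.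
Qed.

Lemma chart_coord_cont (c : chart R k M) q rho p j : cdom c p ->
  {for p, continuous (fun p => chart_coord c q rho p j)}.
Proof.
move=> cp; apply: (@continuous_comp _ _ _ (fun p => cmap c p 0 j)
  (fun a : Cx R => (a - cmap c q 0 j) * (rho^-1)%:C%C)).
  apply: (@continuous_comp _ _ _ (cmap c) (fun v : 'rV[Cx R]_k => v 0 j)).
    exact: cmap_cont.
  exact: continuous_coord.
apply: cderiv_cont (cderivM _ (cderiv_cst _ _)).
exact: cderivB (cderiv_id _) (cderiv_cst _ _).
Qed.

(** For rho small, the closed ball of radius rho around the image of q lies in the image of the
    chart, so the smaller balls are images of Euclidean compact sets by [cinv]. The last clause,
    that every vector of the ball is the image of a point, will let the explicit flow be transported
    to M. *)
Lemma chart_ballP (c : chart R k M) q (W : set M) :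
  holo_coordinates c -> cdom c q -> open W -> W q ->
  exists2 r0 : R, 0 < r0 & forall rho, 0 < rho -> rho <= r0 ->
    [/\ coord_ball L (chart_coord c q rho) (chart_ball c q rho),
        chart_ball c q rho `<=` W, chart_ball c q rho q &
        forall v : 'rV[Cx R]_k, \sum_j cabs (v 0 j - cmap c q 0 j) ^+ 2 < rho ^+ 2 ->
          (cmap c @` cdom c) v].
Proof.
move=> hc cq oW Wq.
have iq : (cmap c @` cdom c) (cmap c q) by exists q.
have H1 : nbhs (cmap c q) (cmap c @` cdom c) by exact: (near_open (@chart_img_open c) iq).
have H2 : nbhs (cmap c q) (cinv c @^-1` W).
  by apply: (cinv_cont iq); rewrite cmapK //; exact: (near_open oW Wq).
have [e e0 He] := rV_nbhsP (filterI H1 H2).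
exists (e / 2); first by rewrite divr_gt0.
move=> rho rho0 rhoe.
have re : rho < e by rewrite (le_lt_trans rhoe) // ltr_pdivrMr // ltr_pMr // ltr1n.
have inE' (v : 'rV[Cx R]_k) : \sum_j cabs (v 0 j - cmap c q 0 j) ^+ 2 <= rho ^+ 2 ->
    (cmap c @` cdom c) v /\ W (cinv c v).
  move=> H; apply: He => j; rewrite (le_lt_trans _ re) //.
  rewrite -(@ler_pXn2r _ 2) ?nnegrE ?cabs_ge0 ?(ltW rho0) //.
  by apply: le_trans (@cabs_le_normsq (fun j => v 0 j - cmap c q 0 j) j) H.
have nE p : (normsq (chart_coord c q rho p) < 1) =
    (\sum_j cabs (cmap c p 0 j - cmap c q 0 j) ^+ 2 < rho ^+ 2).
  by rewrite chart_coord_normsq // ltr_pdivrMr ?exprn_gt0 // mul1r.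
have nc p : cdom c p -> {for p, continuous (fun p => normsq (chart_coord c q rho p))}.
  by move=> cp; apply: continuous_sum => j; apply: continuous_cabs2; exact: chart_coord_cont.
have ballq : chart_ball c q rho q.
  by split=> //; rewrite nE big1 ?exprn_gt0 // => j _; rewrite subrr cabs0 expr0n.
split => //; last by move=> v /ltW /inE' [].
  split.
  - rewrite openE => p [cp np].
    have oc := near_open (@chart_dom_open c) cp.
    have := nc p cp; move=> /(_ [set x : R | x < 1]) nn.
    have n1 : nbhs (normsq (chart_coord c q rho p)) [set x : R | x < 1].
      by exact: (near_open (@open_lt R 1) np).
    exact: filterI oc (nn n1).
  - by move=> p j [cp _]; exact: chart_coord_cont.
  - by move=> p [].
  - move=> r r1; have [r0|r0] := ltP r 0.
      rewrite (_ : [set p | _] = set0); first exact: compact0.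
      rewrite -subset0 => p [_] /=; rewrite leNgt (lt_le_trans r0) //; exact: normsq_ge0.
    have r2 : 0 <= rho * Num.sqrt r by rewrite mulr_ge0 ?sqrtr_ge0 // ltW.
    have rr : (rho * Num.sqrt r) ^+ 2 <= rho ^+ 2.
      by rewrite exprMn sqr_sqrtr // ger_pMr ?exprn_gt0 // ltW.
    rewrite (_ : [set p | _] = cinv c @` [set v : 'rV[Cx R]_k |
        \sum_j cabs (v 0 j - cmap c q 0 j) ^+ 2 <= (rho * Num.sqrt r) ^+ 2]).
      apply: continuous_compact; last exact: euclid_compact.
      apply: continuous_in_subspaceT => v; rewrite inE => /= Hv.
      by apply: cinv_cont; have [] := inE' v (le_trans Hv rr).
    apply/seteqP; split => [p [[cp np] pr]|_ [v /= Hv <-]].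
      exists (cmap c p); last exact: cmapK.
      rewrite /= exprMn sqr_sqrtr // mulrC -ler_pdivrMr ?exprn_gt0 //.
      by rewrite -chart_coord_normsq.
    have [[p cp pv] _] := inE' v (le_trans Hv rr).
    rewrite -pv cmapK //; rewrite -pv in Hv.
    have nr : normsq (chart_coord c q rho p) <= r.
      rewrite chart_coord_normsq // ler_pdivrMr ?exprn_gt0 //.
      by rewrite -[r]sqr_sqrtr // mulrC -exprMn.
    by split => //; split => //; exact: le_lt_trans nr r1.
  - move=> i p j ip [cp _]; have [d Hd] := leaf_chart_derivable j hc ip cp.
    eexists; apply: cderivM; last exact: cderiv_cst.
    by apply: cderivB; [exact: Hd|exact: cderiv_cst].
move=> p [cp]; rewrite nE => /ltW /inE' [_]; rewrite cmapK //.
Qed.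

(** Each piece is open and they are disjoint, so every condition is local to one of them; the two
    pieces may have the same image in C^k, since z is allowed to be several to one. *)
Lemma coord_ballU z1 D1 z2 D2 : coord_ball L z1 D1 -> coord_ball L z2 D2 ->
  D1 `&` D2 = set0 ->
  coord_ball L (fun p => if `[< D1 p >] then z1 p else z2 p) (D1 `|` D2).
Proof.
move=> [opD1 c1 n1 K1 d1] [opD2 c2 n2 K2 d2] D12.
have nD p : D2 p -> ~ D1 p by move=> p2 p1; have : (D1 `&` D2) p by []; rewrite D12.
pose z p := if `[< D1 p >] then z1 p else z2 p.
have e1 p : D1 p -> z p = z1 p by move=> p1; rewrite /z asboolT.
have e2 p : D2 p -> z p = z2 p by move=> p2; rewrite /z asboolF //; exact: nD.
rewrite -/z; split.
- exact: openU.
- have cont z' (D' : set M) p j : open D' -> (forall p, D' p -> z p = z' p) -> D' p ->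
      {for p, continuous (fun p => z' p j)} -> {for p, continuous (fun p => z p j)}.
    move=> oD' zz Dp; rewrite /prop_for /continuous_at zz // => H.
    apply: cvg_trans H; apply: near_eq_cvg; apply: filterS (near_open oD' Dp) => p' Dp'.
    by rewrite zz.
  move=> p j [p1|p2]; first exact: (cont z1 D1 p j opD1 e1 p1 (c1 p j p1)).
  exact: (cont z2 D2 p j opD2 e2 p2 (c2 p j p2)).
- by move=> p [p1|p2]; [rewrite e1 //; exact: n1|rewrite e2 //; exact: n2].
- move=> r r1; rewrite (_ : [set p | _] =
      [set p | D1 p /\ normsq (z1 p) <= r] `|` [set p | D2 p /\ normsq (z2 p) <= r]).
    by apply: compactU; [exact: K1|exact: K2].
  apply/seteqP; split => p /=.
    by move=> [[p1|p2]]; [rewrite e1 //; left|rewrite e2 //; right].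
  by move=> [[p1]|[p2]] H; [rewrite e1 //; split => //; left|rewrite e2 //; split => //; right].
have der z' (D' : set M) (i : fbox L) p j d : open D' -> (forall p, D' p -> z p = z' p) ->
    fdom i p -> D' p ->
    cderiv (fun x => z' (finv (x, (fmap i p).2)) j) (fmap i p).1 d ->
    cderiv (fun x => z (finv (x, (fmap i p).2)) j) (fmap i p).1 d.
  move=> oD' zz ip Dp; apply: cderiv_near.
  by apply: filterS (leaf_near ip oD' Dp) => x [_ Dx]; rewrite zz.
move=> i p j ip [p1|p2].
  by have [d H] := d1 i p j ip p1; exists d; exact: (der z1 D1 i p j d opD1 e1 ip p1 H).
by have [d H] := d2 i p j ip p2; exists d; exact: (der z2 D2 i p j d opD2 e2 ip p2 H).
Qed.

End ChartBalls.

(** * Lifting discs to the universal covering *)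

Lemma within_open_continuous (T U : topologicalType) (V : set T) (f : T -> U) x :
  open V -> {within V, continuous f} -> V x -> {for x, continuous f}.
Proof.
move=> oV; rewrite continuous_open_subspace; last exact: oV.
by move=> H Vx; apply: H; rewrite inE.
Qed.

Section Lifting.
Variable R : realType.
Implicit Types (s w v x y : Cx R).

Definition disc x (r : R) : set (Cx R) := [set y | cabs (y - x) < r].

Definition cconvex (A : set (Cx R)) := forall x y (t : R), A x -> A y -> 0 <= t <= 1 ->
  A (x + t%:C%C * (y - x)).

Lemma disc_convex x r : cconvex (disc x r).
Proof.
move=> y w t yr wr t01; rewrite /disc /=.
by apply: disc_segment => //; rewrite [y + _]addrC subrK.
Qed.

Lemma cconvexI A B : cconvex A -> cconvex B -> cconvex (A `&` B).
Proof. by move=> cA cB x y t [xA xB] [yA yB] t01; split; [exact: cA|exact: cB]. Qed.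

Lemma disc_center x r : 0 < r -> disc x r x.
Proof. by rewrite /disc /= subrr cabs0. Qed.

(** Connectedness of the segment from x to y, along which P and its negation are both open. *)
Lemma convex_locconst (A : set (Cx R)) (P : Cx R -> Prop) : open A -> cconvex A ->
  (forall s, A s -> \forall s' \near s, P s' <-> P s) ->
  forall x y, A x -> A y -> P x -> P y.
Proof.
move=> oA cA Pl x y Ax Ay Px.
pose f (t : R) := x + t%:C%C * (y - x).
have fc : continuous f.
  move=> t; apply/(cvg_cabsP (nbhs_filter t)) => e e0.
  have c0 : 0 < cabs (y - x) + 1 by rewrite ltr_wpDl ?cabs_ge0.
  apply/nbhs_ballP; exists (e / (cabs (y - x) + 1)) => /=; first exact: divr_gt0.
  move=> u; rewrite /ball /= => tu.
  rewrite /f opprD addrACA subrr add0r -mulrBl -rmorphB /= cabsM cabsR distrC.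
  rewrite (@le_lt_trans _ _ (`|t - u| * (cabs (y - x) + 1))) //.
    by rewrite ler_wpM2l // lerDl.
  by rewrite -ltr_pdivlMr.
pose C1 := [set t | A (f t) /\ P (f t)]; pose C2 := [set t | A (f t) /\ ~ P (f t)].
have oC1 : open C1.
  rewrite openE => t [At Pt].
  have n1 : \forall u \near t, A (f u) by exact: (fc t _ (near_open oA At)).
  have n2 : \forall u \near t, P (f u) <-> P (f t) by exact: (fc t _ (Pl _ At)).
  apply: filterS2 n1 n2.
  by move=> u Au /= Pu; split => //; apply/Pu.
have oC2 : open C2.
  rewrite openE => t [At Pt].
  have n1 : \forall u \near t, A (f u) by exact: (fc t _ (near_open oA At)).
  have n2 : \forall u \near t, P (f u) <-> P (f t) by exact: (fc t _ (Pl _ At)).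
  apply: filterS2 n1 n2.
  by move=> u Au /= Pu; split => //; move/Pu.
have f01 (t : R) : 0 <= t <= 1 -> A (f t) by exact: cA.
have BE : `[0, 1]%classic `&` C1 = `[0, 1]%classic.
  apply: (@segment_connected R 0 1).
  - exists 0; split; first by rewrite /= in_itv /= lexx ler01.
    by rewrite /C1 /= /f mul0r addr0.
  - by exists C1.
  - exists (~` C2); first by rewrite closedC.
    apply/seteqP; split => t [t01 Ht]; split => //; first by move=> [_]; case: Ht.
    have At : A (f t) by apply: f01; move: t01; rewrite /= in_itv.
    by split => //; apply: contrapT => nP; exact: Ht.
have : (`[0, 1]%classic `&` C1) 1 by rewrite BE /= in_itv /= ler01 lexx.
by move=> [_ []]; rewrite /f mul1r [x + _]addrC subrK.
Qed.

Lemma cderiv_inverse (h sg : Cx R -> Cx R) w d : d != 0 -> cderiv h w d ->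
  {for h w, continuous sg} -> sg (h w) = w -> (\forall v \near h w, h (sg v) = v) ->
  cderiv sg (h w) d^-1.
Proof.
move=> d0 hd sc sw hs e e0.
have cd : 0 < cabs d by rewrite cabs_gt0.
(* The first bound yields |q| <= 2 |p| / |d|; the second one then converts the remainder of h into a
   remainder e |p| for sg. *)
pose e' := Num.min (cabs d / 2) (e * cabs d / 2 * cabs d).
have e'0 : 0 < e' by rewrite lt_min !mulr_gt0 // ?invr_gt0.
have [r r0 Hr] := hd _ e'0.
have /(cvg_cabsP (nbhs_filter _)) /(_ _ r0) := sc; rewrite sw => sn.
have [t t0 Ht] := iffLR (nbhs_cabsP _ _) (filterI hs sn).
exists t => // v /Ht [hv svr]; have {}Hr := Hr _ svr; rewrite hv in Hr.
set q := sg v - w in svr Hr; set p := v - h w in Hr.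
have e'1 : e' <= cabs d / 2 by rewrite ge_min lexx.
have e'2 : e' <= e * cabs d / 2 * cabs d by rewrite ge_min lexx orbT.
have q1 : cabs d / 2 * cabs q <= cabs p.
  have := cabs_triangle (d * q) p 0; have := cabs_triangle p (d * q) 0.
  rewrite !subr0 cabsM [cabs (d * q - p)]cabsC.
  by have := ler_wpM2r (cabs_ge0 q) e'1; move: Hr; clear; lra.
rewrite -/q -/p (_ : q - d^-1 * p = - ((p - d * q) / d)); last by field.
rewrite cabsN cabsM cabsV ler_pdivrMr // (le_trans Hr) //.
apply: le_trans (ler_wpM2r (cabs_ge0 q) e'2) _.
rewrite (_ : _ * _ * cabs q = e * cabs d * (cabs d / 2 * cabs q)); last by ring.
by rewrite -[X in _ <= X]mulrAC ler_pM2l // mulr_gt0.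
Qed.

End Lifting.

Section CoveringLift.
Variables (R : realType) (k : nat) (M : complexManifold R k) (Y : set M).
Variable L : lamination Y.
Variables (A : set M) (phi psi : Cx R -> M) (rho : R).
Hypothesis leafA : is_leaf L A.
Hypothesis cov : disc_covering L A phi.
Hypothesis psi_holo : leafwise_holo L (disc 0 rho) psi.
Hypothesis psi0 : A (psi 0).
Hypothesis rho0 : 0 < rho.

Implicit Types (s w v : Cx R) (i : fbox L) (f g : Cx R -> Cx R).

Lemma finv_plaque i (x : Cx R) (t : ftrans i) : fbase i x -> plaque t (finv (x, t)).
Proof. by move=> bx; exists (x, t). Qed.

(** Near each point psi stays in one plaque and A is saturated, so membership in A is locally
    constant along psi. *)
Lemma psi_in_leaf s : disc 0 rho s -> A (psi s).
Proof.
have [[AY A0 Ac Asat] _] := leafA.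
move=> ds; apply: (@convex_locconst R (disc 0 rho) (fun s => A (psi s))) ds psi0.
- exact: open_disc.
- exact: disc_convex.
- move=> s' ds'; have [Ys' Hs'] := psi_holo ds'.
  have [i is'] := @fdom_cover _ _ _ _ L _ Ys'; have [nr _] := Hs' i is'.
  have [bs' sK'] := fmapK is'.
  apply: filterS nr => s'' [is'' t''].
  have [bs'' sK''] := fmapK is''.
  have p1 : plaque (fmap i (psi s')).2 (psi s').
    by rewrite -[X in plaque _ X]sK' [X in finv X]surjective_pairing; exact: finv_plaque.
  have p2 : plaque (fmap i (psi s')).2 (psi s'').
    by rewrite -[X in plaque _ X]sK'' [X in finv X]surjective_pairing t''; exact: finv_plaque.
  split => [h|h].
    by apply: (Asat i (fmap i (psi s')).2) p1; exists (psi s'').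
  by apply: (Asat i (fmap i (psi s')).2) p2; exists (psi s').
- exact: disc_center.
Qed.

Definition is_lift (N : set (Cx R)) f := forall s, N s ->
  [/\ {for s, continuous f}, unit_disc (f s) & phi (f s) = psi s].

Lemma is_lift_sub (N N' : set (Cx R)) f : N' `<=` N -> is_lift N f -> is_lift N' f.
Proof. by move=> NN H s /NN; exact: H. Qed.

(** What the gluing of lifts requires of an evenly covered neighbourhood: uniqueness of lifts on
    open convex subsets, and a lift through every point of a fibre. In this form it passes to
    smaller discs. *)
Definition evenly_covered s (d : R) := [/\ disc s d `<=` disc 0 rho,
  (forall N f g s1, open N -> cconvex N -> N `<=` disc s d -> is_lift N f -> is_lift N g ->
     N s1 -> f s1 = g s1 -> forall s2, N s2 -> f s2 = g s2) &
  (forall s1 w, disc s d s1 -> unit_disc w -> phi w = psi s1 ->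
     exists2 g, is_lift (disc s d) g & g s1 = w)].

Lemma evenly_covered_sub s d s' d' : disc s' d' `<=` disc s d ->
  evenly_covered s d -> evenly_covered s' d'.
Proof.
move=> sub [h1 h2 h3]; split.
- exact: subset_trans sub h1.
- by move=> N f g s1 oN cN Ns; apply: h2 => //; exact: subset_trans Ns sub.
- move=> s1 w s1d uw E; have [g gl gs] := h3 s1 w (sub _ s1d) uw E.
  by exists g => //; exact: is_lift_sub gl.
Qed.

(** Near s the values of psi lie in an evenly covered piece of plaque, and a lift is the inverse of
    phi on one sheet applied to the plaque coordinate of psi. Two lifts equal at a point are on the
    same sheet there, whence uniqueness by connectedness. *)
Lemma local_sheets s : disc 0 rho s -> exists2 d : R, 0 < d &
  evenly_covered s d /\
  forall N f, open N -> N `<=` disc s d -> N s -> is_lift N f -> exists e, cderiv f s e.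
Proof.
move=> ds; have As := psi_in_leaf ds.
have [phol _ covP] := cov; have [i [V [F [ips [oV Vb Vx] trF UF HF]]]] := covP _ As.
set t := (fmap i (psi s)).2 in UF HF.
have [Ys Hs] := psi_holo ds; have [nr ds_der] := Hs i ips.
have [_ xcont] := (tt, cderiv_cont (derivable_cderiv ds_der)).
have nV : \forall s' \near s, V (fmap i (psi s')).1 by exact: (xcont _ (near_open oV Vx)).
have nD : \forall s' \near s, disc 0 rho s'.
  by exact: (near_open (@open_disc R 0 rho) ds).
have [d d0 Hd] := iffLR (nbhs_cabsP _ _) (filterI (filterI nr nV) nD).
pose x s' := (fmap i (psi s')).1.
have Hx s' : disc s d s' -> [/\ fdom i (psi s'), V (x s'), disc 0 rho s' & psi s' = finv (x s', t)].
  move=> /Hd [[[i' t'] v'] d']; split => //; have [_ {1}<-] := fmapK i'.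
  by rewrite [X in finv X]surjective_pairing t'.
have xc s' : disc s d s' -> {for s', continuous x}.
  move=> /Hx [i' _ d' _]; have [_ H'] := psi_holo d'; have [_ H2] := H' i i'.
  exact: cderiv_cont (derivable_cderiv H2).
have fibre s' w : disc s d s' -> unit_disc w -> phi w = psi s' ->
    exists2 W, F W & W w.
  move=> /Hx [_ v' _ E] uw pw.
  have : (\bigcup_(W in F) W) w.
    by rewrite UF; split => //; rewrite /= pw E; exists (x s', t).
  by move=> [W FW Ww]; exists W.
have sheet W : F W -> exists sg, [/\ open W, W `<=` @unit_disc R,
    {within V, continuous sg},
    forall v, V v -> W (sg v) /\ phi (sg v) = finv (v, t) &
    forall w, W w -> sg (fmap i (phi w)).1 = w].
  move=> FW; have [oW [sg [sc s1 s2]]] := HF W FW; exists sg; split => //.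
  move=> w Ww; have : (\bigcup_(W in F) W) w by exists W.
  by rewrite UF => -[].
(* On a sheet a lift is the inverse of phi on the sheet composed with psi. *)
have on_sheet W sg N f s' : F W -> (forall w, W w -> sg (fmap i (phi w)).1 = w) ->
    open W -> N `<=` disc s d -> open N -> is_lift N f -> N s' -> W (f s') ->
    \forall s'' \near s', N s'' /\ f s'' = sg (x s'').
  move=> FW sgK oW Nd oN fl Ns' Wf.
  have [fc _ _] := fl _ Ns'.
  have n1 : \forall s'' \near s', W (f s'') by exact: (fc _ (near_open oW Wf)).
  apply: filterS2 n1 (near_open oN Ns') => s'' W'' N''; split => //.
  by have [_ _ pf] := fl _ N''; rewrite /x -pf sgK.
exists d => //; split; first split.
- by move=> s' /Hx [].
- move=> N f g s1 oN cN Nd fl gl N1 E1 s2 N2.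
  apply: (@convex_locconst R N (fun s => f s = g s) oN cN _ s1 s2) => //.
  move=> s' Ns'; have [fc uf pf] := fl _ Ns'; have [gc ug pg] := gl _ Ns'.
  have [E|nE] := pselect (f s' = g s').
    have [W FW Wf] := fibre s' _ (Nd _ Ns') uf pf.
    have [sg [oW _ _ _ sgK]] := sheet W FW.
    have Wg : W (g s') by rewrite -E.
    have n1 := on_sheet W sg N f s' FW sgK oW Nd oN fl Ns' Wf.
    have n2 := on_sheet W sg N g s' FW sgK oW Nd oN gl Ns' Wg.
    by apply: filterS2 n1 n2 => s'' [_ e1] [_ e2]; split => // _; rewrite e1 e2.
  (* The set where the lifts differ is open too, by continuity. *)
  have e0 : 0 < cabs (f s' - g s') / 2.
    by rewrite divr_gt0 // cabs_gt0 subr_eq0; apply/eqP.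
  have /(cvg_cabsP (nbhs_filter _)) /(_ _ e0) n1 := fc.
  have /(cvg_cabsP (nbhs_filter _)) /(_ _ e0) n2 := gc.
  apply: filterS2 n1 n2 => s'' h1 h2; split => // E; exfalso.
  have := cabs_triangle (f s'') (f s') (g s').
  rewrite [cabs (f s' - f s'')]cabsC {2}E.
  by move: h1 h2; rewrite E; lra.
- move=> s1 w s1d uw pw; have [W FW Ww] := fibre s1 w s1d uw pw.
  have [sg [oW Wu sgc sgV sgK]] := sheet W FW.
  exists (sg \o x); last by rewrite /= /x -pw sgK.
  move=> s' s'd; have [i' v' _ E] := Hx _ s'd; have [W' P'] := sgV _ v'.
  split => /=; [|exact: Wu|by rewrite P' -E].
  have sgx : {for x s', continuous sg}.
    exact: (within_open_continuous oV sgc v').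
  exact: (@continuous_comp _ _ _ x sg s' (xc _ s'd) sgx).
move=> N f oN Nd Ns fl.
have sd : disc s d s by exact: disc_center.
have [fc uf pf] := fl _ Ns.
have [W FW Wf] := fibre s _ sd uf pf.
have [sg [oW Wu sgc sgV sgK]] := sheet W FW.
have n1 := on_sheet W sg N f s FW sgK oW Nd oN fl Ns Wf.
(* The inverse [sg] is only continuous by definition of a covering. It becomes holomorphic because h
   is holomorphic and injective on the sheet, so that its derivative does not vanish. *)
pose h w := (fmap i (phi w)).1.
have hW w : W w -> fdom i (phi w) /\ exists e, cderiv h w e.
  move=> Ww; have : (\bigcup_(W in F) W) w by exists W.
  rewrite UF => -[uw [[v t'] [/= Vv ->] E]].
  have iw : fdom i (phi w) by rewrite -E; have [] := @finvK _ _ _ _ L i (v, t) (Vb _ Vv).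
  split => //; have [_ H] := phol _ uw; have [_ H2] := H i iw.
  by eexists; exact: derivable_cderiv H2.
have [r r0 Hr] := iffLR (nbhs_cabsP _ _) (near_open oW Wf).
have [_ [e he]] := hW _ Wf.
have e0 : e != 0.
  apply: (injective_cderiv_neq0 r0 _ _ he) => [w /Hr /hW [] //|w w' /Hr Ww /Hr Ww' E].
  by rewrite -(sgK _ Ww) -(sgK _ Ww') -/(h w) -/(h w') E.
have hf : h (f s) = x s by rewrite /h pf.
have Vs : V (x s) by have [] := Hx _ sd.
have sgd : cderiv sg (h (f s)) e^-1.
  apply: (cderiv_inverse e0 he).
  - by rewrite hf; exact: (within_open_continuous oV sgc Vs).
  - exact: sgK.
  - rewrite hf; apply: filterS (near_open oV Vs) => v Vv; have [_ P] := sgV v Vv.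
    by rewrite /h P; have [_ ->] := @finvK _ _ _ _ L i (v, t) (Vb _ Vv).
rewrite hf in sgd; have [_ H'] := psi_holo ds; have [_ H2] := H' i ips.
eexists; apply: cderiv_near (cderiv_comp (derivable_cderiv H2) sgd).
by apply: filterS n1 => s' [_ ->].
Qed.

(** A Lebesgue number for the closed disc of radius r. *)
Lemma uniform_sheets (r : R) : r < rho -> exists2 d : R, 0 < d &
  forall s, cabs s <= r -> evenly_covered s d.
Proof.
move=> rr; have /compact_near_coveringP cK := @compact_cdisc R 0 r.
have : \forall d \near (0 : R)^'+, [set y : Cx R | cabs (y - 0) <= r] `<=`
    (fun s => evenly_covered s d).
  apply: cK => s /= sr; have sd : disc 0 rho s by apply: le_lt_trans sr rr.
  have [d d0 [H _]] := local_sheets sd.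
  have d20 : 0 < d / 2 by rewrite divr_gt0.
  exists (disc s (d / 2), [set e | e < d / 2]) => /=.
    by split; [exact: near_cabs|exact: nbhs_right_lt].
  move=> [s' e] /= [s'd ed]; apply: evenly_covered_sub H => y ye.
  rewrite /disc /= (le_lt_trans (cabs_triangle s' _ _)) // (splitr d) ltrD //.
  exact: lt_trans ye ed.
move=> H; have [d [Hd d0]] := @filter_ex _ _ (at_right_proper_filter 0) _
  (filterI H (nbhs_right_gt (0 : R))).
by exists d => // s sr; apply: Hd; rewrite /= subr0.
Qed.

(** A point s of the larger disc is lifted by the local lift centred at its contraction [c s] in the
    smaller disc, at distance less than d / 2. Local lifts with centres s and s' agree where both
    are defined: the midpoint of the centres lies in both discs and in the smaller disc, where they
    extend f, and uniqueness propagates from there. *)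
Lemma extend_lift (r r' d : R) f : 0 < d -> 0 < r -> r <= r' ->
  (forall s, cabs s <= r' -> evenly_covered s d) -> is_lift (disc 0 r) f ->
  exists2 g, is_lift (disc 0 (r + d / 2)) g & g 0 = f 0.
Proof.
move=> d0 r0 rr' ec fl.
have ecr s : disc 0 r s -> evenly_covered s d.
  by rewrite /disc /= subr0 => sr; apply: ec; exact: le_trans (ltW sr) rr'.
(* The lifts over the discs centred in disc 0 r which extend f there. *)
have ext (s : Cx R) : exists g, disc 0 r s -> is_lift (disc s d) g /\ g s = f s.
  have [sr|nsr] := pselect (disc 0 r s); last by exists f.
  have [_ uf pf] := fl _ sr; have [_ _ H] := ecr _ sr.
  by have [g gl gs] := H s (f s) (disc_center _ d0) uf pf; exists g.
have [G HG] := choice ext.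
have Gf s y : disc 0 r s -> disc 0 r y -> disc s d y -> G s y = f y.
  move=> sr yr yd; have [gl gs] := HG _ sr; have [_ U _] := ecr _ sr.
  have oN : open (disc s d `&` disc 0 r) by apply: openI; exact: open_disc.
  have cN : cconvex (disc s d `&` disc 0 r) by apply: cconvexI; exact: disc_convex.
  have sN : (disc s d `&` disc 0 r) s by split => //; exact: disc_center.
  exact: (U _ (G s) f s oN cN (@subIsetl _ _ _) (is_lift_sub (@subIsetl _ _ _) gl)
    (is_lift_sub (@subIsetr _ _ _) fl) sN gs y (conj yd yr)).
have GG s s' y : disc 0 r s -> disc 0 r s' -> disc s d y -> disc s' d y -> G s y = G s' y.
  move=> sr sr' yd yd'; have [gl gs] := HG _ sr; have [gl' gs'] := HG _ sr'.
  pose m := s + (2^-1)%:C%C * (s' - s).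
  have h01 : 0 <= (2^-1 : R) <= 1 by rewrite invr_ge0 ler0n invf_le1 // ler1n.
  have mr : disc 0 r m by apply: disc_convex.
  have ss' : cabs (s' - s) < d + d.
    by rewrite (le_lt_trans (cabs_triangle y _ _)) // ltrD // cabsC.
  have hh : cabs ((2^-1)%:C%C * (s' - s)) < d.
    by rewrite cabsM cabsR ger0_norm ?invr_ge0 // mulrC ltr_pdivrMr // mulr2n mulrDr mulr1.
  have md : disc s d m by rewrite /disc /m /= [s + _]addrC addrK.
  have md' : disc s' d m.
    rewrite /disc /m /= (_ : _ - s' = - ((2^-1)%:C%C * (s' - s))); first by rewrite cabsN.
    have E : (1 : Cx R) = (2^-1)%:C%C + (2^-1)%:C%C.
      by rewrite -rmorphD /= -(rmorph1 (real_complex R)); congr (_%:C%C); lra.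
    rewrite -[X in X + _ - s' = _]mul1r -[X in _ - X = _]mul1r E; ring.
  have [_ U _] := ecr _ sr.
  have oN : open (disc s d `&` disc s' d) by apply: openI; exact: open_disc.
  have cN : cconvex (disc s d `&` disc s' d) by apply: cconvexI; exact: disc_convex.
  have gm : G s m = G s' m by rewrite (Gf s m sr mr md) (Gf s' m sr' mr md').
  exact: (U _ (G s) (G s') m oN cN (@subIsetl _ _ _) (is_lift_sub (@subIsetl _ _ _) gl)
    (is_lift_sub (@subIsetr _ _ _) gl') (conj md md') gm y (conj yd yd')).
pose c (s : Cx R) := (r / (r + d / 2))%:C%C * s.
have rd0 : 0 < r + d / 2 by rewrite addr_gt0 // divr_gt0.
have c1 s : disc 0 (r + d / 2) s -> disc 0 r (c s) /\ disc (c s) d s.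
  rewrite /disc /= !subr0 => sr; split.
    rewrite /c cabsM cabsR gtr0_norm ?divr_gt0 // mulrAC ltr_pdivrMr //.
    by rewrite ltr_pM2l.
  rewrite (_ : s - c s = ((d / 2) / (r + d / 2))%:C%C * s).
    rewrite cabsM cabsR gtr0_norm ?divr_gt0 // mulrAC ltr_pdivrMr //.
    rewrite (@lt_le_trans _ _ (d / 2 * (r + d / 2))) //.
      by rewrite ltr_pM2l // divr_gt0.
    by rewrite ler_pM2r // ler_pdivrMr // ler_peMr ?ler1n // ltW.
  rewrite /c -{1}[s]mul1r -mulrBl; congr (_ * s).
  rewrite -(rmorph1 (real_complex R)) -rmorphB /=; congr (_%:C%C).
  by field; rewrite gt_eqF //; lra.
exists (fun s => G (c s) s).
  move=> s sr; have [cr cd] := c1 _ sr; have [gl _] := HG _ cr; have [gc gu gp] := gl _ cd.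
  split; [|exact: gu|exact: gp].
  have E : \forall y \near s, G (c s) y = G (c y) y.
    have n1 := near_open (@open_disc R 0 (r + d / 2)) sr.
    have n2 := near_open (@open_disc R (c s) d) cd.
    by apply: filterS2 n1 n2 => y y1 y2; have [h1 h2] := c1 _ y1; exact: GG.
  rewrite /prop_for /continuous_at; apply: cvg_trans gc.
  by apply: (@near_eq_cvg _ _ (nbhs s) (nbhs_filter s)); apply: filterS E => y.
have z0 : disc 0 r (0 : Cx R) by exact: disc_center.
have c0 : c 0 = 0 by rewrite /c mulr0.
by rewrite c0; have [_ ->] := HG _ z0.
Qed.

(** The radius grows by d / 2 at each step, d being uniform up to r, until r is reached. *)
Lemma lift_exists (r : R) w : 0 < r -> r < rho -> unit_disc w -> phi w = psi 0 ->
  exists f, [/\ is_lift (disc 0 r) f, f 0 = w &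
    forall s, disc 0 r s -> exists e, cderiv f s e].
Proof.
move=> r0 rr uw pw; have [d d0 ec] := uniform_sheets rr.
have d20 : 0 < d / 2 by rewrite divr_gt0.
have step n : exists2 f, is_lift (disc 0 (Num.min r (n.+1%:R * (d / 2)))) f & f 0 = w.
  elim: n => [|n [f fl f0]].
    have [_ _ H] := ec 0 (ltac:(by rewrite cabs0; exact: ltW)).
    have [f fl f0] := H 0 w (disc_center _ d0) uw pw; exists f => //.
    apply: is_lift_sub fl => s; rewrite /disc /= => sd; apply: lt_le_trans sd _.
    have d2 : d / 2 <= d by lra.
    by rewrite mul1r (le_trans _ d2) // ge_min lexx orbT.
  have m0 : 0 < Num.min r (n.+1%:R * (d / 2)) by rewrite lt_min r0 mulr_gt0.
  have mr : Num.min r (n.+1%:R * (d / 2)) <= r by rewrite ge_min lexx.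
  have [g gl g0] := extend_lift d0 m0 mr ec fl.
  exists g; last by rewrite g0.
  apply: is_lift_sub gl => s; rewrite /disc /= => sd; apply: lt_le_trans sd _.
  have E : n.+2%:R * (d / 2) = n.+1%:R * (d / 2) + d / 2.
    by rewrite -[n.+2]addn1 natrD mulrDl mul1r.
  rewrite E; have [h|h] := leP r (n.+1%:R * (d / 2)); last by rewrite ge_min lexx orbT.
  by rewrite ge_min lerDl (ltW d20).
have [f fl f0] := step (Num.bound (r / (d / 2))).
have fl' : is_lift (disc 0 r) f.
  apply: is_lift_sub fl => s; rewrite /disc /= => sd; apply: lt_le_trans sd _.
  rewrite le_min lexx /= -ler_pdivrMr //.
  have := @archi_boundP _ (r / (d / 2)) (divr_ge0 (ltW r0) (ltW d20)).
  by move=> /ltW /le_trans; apply; rewrite ler_nat.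
exists f; split => // s sr.
have sr' : disc 0 rho s by apply: lt_trans sr rr.
have [e e0 [_ H]] := local_sheets sr'.
have oN : open (disc s e `&` disc 0 r) by apply: openI; exact: open_disc.
have sN : (disc s e `&` disc 0 r) s by split => //; exact: disc_center.
exact: (H _ f oN (@subIsetl _ _ _) sN (is_lift_sub (@subIsetr _ _ _) fl')).
Qed.

End CoveringLift.

(** * Schwarz's lemma and the Poincare density along a disc *)

Lemma moebius_le1 (R : realType) (z w : Cx R) : cabs z < 1 -> cabs w < 1 ->
  1 - cconj z * w != 0 /\ cabs ((w - z) / (1 - cconj z * w)) <= 1.
Proof.
move=> z1 w1.
have zw : cabs (cconj z * w) < 1.
  rewrite cabsM cabs_conj (le_lt_trans _ w1) // ler_piMl ?cabs_ge0 //; exact: ltW.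
have n0 : 0 < cabs (1 - cconj z * w).
  have := cabs_triangle (cconj z * w) 1 0; rewrite !subr0 cabs1.
  lra.
split; first by rewrite -cabs_gt0.
rewrite cabsM cabsV ler_pdivrMr // mul1r -(@ler_pXn2r _ 2) ?nnegrE ?cabs_ge0 //.
rewrite -subr_ge0 (_ : _ - _ = (1 - cabs z ^+ 2) * (1 - cabs w ^+ 2)).
  by rewrite mulr_ge0 // subr_ge0 exprn_ile1 ?cabs_ge0 // ltW.
by rewrite !cabs2; case: z {z1 zw n0} => a b; case: w {w1} => c d /=; ring.
Qed.

Section PoincareBound.
Variables (R : realType) (k : nat) (M : complexManifold R k) (Y : set M).
Variable L : lamination Y.

(** The lift f of psi, followed by the automorphism of the disc that sends zeta to 0, is bounded by
    1; Cauchy's estimate on the disc of radius rho / 2 bounds its derivative b at 0 by 32 / rho.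
    Since |f'| = |b| (1 - |zeta|^2), the factor (1 - |zeta|^2)^2 in the density cancels and 2 |b|^2
    remains. When no covering exists the density has its default value 0. *)
Lemma poincare_density_bound (psi : Cx R -> M) (rho : R) (i : fbox L) : 0 < rho ->
  leafwise_holo L (disc 0 rho) psi -> fdom i (psi 0) ->
  poincare_density i (psi 0) * cabs (derive1 (fun s => (fmap i (psi s)).1) 0) ^+ 2 <=
    2 * (32 / rho) ^+ 2.
Proof.
move=> rho0 ph i0.
have B0 : 0 <= 2 * (32 / rho) ^+ 2 by rewrite mulr_ge0 // sqr_ge0.
rewrite /poincare_density; case: xgetP => [d _ /= [A [phi [zeta [lA cov uz pz dE]]]]|_]; last first.
  by rewrite mul0r.
have [phol pA _] := cov.
have A0 : A (psi 0) by rewrite -pA -pz; exists zeta.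
have r0 : 0 < rho / 2 by rewrite divr_gt0.
have rr : rho / 2 < rho by rewrite ltr_pdivrMr // ltr_pMr // ltr1n.
have [f [fl f0 fd]] := lift_exists lA cov ph A0 rho0 r0 rr uz pz.
have d0 : disc 0 (rho / 2) (0 : Cx R) by exact: disc_center.
have [f' ff'] := fd _ d0.
set e := derive1 _ zeta in dE.
have ze : cderiv (fun s => (fmap i (phi s)).1) zeta e.
  have [_ H] := phol _ uz; have [|_ H2] := H i; first by rewrite pz.
  exact: derivable_cderiv H2.
have E : derive1 (fun s => (fmap i (psi s)).1) 0 = e * f'.
  apply: cderiv_derive1; rewrite -f0 in ze.
  apply: cderiv_near (cderiv_comp ff' ze).
  have n1 := near_open (@open_disc R 0 (rho / 2)) d0.
  by apply: filterS n1 => s /fl [_ _ /= ->].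
have uz1 : cabs zeta < 1 := uz.
pose G s := (f s - zeta) * (1 - cconj zeta * f s)^-1.
have fu s : disc 0 (rho / 2) s -> cabs (f s) < 1 by move=> /fl [].
have q0 : 0 < 1 - cabs zeta ^+ 2 by rewrite subr_gt0 exprn_ilt1 ?cabs_ge0.
have zz : 1 - cconj zeta * zeta = (1 - cabs zeta ^+ 2)%:C%C.
  by apply: cx_eq; rewrite ?cReB ?cImB cabs2; case: zeta {dE uz pz f0 ze e E uz1 G q0} => a b /=; ring.
have Gd s a : disc 0 (rho / 2) s -> cderiv f s a -> exists b, cderiv G s b /\
    (s = 0 -> b = (1 - cconj zeta * zeta)^-1 * a).
  move=> ds fa; have [n0 _] := moebius_le1 uz1 (fu _ ds).
  have h1 := cderivB fa (cderiv_cst zeta s).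
  have h2 := cderivB (cderiv_cst 1 s) (cderivM (cderiv_cst (cconj zeta) s) fa).
  have H := cderivM h1 (@cderivV _ (fun y => 1 - cconj zeta * f y) s _ n0 h2).
  eexists; split; first exact: H.
  by move=> ->; rewrite f0 subrr mul0r add0r subr0.
have [b [Gb bE]] := Gd 0 f' d0 ff'.
have bB : cabs b <= 16 * 1 / (rho / 2).
  apply: (Cauchy_estimate r0 _ _ Gb) => w ws.
    by have [a fa] := fd w ws; have [b' []] := Gd w a ws fa; exists b'.
  by have [_] := moebius_le1 uz1 (fu _ ws).
have f'E : cabs f' = cabs b * (1 - cabs zeta ^+ 2).
  rewrite bE // cabsM cabsV zz cabsR gtr0_norm // mulrAC mulVf ?mul1r //.
  by rewrite gt_eqF.
rewrite E cabsM f'E dE.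
have [->|e0] := eqVneq (cabs e) 0; first by rewrite mul0r expr0n mulr0.
rewrite (_ : _ * _ = 2 * cabs b ^+ 2); last by field; rewrite e0 gt_eqF.
have b2 : cabs b ^+ 2 <= (16 * 1 / (rho / 2)) ^+ 2.
  by rewrite ler_pXn2r ?nnegrE ?cabs_ge0 // (le_trans (cabs_ge0 _) bB).
rewrite (_ : 32 / rho = 16 * 1 / (rho / 2)); last by field; rewrite gt_eqF.
by rewrite ler_pM2l.
Qed.

End PoincareBound.

(** * The complex exponential and linear differential equations *)

Section ComplexExponential.
Variable R : realType.

Definition cexp (w : Cx R) : Cx R :=
  Complex (expR (complex.Re w) * cos (complex.Im w))
          (expR (complex.Re w) * sin (complex.Im w)).

Lemma cexp0 : cexp 0 = 1.
Proof. by apply: cx_eq; rewrite /= expR0 ?cos0 ?sin0 ?mulr0 ?mul1r. Qed.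

Lemma cexpD w v : cexp (w + v) = cexp w * cexp v.
Proof.
by case: w => a b; case: v => c d; apply: cx_eq; rewrite /= expRD ?cosD ?sinD; ring.
Qed.

Lemma cabs_cexp w : cabs (cexp w) = expR (complex.Re w).
Proof.
by rewrite cabsE /= !exprMn -mulrDr cos2Dsin2 mulr1 sqrtr_sqr ger0_norm.
Qed.

Lemma cexp_neq0 w : cexp w != 0.
Proof. by rewrite -cabs_gt0 cabs_cexp expR_gt0. Qed.

Lemma is_derive_eps (f : R -> R) (x d : R) : is_derive x 1 f d ->
  forall e, 0 < e -> exists2 r, 0 < r & forall h, `|h| < r ->
    `|f (h + x) - f x - d * h| <= e * `|h|.
Proof.
move=> [fd fE] e e0.
have H : (fun h : R => h^-1 *: ((f \o shift x) (h *: (1 : R)) - f x)) @ 0^' --> d.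
  by rewrite -fE; exact: fd.
have /cvgrPdist_lt /(_ _ e0) /nbhs_ballP [r /= r0 Hr] := H.
exists r => // h hr; have [->|h0] := eqVneq h 0.
  by rewrite add0r subrr mulr0 subrr normr0 mulr0.
have := Hr h; rewrite /ball /= sub0r normrN => /(_ hr h0).
rewrite /GRing.scale /= mulr1 => /ltW H1.
rewrite (_ : _ - _ = - (d - h^-1 * (f (h + x) - f x)) * h); last first.
  by rewrite mulNr mulrBl mulrAC mulVf // mul1r opprB.
by rewrite normrM normrN ler_wpM2r.
Qed.

(** The only point where the remainder is estimated; the addition formula then gives the derivative
    everywhere. *)
Lemma cderiv_cexp0 : cderiv cexp 0 1.
Proof.
(* The real and imaginary parts of the remainder will be at most 4 e' |y| and 5 e' |y|, and 9 / 16 <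
   1. *)
move=> e e0; have [e' [e'0 e'1 e'e]] : exists e', [/\ 0 < e', e' <= 1 & e' <= e / 16].
  exists (Num.min 1 (e / 16)); split; last by rewrite ge_min lexx orbT.
    by rewrite lt_min ltr01 divr_gt0.
  by rewrite ge_min lexx.
have [r1 r10 H1] := is_derive_eps (is_derive_expR (0 : R)) e'0.
have [r2 r20 H2] := is_derive_eps (is_derive_cos (0 : R)) e'0.
have [r3 r30 H3] := is_derive_eps (is_derive_sin (0 : R)) e'0.
exists (Num.min e' (Num.min r1 (Num.min r2 r3))); first by rewrite !lt_min e'0 r10 r20.
move=> y; rewrite subr0 !lt_min => /and4P[ye y1 y2 y3].
case: y ye y1 y2 y3 => a b ye y1 y2 y3.
have aN := Re_le_cabs (a +i* b)%C; have bN := Im_le_cabs (a +i* b)%C.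
rewrite /= in aN bN; set n := cabs _ in aN bN ye y1 y2 y3 *.
have n0 : 0 <= n by exact: cabs_ge0.
have {}H1 := H1 a (le_lt_trans aN y1); have {}H2 := H2 b (le_lt_trans bN y2).
have {}H3 := H3 b (le_lt_trans bN y3).
rewrite !addr0 expR0 mul1r in H1; rewrite !addr0 cos0 sin0 oppr0 mul0r subr0 in H2.
rewrite !addr0 sin0 cos0 mul1r subr0 in H3.
rewrite mul1r cexp0.
set A := expR a in H1; set C := cos b in H2; set S := sin b in H3.
have h1 : `|A - 1 - a| <= e' * n by rewrite (le_trans H1) // ler_pM2l.
have h2 : `|C - 1| <= e' * n by rewrite (le_trans H2) // ler_pM2l.
have h3 : `|S - b| <= e' * n by rewrite (le_trans H3) // ler_pM2l.
have en : e' * n <= n by rewrite ler_piMl.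
have en1 : n <= 1 by rewrite (le_trans (ltW ye)).
have A3 : `|A| <= 3.
  rewrite (_ : A = (A - 1 - a) + a + 1); last by ring.
  rewrite (le_trans (ler_normD _ _)) // normr1.
  rewrite (le_trans (lerD (ler_normD _ _) (lexx _))) //.
  by move: h1 aN en en1; clear; lra.
have A2 : `|A - 1| <= 2 * e'.
  rewrite (_ : A - 1 = (A - 1 - a) + a); last by ring.
  rewrite (le_trans (ler_normD _ _)) //; move: h1 aN en ye; clear; lra.
have S2 : `|S| <= 2 * n.
  rewrite (_ : S = (S - b) + b); last by ring.
  rewrite (le_trans (ler_normD _ _)) //; move: h3 bN en; clear; lra.
apply: le_trans (cabs_le_ReIm _) _.
rewrite !cReB !cImB /= -/A -/C -/S !subr0.
have hr : `|A * C - 1 - a| <= 4 * (e' * n).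
  rewrite (_ : _ - a = A * (C - 1) + (A - 1 - a)); last by ring.
  rewrite (le_trans (ler_normD _ _)) // normrM.
  have := ler_pM (normr_ge0 _) (normr_ge0 _) A3 h2; move: h1; clear; lra.
have hi : `|A * S - b| <= 5 * (e' * n).
  rewrite (_ : _ - b = (A - 1) * S + (S - b)); last by ring.
  rewrite (le_trans (ler_normD _ _)) // normrM.
  have := ler_pM (normr_ge0 _) (normr_ge0 _) A2 S2.
  rewrite (_ : 2 * e' * (2 * n) = 4 * (e' * n)); last by ring.
  move: h3; clear; lra.
apply: le_trans (lerD hr hi) _.
have p : e' * n <= e / 16 * n by rewrite ler_wpM2r.
have q : 0 <= e * n by rewrite mulr_ge0 // ltW.
move: p q; clear; lra.
Qed.

Lemma cderiv_cexp w : cderiv cexp w (cexp w).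
Proof.
have h : cderiv (fun y => y - w) w 1.
  by rewrite -[1]subr0; apply: cderivB; [exact: cderiv_id|exact: cderiv_cst].
have h0 : cderiv cexp (w - w) 1 by rewrite subrr; exact: cderiv_cexp0.
have := cderivZ (cexp w) (cderiv_comp h h0).
rewrite mulr1 mulr1; apply: cderiv_near; apply: (@filterE _ (nbhs w)) => y /=.
by rewrite -cexpD addrC subrK.
Qed.

Lemma cderiv_cexpZ (lam : Cx R) w : cderiv (fun s => cexp (lam * s)) w (lam * cexp (lam * w)).
Proof.
have h : cderiv (fun s => lam * s) w lam.
  by have := cderivZ lam (cderiv_id w); rewrite mulr1.
by rewrite mulrC; exact: (cderiv_comp h (cderiv_cexp _)).
Qed.

(** The product of f with e^(- lam s) has derivative 0 on the disc. *)
Lemma linear_ode (f : Cx R -> Cx R) (lam : Cx R) (r : R) :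
  (forall s, cabs s < r -> cderiv f s (lam * f s)) ->
  forall s, cabs s < r -> f s = f 0 * cexp (lam * s).
Proof.
move=> fd s sr.
pose g s := f s * cexp (- lam * s).
have gE : g s = g 0.
  apply: (@cderiv_zero_cst _ g 0 r); last by rewrite subr0.
  move=> w; rewrite subr0 => wr.
  have := cderivM (fd _ wr) (cderiv_cexpZ (- lam) w).
  by rewrite (_ : _ + _ = 0) //; ring.
have e1 : cexp (- lam * s) * cexp (lam * s) = 1.
  by rewrite -cexpD mulNr addrC subrr cexp0.
have g0 : g 0 = f 0 by rewrite /g mulr0 cexp0 mulr1.
by rewrite -g0 -gE /g -mulrA e1 mulr1.
Qed.

End ComplexExponential.

(** * The Poincare density near a linearizable singularity *)

Lemma poincare_density_ge0 (R : realType) (k : nat) (M : complexManifold R k) (Y : set M)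
    (L : lamination Y) (i : fbox L) p : 0 <= poincare_density i p.
Proof.
rewrite /poincare_density; case: xgetP => // d _ /= [A [phi [zeta [_ _ _ _ ->]]]].
by rewrite divr_ge0 // mulr_ge0 // sqr_ge0.
Qed.

Section LinearFlow.
Variables (R : realType) (k : nat) (M : complexManifold R k) (X : singLamination M).

Let Y := supp X `\` sing X.
Let L := lam X.

Variables (a : M) (c : chart R k M) (lambda : 'rV[Cx R]_k) (rho : R).
Hypotheses (Ea : sing X a) (hc : holo_coordinates c) (ca : cdom c a) (c0 : cmap c a = 0).
Hypothesis lam0 : forall j, lambda 0 j != 0.
Hypothesis flowP : forall p, Y p -> cdom c p ->
  exists (S : set (Cx R)) (gamma : Cx R -> M),
    [/\ open S, connected S, S 0, gamma 0 = p &
        leafwise_holo L S gamma /\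
        forall s, S s -> cdom c (gamma s) /\
          is_derive s (1 : Cx R) (cmap c \o gamma)
            (\row_j (lambda 0 j * cmap c (gamma s) 0 j))].
Hypotheses (rho0 : 0 < rho)
  (img : forall v : 'rV[Cx R]_k, \sum_j cabs (v 0 j) ^+ 2 < rho ^+ 2 ->
     (cmap c @` cdom c) v)
  (singa : forall p, sing X p -> chart_ball c a rho p -> p = a).

Definition flow (v : 'rV[Cx R]_k) (s : Cx R) : 'rV[Cx R]_k :=
  \row_j (v 0 j * cexp (lambda 0 j * s)).

Lemma flow0 v : flow v 0 = v.
Proof. by apply/rowP => j; rewrite mxE mulr0 cexp0 mulr1. Qed.

Lemma flowD v s h : flow v (s + h) = flow (flow v s) h.
Proof. by apply/rowP => j; rewrite !mxE mulrDr cexpD mulrA. Qed.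

(** The hypothesis provides integral curves on unspecified domains. Uniqueness for linear equations
    identifies them near 0 with the explicit flow, which thus inherits their leafwise holomorphy
    around each of its points in Y. *)
Lemma flow_local q : Y q -> cdom c q ->
  (\forall h \near (0 : Cx R), Y (cinv c (flow (cmap c q) h))) /\
  forall i : fbox L, fdom i q ->
    (\forall h \near (0 : Cx R), fdom i (cinv c (flow (cmap c q) h)) /\
       (fmap i (cinv c (flow (cmap c q) h))).2 = (fmap i q).2) /\
    exists d, cderiv (fun h => (fmap i (cinv c (flow (cmap c q) h))).1) 0 d.
Proof.
move=> Yq cq; have [S [gam [oS _ S0 g0 [gh gd]]]] := flowP Yq cq.
have [r r0 Hr] := iffLR (nbhs_cabsP _ _) (near_open oS S0).
have inS s : cabs s < r -> S s by move=> sr; apply: Hr; rewrite subr0.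
have gE s : cabs s < r -> gam s = cinv c (flow (cmap c q) s).
  move=> sr; have [cs _] := gd _ (inS _ sr); rewrite -(cmapK cs); congr cinv.
  apply/rowP => j; rewrite mxE -g0.
  apply: (@linear_ode _ (fun s => cmap c (gam s) 0 j) _ r) => // w wr.
  have [_ [wd wE]] := gd _ (inS _ wr).
  by have := derivable_coord j wd; rewrite wE mxE.
have nE : \forall h \near (0 : Cx R), gam h = cinv c (flow (cmap c q) h).
  by apply/nbhs_cabsP; exists r => // h; rewrite subr0; exact: gE.
have nS : \forall h \near (0 : Cx R), S h by exact: (near_open oS S0).
have [_ H0] := gh 0 S0; rewrite g0 in H0.
split.
  by apply: filterS2 nE nS => h <- Sh; have [] := gh h Sh.
move=> i iq; have [H1 H2] := H0 i iq; split.
  by apply: filterS2 nE H1 => h <-.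
eexists; apply: cderiv_near (derivable_cderiv H2).
by apply: filterS nE => h ->.
Qed.

Variables (p : M).
Hypotheses (Yp : Y p) (Dp : chart_ball c a rho p).

Lemma chart_coord_lin q j : chart_coord c a rho q j = cmap c q 0 j * (rho^-1)%:C%C.
Proof. by rewrite /chart_coord c0 mxE subr0. Qed.

Lemma normsq_lin q : normsq (chart_coord c a rho q) =
  (\sum_j cabs (cmap c q 0 j) ^+ 2) / rho ^+ 2.
Proof.
rewrite chart_coord_normsq //; congr (_ / _); apply: eq_bigr => j _.
by rewrite c0 mxE subr0.
Qed.

Lemma coord_neq0 : exists j, cmap c p 0 j != 0.
Proof.
apply: contrapT => H; have cE : cmap c p = cmap c a.
  apply/rowP => j; rewrite c0 mxE; apply/eqP; apply: contrapT => /negP nj.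
  by apply: H; exists j.
have [cp _] := Dp; have pa : p = a by rewrite -(cmapK cp) cE cmapK.
by have [_] := Yp; apply; rewrite pa.
Qed.

Lemma coord_gt0 : 0 < normsq (chart_coord c a rho p).
Proof.
have [j vj] := coord_neq0; apply: (@normsq_gt0 _ _ _ j).
rewrite chart_coord_lin mulf_neq0 // -cabs_gt0 cabsR normr_gt0 invr_eq0.
by rewrite gt_eqF.
Qed.

Variable Lam : R.
Hypotheses (Lam0 : 0 < Lam) (lamL : forall j, cabs (lambda 0 j) <= Lam).

Let N := normsq (chart_coord c a rho p).
(** Along the flow |z|^2 is at most N e^(2 Lam |s|), which is below 1 as long as |s| < [rho1]. *)
Let rho1 := - ln N / (2 * Lam).
Let psi s := cinv c (flow (cmap c p) s).

Lemma flow_radius_gt0 : 0 < rho1.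
Proof.
rewrite divr_gt0 ?mulr_gt0 // oppr_gt0 ln_lt0 //.
by rewrite coord_gt0 /=; case: Dp.
Qed.

Lemma flow_small s : disc 0 rho1 s ->
  \sum_j cabs (flow (cmap c p) s 0 j) ^+ 2 < rho ^+ 2.
Proof.
rewrite /disc /= subr0 => sr; have N0 := coord_gt0; rewrite -/N in N0.
have h : \sum_j cabs (flow (cmap c p) s 0 j) ^+ 2 <=
    (\sum_j cabs (cmap c p 0 j) ^+ 2) * expR (2 * Lam * cabs s).
  rewrite mulr_suml; apply: ler_sum => j _; rewrite mxE cabsM exprMn.
  rewrite ler_wpM2l ?sqr_ge0 // cabs_cexp -expRM_natl ler_expR.
  rewrite -mulrA ler_wpM2l // (le_trans (ler_norm _)) //.
  rewrite (le_trans (Re_le_cabs _)) // cabsM ler_wpM2r ?cabs_ge0 //.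
apply: le_lt_trans h _.
have E : \sum_j cabs (cmap c p 0 j) ^+ 2 = N * rho ^+ 2.
  by rewrite /N normsq_lin divfK // expf_neq0 // gt_eqF.
rewrite E mulrAC gtr_pMl ?exprn_gt0 //.
have sE : expR (2 * Lam * cabs s) < N^-1.
  rewrite -(@lnK _ (N^-1)) ?posrE ?invr_gt0 // ltr_expR lnV ?posrE //.
  by rewrite mulrC -ltr_pdivlMr ?mulr_gt0.
by rewrite -[ltRHS](mulfV (lt0r_neq0 N0)) ltr_pM2l.
Qed.

Lemma flow_chart s : disc 0 rho1 s ->
  [/\ cdom c (psi s), cmap c (psi s) = flow (cmap c p) s & chart_ball c a rho (psi s)].
Proof.
move=> /flow_small sm; have [q cq qE] := img sm.
have pE : psi s = q by rewrite /psi -qE cmapK.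
rewrite pE; split => //; split => //.
by rewrite normsq_lin qE ltr_pdivrMr ?exprn_gt0 // mul1r.
Qed.

Lemma flow_neq_sing s : disc 0 rho1 s -> ~ sing X (psi s).
Proof.
move=> ds; have [cs cE bs] := flow_chart ds => /singa /(_ bs) pa.
have [j vj] := coord_neq0.
have : flow (cmap c p) s 0 j = 0 by rewrite -cE pa c0 mxE.
by rewrite mxE => /eqP; rewrite mulf_eq0 (negPf vj) (negPf (cexp_neq0 _)).
Qed.

Lemma flow_cont s : {for s, continuous (flow (cmap c p))}.
Proof.
move=> A /nbhs_ballP [e /= e0 eA].
have eE : e = (complex.Re e)%:C%C.
  by move: e0; rewrite ltcE; case: e {eA} => x y /= /andP[/eqP -> _].
have e0' : 0 < complex.Re e by move: e0; rewrite ltcE => /andP[].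
have H j : \forall w \near s, cabs (flow (cmap c p) s 0 j - flow (cmap c p) w 0 j) < complex.Re e.
  have hd := cderivZ (cmap c p 0 j) (cderiv_cexpZ (lambda 0 j) s).
  have /(cvg_cabsP (nbhs_filter _)) /(_ _ e0') := cderiv_cont hd.
  by apply: filterS => w; rewrite !mxE cabsC.
have := filter_forall (nbhs_filter s) H; apply: filterS => w Hw.
apply: eA; split => // i j; rewrite ord1 eE /ball /= normcabs ltcR.
exact: Hw.
Qed.

(** Membership in X is locally constant along the disc: it is open by [flow_local], as the flow
    never meets E, and closed because X is compact. *)
Lemma flow_in_supp s : disc 0 rho1 s -> Y (psi s).
Proof.
move=> ds; split; last exact: flow_neq_sing.
apply: (@convex_locconst R (disc 0 rho1) (fun s => supp X (psi s)) _ _ _ 0 s) => //.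
- exact: open_disc.
- exact: disc_convex.
- move=> w dw; have [cw cE _] := flow_chart dw.
  have [sw|nsw] := pselect (supp X (psi w)).
    have Yw : Y (psi w) by split => //; exact: flow_neq_sing.
    have [H _] := flow_local Yw cw; rewrite cE in H.
    have sh : {for w, continuous (fun y : Cx R => y - w)}.
      exact: cderiv_cont (cderivB (cderiv_id w) (cderiv_cst w w)).
    have H' : \forall y \near w, Y (cinv c (flow (flow (cmap c p) w) (y - w))).
      by apply: (sh (fun h => Y (cinv c (flow (flow (cmap c p) w) h)))); rewrite subrr.
    apply: filterS H' => y; rewrite -flowD [w + _]addrC subrK => -[sy _]; split => //.
  have cS : closed (supp X).
    apply: compact_closed; first exact: manifold_hausdorff.
    by case: X.
  have n1 : nbhs (psi w) (~` supp X) by exact: (near_open (closed_openC cS) nsw).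
  have pc : {for w, continuous psi}.
    apply: (@continuous_comp _ _ _ (flow (cmap c p)) (cinv c)); first exact: flow_cont.
    by apply: cinv_cont; rewrite -cE; exists (psi w).
  have n2 : \forall y \near w, (~` supp X) (psi y) by exact: (pc _ n1).
  by apply: filterS n2 => y ny; split.
- exact: disc_center flow_radius_gt0.
- by rewrite /psi flow0 cmapK; [case: Yp|case: Dp].
Qed.

Lemma flow_leafwise : leafwise_holo L (disc 0 rho1) psi.
Proof.
move=> s ds; have Ys := flow_in_supp ds; split => // i is_.
have [cs cE _] := flow_chart ds; have [_ H] := flow_local Ys cs.
rewrite cE in H; have [H1 [d H2]] := H i is_.
have sd : cderiv (fun y : Cx R => y - s) s 1.
  by rewrite -[1]subr0; exact: cderivB (cderiv_id s) (cderiv_cst s s).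
have psE y : psi y = cinv c (flow (flow (cmap c p) s) (y - s)).
  by rewrite -flowD [s + _]addrC subrK.
split.
  have H' : \forall y \near s, fdom i (cinv c (flow (flow (cmap c p) s) (y - s))) /\
      (fmap i (cinv c (flow (flow (cmap c p) s) (y - s)))).2 = (fmap i (psi s)).2.
    have shc : {for s, continuous (fun y : Cx R => y - s)} := cderiv_cont sd.
    apply: (shc (fun h => fdom i (cinv c (flow (flow (cmap c p) s) h)) /\
      (fmap i (cinv c (flow (flow (cmap c p) s) h))).2 = (fmap i (psi s)).2)).
    by rewrite subrr.
  by apply: filterS H' => y; rewrite -psE.
have H2' : cderiv (fun h => (fmap i (cinv c (flow (flow (cmap c p) s) h))).1) (s - s) d.
  by rewrite subrr.
have := cderiv_comp sd H2'; rewrite mulr1 => H3.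
apply: (@cderiv_derivable _ _ _ d); apply: cderiv_near H3.
by apply: (@filterE _ (nbhs s)) => y /=; rewrite -psE.
Qed.

Variable m : R.
Hypotheses (m0 : 0 < m) (lamm : forall j, m <= cabs (lambda 0 j) ^+ 2).

(** With g the velocity of the flow in the plaque coordinate, the chain rule reads dz_j * g =
    lambda_j z_j, hence m N <= kahler * |g|^2. This eliminates |g|^2 from the bound 2 (32 / rho1)^2
    on density * |g|^2, and 32 / rho1 = 64 Lam / (- ln N). *)
Lemma poincare_density_linear (i : fbox L) : fdom i p ->
  poincare_density i p <=
    2 * (64 * Lam) ^+ 2 / m * (kahler (chart_coord c a rho) i p / (N * ln N ^+ 2)).
Proof.
move=> ip; have N0 : 0 < N := coord_gt0.
have r1 := flow_radius_gt0.
have p0 : psi 0 = p by rewrite /psi flow0 cmapK //; case: Dp.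
have i0 : fdom i (psi 0) by rewrite p0.
have B := poincare_density_bound r1 flow_leafwise i0; rewrite p0 in B.
have d0 : disc 0 rho1 (0 : Cx R) by exact: disc_center.
set g := derive1 _ _ in B.
have gd : cderiv (fun s => (fmap i (psi s)).1) 0 g.
  by have [_ H] := flow_leafwise d0; have [_ H2] := H i i0; exact: derivable_cderiv H2.
have cp : cdom c p by case: Dp.
have dE j : dcoord (chart_coord c a rho) i p j * g = lambda 0 j * chart_coord c a rho p j.
  have [e He] := leaf_chart_derivable j hc ip cp.
  have zd : cderiv (fun x => chart_coord c a rho (finv (x, (fmap i p).2)) j) (fmap i p).1
      (dcoord (chart_coord c a rho) i p j).
    rewrite /dcoord; have := cderivM (cderivB He (cderiv_cst (cmap c a 0 j) _))
      (cderiv_cst (rho^-1)%:C%C _) => H.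
    by rewrite (cderiv_derive1 H).
  have zd' : cderiv (fun x => chart_coord c a rho (finv (x, (fmap i p).2)) j)
      (fmap i (psi 0)).1 (dcoord (chart_coord c a rho) i p j) by rewrite p0.
  have zg := cderiv_comp gd zd'.
  have [_ H] := flow_leafwise d0; have [H1 _] := H i i0; rewrite p0 in H1.
  have n1 := near_open (@open_disc R 0 rho1) d0.
  have fl : cderiv (fun s => chart_coord c a rho p j * cexp (lambda 0 j * s)) 0
      (chart_coord c a rho p j * (lambda 0 j * 1)).
    have := cderivZ (chart_coord c a rho p j) (cderiv_cexpZ (lambda 0 j) 0).
    by rewrite mulr0 cexp0.
  rewrite (cderiv_unique zg (_ : cderiv _ 0 (lambda 0 j * chart_coord c a rho p j))) //.
  rewrite mulrC; rewrite mulr1 in fl; apply: cderiv_near fl.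
  apply: filterS2 n1 H1 => s ds [is_ ts] /=.
  have [_ sK] := fmapK is_.
  rewrite -ts -surjective_pairing sK !chart_coord_lin.
  by have [_ -> _] := flow_chart ds; rewrite mxE mulrAC.
have kE : m * N <= kahler (chart_coord c a rho) i p * cabs g ^+ 2.
  rewrite /N /kahler /normsq mulr_sumr mulr_suml; apply: ler_sum => j _.
  rewrite -exprMn -cabsM dE cabsM exprMn ler_wpM2r ?sqr_ge0 //.
have P0 := poincare_density_ge0 i p.
have K0 : 0 <= kahler (chart_coord c a rho) i p by exact: normsq_ge0.
have ln0 : ln N != 0.
  by rewrite lt_eqF // ln_lt0 // N0 /=; case: Dp.
have h : poincare_density i p * (m * N) <=
    kahler (chart_coord c a rho) i p * (2 * (32 / rho1) ^+ 2).
  apply: le_trans (ler_wpM2l P0 kE) _.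
  by rewrite mulrCA ler_wpM2l.
have mN : 0 < m * N by rewrite mulr_gt0.
move: h; rewrite -ler_pdivlMr // => /le_trans; apply.
rewrite le_eqVlt; apply/orP; left; apply/eqP; rewrite /rho1; field.
by rewrite ln0 !gt_eqF.
Qed.

End LinearFlow.

(** * Measurability and iterated integrals *)

Lemma countable_bigcup_measurable d (T : measurableType d) (I : countType) (P : set I)
    (F : I -> set T) : (forall i, P i -> measurable (F i)) ->
  measurable (\bigcup_(i in P) F i).
Proof.
move=> mF; rewrite bigcup_mkcond.
apply: countable_bigcupT_measurable => [|i]; first exact: countableP.
by case: ifP => //; rewrite inE; exact: mF.
Qed.

Lemma countable_bigcap_measurable d (T : measurableType d) (I : countType) (P : set I)
    (F : I -> set T) : (forall i, P i -> measurable (F i)) ->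
  measurable (\bigcap_(i in P) F i).
Proof.
move=> mF; rewrite -[X in measurable X]setCK setC_bigcap; apply: measurableC.
by apply: countable_bigcup_measurable => i /mF; exact: measurableC.
Qed.

Section PlaneMeasure.
Variable R : realType.

HB.instance Definition _ := Measure.on (@leb2 R).

Lemma leb2_sigma_finite : sigma_finite setT (@leb2 R).
Proof.
have /sigma_finiteP[F [TF ndF Foo]] := sigma_finiteT (@lebesgue_measure R).
exists (fun n => F n `*` F n).
  rewrite -setXTT TF predeqE => -[x y]; split; last by move=> [n _ [/= ? ?]]; split; exists n.
  move=> [/= [n _ Fnx] [m _ Fmy]]; exists (maxn n m) => //; split.
    by move: x Fnx; exact/subsetPset/ndF/leq_maxl.
  by move: y Fmy; exact/subsetPset/ndF/leq_maxr.
move=> n; have [h1 h2] := Foo n; split; first exact: measurableX.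
by rewrite /leb2 product_measure1E// lte_mul_pinfty// ge0_fin_numE.
Qed.

HB.instance Definition _ := Measure_isSigmaFinite.Build _ _ _ (@leb2 R) leb2_sigma_finite.

Let plane := (measurableTypeR R * measurableTypeR R)%type.

Definition rat_rect (q : rat * rat * (rat * rat)) : set (R * R) :=
  [set` `]ratr q.1.1, ratr q.1.2[ ] `*` [set` `]ratr q.2.1, ratr q.2.2[ ].

Lemma measurable_rat_rect q : measurable (rat_rect q : set plane).
Proof. by apply: measurableX; exact: measurable_itv. Qed.

Lemma rat_rect_nbhs (u : R * R) (A : set (R * R)) : nbhs u A ->
  exists q, rat_rect q u /\ rat_rect q `<=` A.
Proof.
move=> [[A1 A2] /= [/nbhs_ballP [e1 /= e10 E1] /nbhs_ballP [e2 /= e20 E2]] AA].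
have itv (x e : R) : 0 < e -> exists q : rat * rat,
    [set` `]ratr q.1, ratr q.2[ ] x /\ [set` `]ratr q.1, ratr q.2[ ] `<=` ball x e.
  move=> e0; have /rat_in_itvoo [q1] : x - e < x by rewrite ltrBlDr ltrDl.
  rewrite in_itv /= => /andP[h1 h2].
  have /rat_in_itvoo [q2] : x < x + e by rewrite ltrDl.
  rewrite in_itv /= => /andP[h3 h4]; exists (q1, q2); split => /= [|y /=].
    by rewrite in_itv /= h2.
  rewrite in_itv /= => /andP[g1 g2]; rewrite /ball /= ltr_distlC.
  by rewrite (lt_trans h1) // (lt_trans g2).
have [q1 [q1u q1A]] := itv u.1 e1 e10; have [q2 [q2u q2A]] := itv u.2 e2 e20.
exists (q1, q2); split; first by split.
by move=> v [v1 v2]; apply: AA; split; [exact/E1/q1A|exact/E2/q2A].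
Qed.

Lemma rat_rect_open q : open (rat_rect q).
Proof.
rewrite openE => u [u1 u2].
exists ([set` `]ratr q.1.1, ratr q.1.2[ ], [set` `]ratr q.2.1, ratr q.2.2[ ]) => //=.
by split; [exact: (near_open (interval_open _ _) u1)|exact: (near_open (interval_open _ _) u2)].
Qed.

(** The plane has a countable base of rectangles but T need not have one; so with each rational
    rectangle goes the largest open set of T whose product with it lies in A. *)
Lemma measurable_openX (T : ptopologicalType) (A : set ((R * R) * T)) : open A ->
  measurable ([set q | A (q.2, q.1)] : set (borel T * plane)).
Proof.
move=> oA; pose W q := interior [set t : T | forall u, rat_rect q u -> A (u, t)].
rewrite (_ : [set _ | _] = \bigcup_q (W q `*` rat_rect q)).
  apply: countable_bigcup_measurable => q _; apply: measurableX; last exact: measurable_rat_rect.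
  by apply: sub_sigma_algebra; exact: open_interior.
apply/seteqP; split => [[t u] /= Aut|[t u] [q _ [Wt qu]]]; last first.
  exact: (interior_subset Wt).
have [[U V] /= [Uu Vt] UV] := near_open oA Aut.
have [q [qu qU]] := rat_rect_nbhs Uu; exists q => //; split => //.
by apply: filterS Vt => t' Vt' u' qu'; apply: UV; split => //; exact: qU.
Qed.

Lemma measurable_open2 (A : set (R * R)) : open A -> measurable (A : set plane).
Proof.
move=> oA; rewrite (_ : A = \bigcup_(q in [set q | rat_rect q `<=` A]) rat_rect q).
  apply: countable_bigcup_measurable => // q _; exact: measurable_rat_rect.
apply/seteqP; split => [u Au|u [q qA /qA]] //.
by have [q [qu qA]] := rat_rect_nbhs (near_open oA Au); exists q.
Qed.

Lemma measurable_fun_openX (T : ptopologicalType) (A : set ((R * R) * T))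
    (f : (R * R) * T -> R) : open A -> (forall q, A q -> {for q, continuous f}) ->
  measurable_fun ([set q | A (q.2, q.1)] : set (borel T * plane)) (fun q => f (q.2, q.1)).
Proof.
move=> oA fc; apply: (measurability _ (RGenOInfty.measurableE R)) => _ [_ [a ->] <-].
rewrite (_ : _ `&` _ = [set q | [set q | A q /\ a < f q] (q.2, q.1)]).
  apply: measurable_openX; rewrite openE => q [Aq fq].
  have n1 := near_open oA Aq; have fc' := fc q Aq.
  have n2 : \forall p \near q, a < f p by exact: (fc' _ (lt_nbhsr fq)).
  by apply: filterS2 n1 n2.
by apply/seteqP; split => q /=; rewrite in_itv /= andbT.
Qed.

(* A Caratheodory function: the values on rational points near u determine
   whether h t u > a. *)
Lemma measurable_fun_Caratheodory d (T : measurableType d) (N : set T) (B : set (R * R))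
    (h : T -> R * R -> R) : measurable N -> open B ->
  (forall u, B u -> measurable_fun setT (h ^~ u)) ->
  (forall t u, ~ N t -> B u -> {for u, continuous (h t)}) ->
  measurable_fun ((~` N) `*` B : set (T * plane)) (fun q => h q.1 q.2).
Proof.
move=> mN oB mh ch; apply: (measurability _ (RGenOInfty.measurableE R)) => _ [_ [a ->] <-].
pose pt (r : rat * rat) : R * R := (ratr r.1, ratr r.2).
pose W (q : rat * rat * (rat * rat)) (b : rat) : set T := ~` N `&`
  \bigcap_(r in [set r | rat_rect q (pt r) /\ B (pt r)]) [set t | ratr b <= h t (pt r)].
rewrite (_ : _ `&` _ = \bigcup_(qb in
    [set qb : _ * rat | a < ratr qb.2 /\ rat_rect qb.1 `<=` B])
    (W qb.1 qb.2 `*` rat_rect qb.1)).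
  apply: countable_bigcup_measurable => // -[q b] _; apply: measurableX; last first.
    exact: measurable_rat_rect.
  apply: measurableI; first exact: measurableC.
  apply: countable_bigcap_measurable => // r [_ Br].
  rewrite -[X in measurable X]setTI; have := mh _ Br measurableT [set` `[ratr b, +oo[ ].
  rewrite (_ : _ @^-1` _ = [set t | ratr b <= h t (pt r)]); first by apply; exact: measurable_itv.
  by apply/seteqP; split => t /=; rewrite in_itv /= andbT.
apply/seteqP; split => [[t u] [[/= Nt Bu]]|[t u] [[q b] [/= ab qB] [[Nt Wt] qu]]].
  rewrite /= in_itv /= andbT => hu; have [b] := rat_in_itvoo hu.
  rewrite in_itv /= => /andP[ab bh].
  have hc := ch t u Nt Bu.
  have n1 : \forall v \near u, ratr b < h t v by exact: (hc _ (lt_nbhsr bh)).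
  have [q [qu qA]] := rat_rect_nbhs (filterI n1 (near_open oB Bu)).
  exists (q, b); first by split => // v /qA [].
  split => //; split => // r [qr Br] /=.
  by apply/ltW; have [] := qA _ qr.
split; first by split => //=; exact: qB.
rewrite /= in_itv /= andbT; apply: lt_le_trans ab _; rewrite leNgt; apply/negP => hb.
have hc := ch t u Nt (qB _ qu).
have n1 : \forall v \near u, h t v < ratr b by exact: (hc _ (lt_nbhsl hb)).
have [[[x1 x2] [y1 y2]] [q'u q'A]] := rat_rect_nbhs (filterI n1 (near_open (@rat_rect_open q) qu)).
move: (q'u) => -[/=]; rewrite !in_itv /= => /andP[g1 g2] /andP[g3 g4].
have [r1 hr1] := rat_in_itvoo (lt_trans g1 g2).
have [r2 hr2] := rat_in_itvoo (lt_trans g3 g4).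
have [k1 k2] : _ := q'A (pt (r1, r2)) (conj hr1 hr2).
have := Wt (r1, r2) (conj k2 (qB _ k2)); rewrite /= leNgt => /negP; exact.
Qed.

End PlaneMeasure.

Section IntegralComparison.
Local Open Scope ereal_scope.
Context d (T : measurableType d) (R : realType) (mu : {measure set T -> \bar R}).
Import HBNNSimple.

(** Monotonicity read off the supremum over simple functions, for arbitrary nonnegative functions:
    the Poincare density, given by a choice of coverings, is compared with its majorant in this
    way. *)
Lemma le_integral_ge0 (D : set T) (f g : T -> \bar R) :
  (forall x, D x -> 0 <= f x) -> (forall x, D x -> f x <= g x) ->
  \int[mu]_(x in D) f x <= \int[mu]_(x in D) g x.
Proof.
move=> f0 fg; have g0 x : D x -> 0 <= g x by move=> Dx; exact: le_trans (f0 _ Dx) (fg _ Dx).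
rewrite !ge0_integralE //; apply: ereal_sup_le => _ [h /= hf <-]; exists h => //= x; apply: le_trans (hf x) _; rewrite /patch; case: ifP => //.
by rewrite inE => /fg.
Qed.

(* No measurability of f: its integral is a supremum over simple functions. *)
Lemma le_integral_ae (D N : set T) (f g : T -> \bar R) : measurable D ->
  measurable N -> mu N = 0 -> measurable_fun D g ->
  (forall x, D x -> ~ N x -> 0 <= g x /\ f x <= g x) ->
  \int[mu]_(x in D) f x <= \int[mu]_(x in D) g x.
Proof.
(* Raising the majorant to +oo on the null set makes it dominate f on all of D. *)
move=> mD mN N0 mg fg; pose g' x := if `[< N x >] then +oo else g x.
have -> : \int[mu]_(x in D) g x = \int[mu]_(x in D) g' x.
  apply: ae_eq_integral => //.
    have mb : measurable_fun D (fun x => `[< N x >]).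
      apply: (measurable_fun_bool true); rewrite (_ : _ @^-1` _ = N); first exact: measurableI.
      by apply/seteqP; split => x /=; [move/asboolP|move=> ?; apply/asboolP].
    apply: (measurable_fun_if mD mb) => [|]; first by apply: measurable_cst.
    by apply: measurable_funS mg => //; exact: subIsetl.
  exists N; split => // x nx; apply: contrapT => nN; apply: nx => /= _.
  by rewrite /g' asboolF.
rewrite integralE; apply: (@le_trans _ _ (\int[mu]_(x in D) f^\+ x)).
  rewrite -[leRHS]sube0; apply: leeB => //; exact: integral_ge0.
apply: le_integral_ge0 => // x Dx; rewrite /g' funeposE; case: asboolP => [_|nN].
  by rewrite leey.
by have [h1 h2] := fg _ Dx nN; rewrite ge_max h2.
Qed.

End IntegralComparison.

(** * Measures given by a density integrated plaque by plaque *)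

Section IteratedDensity.
Local Open Scope ereal_scope.
Context d1 d2 (T1 : measurableType d1) (T2 : measurableType d2) (R : realType).
Variables (m1 : {measure set T1 -> \bar R}) (m2 : {sigma_finite_measure set T2 -> \bar R}).
Variable F : T1 * T2 -> \bar R.
Hypotheses (mF : measurable_fun setT F) (F0 : forall q, 0 <= F q).

Definition iterated_slice (A : set (T1 * T2)) (t : T1) :=
  \int[m2]_(u in xsection A t) F (t, u).

(** Only m2 is sigma-finite, so the density is integrated in the fixed order, m2 and then m1,
    instead of against a product measure. The hypotheses on F are arguments so that the measure
    structure can be attached to the term. *)
Definition iterated_density_def of measurable_fun setT F & (forall q, 0 <= F q) :=
  fun A : set (T1 * T2) => \int[m1]_t iterated_slice A t.
Local Notation nu := (iterated_density_def mF F0).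

Lemma measurable_iterated_slice A : measurable A -> measurable_fun setT (iterated_slice A).
Proof.
move=> mA; rewrite (_ : iterated_slice A = fubini_F m2 (F \_ A)).
  have mFA : measurable_fun setT (F \_ A).
    by apply: (measurable_restrictT _ mA).1; exact: measurable_funTS.
  apply: (measurable_fun_fubini_tonelli_F _ mFA).
  by move=> q; rewrite /patch; case: ifP.
apply/funext => t; rewrite /iterated_slice integral_mkcond; apply: eq_integral => u _.
by rewrite /patch mem_xsection.
Qed.

Lemma iterated_slice_ge0 A t : 0 <= iterated_slice A t.
Proof. exact: integral_ge0. Qed.

Let nu0 : nu set0 = 0.
Proof. by apply: integral0_eq => t _; rewrite /iterated_slice xsection0 integral_set0. Qed.

Let nu_ge0 A : 0 <= nu A.
Proof. by apply: integral_ge0 => t _; exact: iterated_slice_ge0. Qed.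

Let nu_sigma_additive : semi_sigma_additive nu.
Proof.
move=> A mA tA mUA.
rewrite [X in _ --> X](_ : _ = \sum_(n <oo) nu (A n)).
  by apply/cvg_closeP; split; [exact: is_cvg_nneseries|rewrite closeE].
rewrite -integral_nneseries //; first last.
- by move=> n t _; exact: iterated_slice_ge0.
- by move=> n; exact: measurable_iterated_slice.
apply: eq_integral => t _; rewrite /iterated_slice xsection_bigcup ge0_integral_bigcup //.
- by move=> n; exact: measurable_xsection.
- apply: measurable_funTS; exact: (measurableT_comp mF (measurable_pair1 t)).
- exact: trivIset_xsection.
Qed.

HB.instance Definition _ := isMeasure.Build _ _ _ nu nu0 nu_ge0 nu_sigma_additive.

Definition iterated_density : {measure set (T1 * T2) -> \bar R} := nu.

Lemma iterated_densityE A : iterated_density A =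
  \int[m1]_t \int[m2]_(u in xsection A t) F (t, u).
Proof. by []. Qed.

End IteratedDensity.

(** * Inner regularity *)

Lemma preimage_diff (T U : Type) (f : T -> U) (A B : set U) :
  f @^-1` (A `\` B) = f @^-1` A `\` f @^-1` B.
Proof. by []. Qed.

Section InnerRegularity.
Local Open Scope ereal_scope.
Context d (T : measurableType d) (R : realType) (nu : {measure set T -> \bar R}).
Variables (M : topologicalType) (phi : T -> M).
Hypothesis nu_fin : nu setT < +oo.

Let nu_lty A : measurable A -> nu A < +oo.
Proof. by move=> mA; apply: le_lt_trans nu_fin; apply: le_measure; rewrite ?inE. Qed.

(** Continuity from above of a finite measure, along tails that decrease to the empty set. *)
Lemma tail_small (C : (set M)^nat) (e : R) : (forall n, measurable (phi @^-1` C n)) ->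
  (0 < e)%R ->
  exists N, nu (phi @^-1` (\bigcup_n C n `\` \bigcup_(n in [set n | (n < N)%N]) C n)) <= e%:E.
Proof.
move=> mC e0; pose F N := phi @^-1` (\bigcup_n C n `\` \bigcup_(n in [set n | (n < N)%N]) C n).
have mF N : measurable (F N).
  rewrite /F preimage_diff !preimage_bigcup; apply: measurableD; first exact: bigcupT_measurable.
  exact: bigcup_measurable.
have F0 : \bigcap_n F n = set0.
  apply/seteqP; split => // t Ft; have [[m _ Cm] _] := Ft 0%N Logic.I.
  by have [_] := Ft m.+1 Logic.I; apply; exists m => //=.
have := @nonincreasing_cvg_mu _ _ _ nu F (nu_lty (mF _)) mF.
rewrite F0 measure0 => /(_ measurable0) H.
have {H} : nu (F n) @[n --> \oo] --> 0.
  apply: H => n m nm; apply/subsetPset => t [Ct nC]; split => // -[i /= il Ci].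
  by apply: nC; exists i => //=; exact: leq_trans il nm.
move=> /(_ [set x | x <= e%:E]) H.
have n0 : \forall y \near (0%R : R), y%:E <= e%:E.
  by apply: filterS (lt_nbhsl e0) => y ye; rewrite lee_fin ltW.
by have [N _ HN] := H n0; exists N; exact: (HN N (leqnn N)).
Qed.

(** The measure lives on the parameter space of a flow box, and subsets of M are measured through
    their preimages by phi. *)
Definition closed_approx (S : set M) := forall e : R, (0 < e)%R ->
  exists C, [/\ closed C, C `<=` S & nu (phi @^-1` (S `\` C)) <= e%:E].

Hypothesis mphi : forall U : set M, open U -> measurable (phi @^-1` U).

Let mclosed C : closed C -> measurable (phi @^-1` C).
Proof.
move=> cC; have mU := measurableC (mphi (closed_openC cC)).
by rewrite -(setCK (phi @^-1` C)).
Qed.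

Lemma closed_finite_bigcup (C : (set M)^nat) N : (forall n, closed (C n)) ->
  closed (\bigcup_(n in [set n | (n < N)%N]) C n).
Proof.
move=> cC; elim: N => [|N IH]; first by rewrite bigcup0; [exact: closed0|].
rewrite (_ : \bigcup_(_ in _) _ = (\bigcup_(n in [set n | (n < N)%N]) C n) `|` C N); first exact: closedU.
apply/seteqP; split => [p [n /= nN Cn]|p [[n /= nN Cn]|CN]]; last by exists N => /=.
  by move: nN; rewrite ltnS leq_eqVlt => /orP[/eqP <-|nN]; [right|left; exists n].
by exists n => //=; exact: ltnW.
Qed.

Lemma Fsigma_approx (C : (set M)^nat) : (forall n, closed (C n)) ->
  closed_approx (\bigcup_n C n).
Proof.
move=> cC e e0; have [N HN] := tail_small (fun n => mclosed (cC n)) e0.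
exists (\bigcup_(n in [set n | (n < N)%N]) C n); split => //.
  exact: closed_finite_bigcup.
by move=> p [n _ Cn]; exists n.
Qed.

Lemma bigcup_small (A : (set M)^nat) (e : R) : (0 < e)%R ->
  (forall n, measurable (phi @^-1` A n)) ->
  (forall n, nu (phi @^-1` A n) <= (e / (2 ^ n.+1)%:R)%:E) ->
  nu (phi @^-1` \bigcup_n A n) <= e%:E.
Proof.
move=> e0 mA Ae; rewrite preimage_bigcup.
apply: (@le_trans _ _ (\sum_(n <oo) nu (phi @^-1` A n))).
  by apply: measure_sigma_subadditive => //; exact: bigcupT_measurable.
apply: le_trans (epsilon_trick0 xpredT (ltW e0)).
by apply: lee_nneseries => n _.
Qed.

(** Half of e pays for the approximation of the pieces, the other half for the truncation of the
    union of the C n, which need not be closed. *)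
Lemma bigcup_approx (A : (set M)^nat) : (forall n, measurable (phi @^-1` A n)) ->
  (forall n, closed_approx (A n)) -> closed_approx (\bigcup_n A n).
Proof.
move=> mA aA e e0; have e2 : (0 < e / 2)%R by rewrite divr_gt0.
have pe n : (0 < e / 2 / (2 ^ n.+1)%:R)%R by rewrite divr_gt0 // ltr0n expn_gt0.
have [C HC] := choice (fun n => aA n _ (pe n)).
have cC n : closed (C n) by have [] := HC n.
have [N HN] := tail_small (fun n => mclosed (cC n)) e2.
exists (\bigcup_(n in [set n | (n < N)%N]) C n); split.
- exact: closed_finite_bigcup.
- by move=> p [n _ Cn]; exists n => //; have [_ + _] := HC n; exact.
have mD n : measurable (phi @^-1` (A n `\` C n)).
  by rewrite preimage_diff; apply: measurableD => //; exact: mclosed.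
have mCN : measurable (phi @^-1` (\bigcup_n C n `\` \bigcup_(n in [set n | (n < N)%N]) C n)).
  rewrite preimage_diff; apply: measurableD; last by apply: mclosed; exact: closed_finite_bigcup.
  by rewrite preimage_bigcup; apply: bigcupT_measurable => n; exact: mclosed.
rewrite [e in e%:E](splitr e) EFinD.
apply: (@le_trans _ _ (nu (phi @^-1` (\bigcup_n (A n `\` C n)) `|`
    phi @^-1` (\bigcup_n C n `\` \bigcup_(n in [set n | (n < N)%N]) C n)))).
  have mU : measurable (phi @^-1` (\bigcup_n (A n `\` C n))).
    by rewrite preimage_bigcup; exact: bigcupT_measurable.
  apply: le_measure; rewrite ?inE; last 1 first.
  - move=> t [[n _ An] nC]; have [Cn|Cn] := pselect (C n (phi t)).
      by right; split => //; exists n.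
    by left; exists n.
  - rewrite preimage_diff; apply: measurableD; last by apply: mclosed; exact: closed_finite_bigcup.
    by rewrite preimage_bigcup; exact: bigcupT_measurable.
  - exact: measurableU.
have mU : measurable (phi @^-1` (\bigcup_n (A n `\` C n))).
  by rewrite preimage_bigcup; exact: bigcupT_measurable.
apply: le_trans (measureU2 _ mU mCN) _; apply: leeD => //.
by apply: bigcup_small => // n; have [] := HC n.
Qed.

Lemma bigcap_approx (A : (set M)^nat) : (forall n, measurable (phi @^-1` A n)) ->
  (forall n, closed_approx (A n)) -> closed_approx (\bigcap_n A n).
Proof.
move=> mA aA e e0.
have pe n : (0 < e / (2 ^ n.+1)%:R)%R by rewrite divr_gt0 // ltr0n expn_gt0.
have [C HC] := choice (fun n => aA n _ (pe n)).
have cC n : closed (C n) by have [] := HC n.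
have mD n : measurable (phi @^-1` (A n `\` C n)).
  by rewrite preimage_diff; apply: measurableD => //; exact: mclosed.
exists (\bigcap_n C n); split.
- by apply: closed_bigI => n _.
- by move=> p Cp n _; have [_ + _] := HC n; apply; exact: Cp.
apply: (@le_trans _ _ (nu (phi @^-1` \bigcup_n (A n `\` C n)))); last first.
  by apply: bigcup_small => // n; have [] := HC n.
apply: le_measure; rewrite ?inE.
- rewrite preimage_diff preimage_bigcap; apply: measurableD.
    exact: bigcapT_measurable.
  by rewrite preimage_bigcap; apply: bigcapT_measurable => n; exact: mclosed.
- by rewrite preimage_bigcup; exact: bigcupT_measurable.
move=> t [At nC]; apply: contrapT => nU; apply: nC => n _; apply: contrapT => nC.
by apply: nU; exists n => //; split => //; exact: At.
Qed.

Hypothesis Fsig : forall U : set M, open U ->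
  exists2 C : (set M)^nat, (forall n, closed (C n)) & U = \bigcup_n C n.

(** The class [G] asks for the approximation of both S and its complement, which makes it stable
    under complements; it contains the open sets because they are countable unions of closed
    ones. *)
Lemma borel_approx (S : set M) : <<s @open M >> S ->
  measurable (phi @^-1` S) /\ closed_approx S.
Proof.
pose G S := [/\ measurable (phi @^-1` S), closed_approx S & closed_approx (~` S)].
suff H : <<s @open M >> `<=` G by move=> /H [].
apply: smallest_sub; first split.
- split; first by rewrite preimage_set0.
    move=> e e0; exists set0; rewrite setDv preimage_set0 measure0 lee_fin ltW //.
    by split; [exact: closed0|exact: subset_refl|].
  move=> e e0; exists setT; rewrite setC0 setDv preimage_set0 measure0 lee_fin ltW //.
- move=> A [mA aA aCA]; rewrite setTD; split => //; last by rewrite setCK.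
  exact: (measurableC mA).
- move=> A GA; split.
  + by rewrite preimage_bigcup; apply: bigcupT_measurable => n; have [] := GA n.
  + by apply: bigcup_approx => n; have [] := GA n.
  + rewrite setC_bigcup; apply: bigcap_approx => n; have [mA _ aC] := GA n => //.
    exact: (measurableC mA).
move=> U oU; split; first exact: mphi.
  by have [C cC ->] := Fsig oU; exact: Fsigma_approx.
move=> e e0; exists (~` U); rewrite setDv preimage_set0 measure0 lee_fin ltW //; split => //.
by rewrite closedC.
Qed.

Lemma compact_finite_bigcup (K : (set M)^nat) N : (forall n, compact (K n)) ->
  compact (\bigcup_(n in [set n | (n < N)%N]) K n).
Proof.
move=> cC; elim: N => [|N IH]; first by rewrite bigcup0; [exact: compact0|].
rewrite (_ : \bigcup_(_ in _) _ = (\bigcup_(n in [set n | (n < N)%N]) K n) `|` K N); first exact: compactU.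
apply/seteqP; split => [p [n /= nN Cn]|p [[n /= nN Cn]|CN]]; last by exists N => /=.
  by move: nN; rewrite ltnS leq_eqVlt => /orP[/eqP <-|nN]; [right|left; exists n].
by exists n => //=; exact: ltnW.
Qed.

Lemma compact_inner_regular (K : (set M)^nat) (S : set M) (e : R) : hausdorff_space M ->
  (forall n, compact (K n)) -> <<s @open M >> S -> S `<=` \bigcup_n K n -> (0 < e)%R ->
  exists C, [/\ compact C, C `<=` S & nu (phi @^-1` S) <= nu (phi @^-1` C) + e%:E].
Proof.
move=> hM cK bS SK e0; have e2 : (0 < e / 2)%R by rewrite divr_gt0.
have [mS aS] := borel_approx bS.
have [C [cC CS HC]] := aS _ e2.
have clK n : closed (K n) by apply: compact_closed.
have [N HN] := tail_small (fun n => mclosed (clK n)) e2.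
pose KN := \bigcup_(n in [set n | (n < N)%N]) K n.
have cKN : compact KN by exact: compact_finite_bigcup.
exists (KN `&` C); split.
- exact: compact_closedI.
- by apply: subset_trans CS; exact: subIsetr.
have mKN : measurable (phi @^-1` KN) by apply: mclosed; apply: compact_closed.
have mC : measurable (phi @^-1` C) by exact: mclosed.
have mK : measurable (phi @^-1` \bigcup_n K n).
  by rewrite preimage_bigcup; apply: bigcupT_measurable => n; exact: mclosed.
have m1 : measurable (phi @^-1` (KN `&` C)) by rewrite preimage_setI; exact: measurableI.
have m2 : measurable (phi @^-1` (S `\` C)) by rewrite preimage_diff; exact: measurableD.
have m3 : measurable (phi @^-1` (\bigcup_n K n `\` KN)) by rewrite preimage_diff; exact: measurableD.
rewrite [e in e%:E](splitr e) EFinD.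
apply: le_trans (leeD2l _ (leeD HC HN)).
apply: le_trans (leeD2l _ (measureU2 nu m2 m3)).
apply: le_trans (measureU2 nu m1 (measurableU _ _ m2 m3)).
apply: le_measure; rewrite ?inE //; first by apply: measurableU => //; exact: measurableU.
move=> t St; have [Ct|nC] := pselect (C (phi t)); last by right; left.
have [Kt|nK] := pselect (KN (phi t)); first by left.
by right; right; split => //; exact: SK.
Qed.

End InnerRegularity.

(** * Compact neighbourhoods, and open sets of the manifold as countable unions of closed sets *)

Section SigmaCompact.
Variables (R : realType) (k : nat) (M : complexManifold R k) (Y : set M).
Variable L : lamination Y.

Lemma atlas_holo (c : chart R k M) : catlas c -> holo_coordinates c.
Proof. by move=> cc d dd; split; exact: atlas_transition. Qed.

Lemma chart_coord0 (c : chart R k M) q rho : normsq (chart_coord c q rho q) = 0.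
Proof.
rewrite /normsq big1 // => j _; rewrite /chart_coord subrr mul0r cabs0; exact: expr0n.
Qed.

Lemma compact_nbhs (p : M) (U : set M) : open U -> U p ->
  exists K, [/\ compact K, K `<=` U & nbhs p K].
Proof.
move=> oU Up; have [c cc cp] := manifold_chart p.
have [rho rho0 H] := chart_ballP L (atlas_holo cc) cp oU Up.
have [[oD zc n1 cK _] DU Dp _] := H rho rho0 (lexx _).
exists [set p' | chart_ball c p rho p' /\ normsq (chart_coord c p rho p') <= 2^-1]; split.
- by apply: cK; rewrite invf_lt1 // ltr1n.
- by move=> p' [Dp' _]; exact: DU.
have nc : {for p, continuous (fun p' => normsq (chart_coord c p rho p'))}.
  apply: (@continuous_sum _ _ _ (fun j p' => cabs (chart_coord c p rho p' j) ^+ 2)) => j.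
  by apply: continuous_cabs2; exact: zc.
have n2 : \forall p' \near p, normsq (chart_coord c p rho p') < 2^-1.
  by apply: (nc _ (lt_nbhsl _)); rewrite chart_coord0 invr_gt0.
by apply: filterS2 (near_open oD Dp) n2 => p' h1 /ltW h2.
Qed.

(** U is the union of the closures, contained in U, of members of a countable base; compact
    neighbourhoods show that there are enough of them. The n-th closed set is the closure of the
    member of index n under an injection into the integers, or empty. *)
Lemma manifold_Fsigma (U : set M) : open U ->
  exists2 C : (set M)^nat, (forall n, closed (C n)) & U = \bigcup_n C n.
Proof.
move=> oU; have [B cB [Bo Bn]] := @manifold_second_countable _ _ M.
have /countable_injP [f fi] := cB.
pose P n b := [/\ B b, f b = n & closure b `<=` U].
exists (fun n => \bigcup_(b in P n) closure b).
  move=> n; have [[b Pb]|nP] := pselect (exists b, P n b).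
    rewrite (_ : \bigcup_(_ in _) _ = closure b); first exact: closed_closure.
    apply/seteqP; split => [p [b' Pb' b'p]|p bp]; last by exists b.
    suff -> : b = b' by [].
    have [Bb fb _] := Pb; have [Bb' fb' _] := Pb'.
    by apply: fi; rewrite ?inE // fb fb'.
  rewrite (_ : \bigcup_(_ in _) _ = set0); first exact: closed0.
  by apply/seteqP; split => // p [b Pb _]; apply: nP; exists b.
apply/seteqP; split => [p Up|p [n _ [b [_ _ bU] bp]]]; last exact: bU.
have [K [cK KU nK]] := compact_nbhs oU Up.
have [b [Bb bp] bK] := Bn p K nK.
exists (f b) => //; exists b; last exact: subset_closure.
split => //; apply: subset_trans KU.
have clK : closed K by apply: compact_closed; first exact: manifold_hausdorff.
by move=> p' bp'; apply: clK; apply: closureS bp'.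
Qed.

End SigmaCompact.

(** * The current in a flow box *)

Section BoxMeasure.
Variables (R : realType) (k : nat) (M : complexManifold R k) (Y : set M).
Variables (L : lamination Y) (T : harmonicCurrent L) (i : fbox L).

Lemma hc_linear c alpha beta : test_form alpha -> test_form beta ->
  hc_fun T (fun i p => c * alpha i p + beta i p) = c * hc_fun T alpha + hc_fun T beta.
Proof. by case: T => *; auto. Qed.

Lemma hc_pos alpha : test_form alpha -> (forall i p, fdom i p -> 0 <= alpha i p) ->
  0 <= hc_fun T alpha.
Proof. by case: T => *; auto. Qed.

Lemma hc_ddbar f : test_function L f -> hc_fun T (ddbar f) = 0.
Proof. by case: T => *; auto. Qed.

Lemma hc_measurable u : base2 i u ->
  measurable_fun [set: borel (ftrans i)] (fun t : ftrans i => hc_h T t u).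
Proof. by case: T => *; auto. Qed.

Lemma hc_ae : {ae hc_mu T i, forall t,
  harmonic_on (base2 i) (hc_h T t) /\ forall u, base2 i u -> 0 <= hc_h T t u}.
Proof. by case: T => *; auto. Qed.

Lemma hc_box alpha : test_form alpha -> supported_in alpha (fdom i) ->
  let slice := fun t : borel (ftrans i) =>
    \int[@leb2 R]_(u in base2 i) (hc_h T t u * in_box (alpha i) u t * 2) in
  (hc_mu T i).-integrable setT (EFin \o slice) /\ hc_fun T alpha = \int[hc_mu T i]_t slice t.
Proof.
case: T => ? ? ? ? ? ? ? ? ? H h1 h2; exact: (H i alpha h1 h2).
Qed.

Definition box_open_dom (V : set M) : set (R * R * ftrans i) :=
  [set q | base2 i q.1 /\ V (finv (cplx q.1, q.2))].

Lemma box_open_dom_open V : open V -> open (box_open_dom V).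
Proof.
move=> oV; apply: (@open_cplx_pair _ _ [set q : Cx R * ftrans i | fbase i q.1 /\ V (finv q)]).
by rewrite openE => q [bq Vq]; exact: finv_near.
Qed.

Lemma base2_open : open (base2 i).
Proof.
apply: (@open_comp _ _ (@cplx R)); last exact: fbase_open.
by move=> u _; exact: continuous_cplx.
Qed.

Let plane := (measurableTypeR R * measurableTypeR R)%type.

Lemma hc_good : exists N : set (borel (ftrans i)), [/\ measurable N, hc_mu T i N = 0%E &
  forall t, ~ N t -> (forall u, base2 i u -> {for u, continuous (hc_h T t)}) /\
    (forall u, base2 i u -> 0 <= hc_h T t u)].
Proof.
have [N [mN N0 NP]] := hc_ae; exists N; split => // t nN.
have [[hc _] h0] : harmonic_on (base2 i) (hc_h T t) /\
    forall u, base2 i u -> 0 <= hc_h T t u.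
  by apply: contrapT => nP; apply: nN; exact: NP.
by split => // u bu; have [] := hc [::] u isT bu.
Qed.

(* The compact support of alpha cuts a compact set out of each plaque. *)
Lemma plaque_compact (K : set M) (t : ftrans i) : compact K -> K `<=` fdom i ->
  compact [set u : R * R | base2 i u /\ K (finv (cplx u, t))].
Proof.
move=> cK Ki.
have cf : {within K, continuous (@fmap _ _ _ _ L i)}.
  exact: continuous_subspaceW Ki (@fmap_within _ _ _ _ _ i).
have cI := continuous_compact cf cK.
have cl : closed [set q : Cx R * ftrans i | q.2 = t].
  rewrite (_ : [set _ | _] = snd @^-1` [set t]) //.
  apply: closed_comp; first by move=> q _; exact: cvg_snd.
  have [hT _] : hausdorff_space (ftrans i) /\ locally_compact [set: ftrans i].
    by case: L i {cf cI} => *; auto.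
  apply: compact_closed => //; exact: compact_set1.
have cJ := compact_closedI cI cl.
set J := _ `&` _ in cJ; pose fr (q : Cx R * ftrans i) := reim q.1.
set S' := [set u | _]; have -> : S' = fr @` J.
  symmetry.
  apply/seteqP; split => [u [q [[p Kp pq] qt] qu]|u [bu Ku]].
    have [bp pK] := fmapK (Ki _ Kp).
    have E : (cplx u, t) = fmap i p by rewrite pq -qu reimK -qt; case: (q).
    by rewrite /S' /= E pK; split => //; rewrite /base2 /= -[cplx u]/((cplx u, t).1) E.
  have [iu uK] := @finvK _ _ _ _ L i (cplx u, t) bu.
  exists (cplx u, t); last by rewrite /fr /= cplxK.
  by split => //; exists (finv (cplx u, t)).
apply: (continuous_compact _ cJ); apply: continuous_subspaceT => q.
by apply: (@continuous_comp _ _ _ fst (@reim R)); [exact: cvg_fst|exact: continuous_reim].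
Qed.

(** The current is expressed with real-valued integrals, in which an infinite slice would count as
    0; finiteness identifies them with the extended ones. The support of alpha meets the plaque in a
    compact set, on which the continuous integrand is bounded. *)
Lemma slice_fin alpha (t : borel (ftrans i)) : test_form alpha ->
  supported_in alpha (fdom i) -> (forall p, fdom i p -> 0 <= alpha i p) ->
  (forall u, base2 i u -> {for u, continuous (hc_h T t)}) ->
  (forall u, base2 i u -> 0 <= hc_h T t u) ->
  (\int[@leb2 R]_(u in base2 i) (hc_h T t u * in_box (alpha i) u t * 2)%:E < +oo)%E.
Proof.
move=> [_ asm _] [K [cK Ki] K0] a0 hc h0.
have cS := @plaque_compact K t cK Ki; set S := [set u | _] in cS.
pose g u := hc_h T t u * in_box (alpha i) u t * 2.
have gc u : base2 i u -> {for u, continuous g}.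
  move=> bu; apply: cvgM; last exact: cvg_cst.
  apply: cvgM; first exact: hc.
  have [_ ac] := asm i [::] u t bu.
  apply: (@continuous_comp _ _ _ (fun u : R * R => (u, t)) (fun q : R * R * ftrans i =>
    in_box (alpha i) q.1 q.2)); last exact: ac.
  exact: (cvg_pair cvg_id (cvg_cst _)).
have gS : {within S, continuous g}.
  have SB : S `<=` base2 i by move=> u [].
  apply: continuous_subspaceW SB _.
  by rewrite continuous_open_subspace; [move=> u; rewrite inE => /gc|exact: base2_open].
have bound (V : normedModType R) (A : set V) : compact A ->
    exists2 m : R, 0 <= m & forall x, A x -> `|x| <= m.
  move=> /compact_bounded [m [_ mP]]; exists (`|m| + 1) => //.
  by apply: mP; rewrite (le_lt_trans (ler_norm m)) // ltrDl.
have [m m0 mP] := bound _ _ (continuous_compact gS cS).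
have [r r0 rP] := bound _ _ cS.
pose I : set (measurableTypeR R) := [set` `[- r, r] ].
pose sq : set plane := I `*` I.
have msq : measurable sq by apply: measurableX; exact: measurable_itv.
apply: (@le_lt_trans _ _ (\int[@leb2 R]_(u in sq) (m%:E))%E); last first.
  rewrite integral_cst // [X in (_ * X)%E](_ : _ = lebesgue_measure I * lebesgue_measure I)%E;
    last by apply: product_measure1E; exact: measurable_itv.
  have I0 : (lebesgue_measure I < +oo)%E.
    by rewrite /I lebesgue_measure_itv; case: ifP => // _; rewrite -EFinB ltry.
  rewrite lte_mul_pinfty // ?lee_fin // lte_mul_pinfty // ge0_fin_numE //.
rewrite integral_mkcond [leRHS]integral_mkcond; apply: le_integral_ge0 => u _.
  rewrite /patch; case: ifP => //; rewrite inE => bu; rewrite lee_fin mulr_ge0 //.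
  by rewrite mulr_ge0 ?h0 // a0 //; exact: (finvK _).1.
rewrite /patch; case: ifP => [|_]; last by case: ifP => // _; rewrite lee_fin.
rewrite inE => bu; have [Ku|nKu] := pselect (K (finv (cplx u, t))).
  have Su : S u by [].
  have nu := rP _ Su; rewrite prod_normE ge_max !ler_norml in nu.
  rewrite ifT; last first.
    by rewrite inE; move: nu => /andP[h1 h2]; split; rewrite /I /= in_itv.
  by rewrite lee_fin (le_trans (ler_norm _)) //; apply: mP; exists u.
rewrite /in_box K0 //; last exact: (finvK _).1.
by rewrite mulr0 mul0r; case: ifP => // _; rewrite lee_fin.
Qed.

End BoxMeasure.

Arguments box_open_dom {R k M Y L} i V.

(** * In a flow box, the measure whose density is the harmonic functions of T times a continuous
    weight *)

Section WeightedBoxMeasure.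
Variables (R : realType) (k : nat) (M : complexManifold R k) (Y : set M).
Variables (L : lamination Y) (T : harmonicCurrent L) (i : fbox L).
Variables (p0 : M) (V : set M) (W : M -> R).
Hypotheses (oV : open V)
  (Wc : forall q, box_open_dom i V q ->
     {for q, continuous (fun q : R * R * ftrans i => in_box W q.1 q.2)})
  (W0 : forall p, fdom i p -> V p -> 0 <= W p).

Let plane := (measurableTypeR R * measurableTypeR R)%type.
Let bp := (borel (ftrans i) * plane)%type.

(** A total parametrization by the whole product; [p0] is the default value off the base, where the
    measures below have no mass. *)
Definition box_param (q : bp) : M :=
  if `[< base2 i q.2 >] then finv (cplx q.2, q.1) else p0.

Lemma box_paramE t u : base2 i u -> box_param (t, u) = finv (cplx u, t).
Proof. by move=> bu; rewrite /box_param asboolT. Qed.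

Lemma measurable_box_param (U : set M) : open U -> measurable (box_param @^-1` U).
Proof.
move=> oU; have mB : measurable ([set q | base2 i q.2] : set bp).
  rewrite (_ : [set _ | _] = setT `*` base2 i); last by apply/seteqP; split => q //= -[].
  by apply: measurableX => //; apply: measurable_open2; exact: base2_open.
have mU := measurable_openX (box_open_dom_open (i := i) oU).
rewrite (_ : _ @^-1` _ = [set q : bp | box_open_dom i U (q.2, q.1)] `|`
  (if `[< U p0 >] then ~` [set q : bp | base2 i q.2] else set0)).
  apply: measurableU => //; case: ifP => // _; exact: measurableC.
apply/seteqP; split => -[t u]; rewrite /box_param /=.
  case: asboolP => bu Uq; first by left.
  by right; rewrite asboolT.
by case=> [[/= bu Uu]|]; [rewrite asboolT|case: asboolP => // Up nb; rewrite asboolF].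
Qed.

(** A measure between the two quantities to be compared: with W above the Poincare density it
    dominates the box mass, and it is dominated by T on positive test forms that lie above W. *)
Lemma box_measure_exists : exists nu : {measure set bp -> \bar R},
  (forall S, <<s @open M >> S -> measurable (box_param @^-1` S) -> S `<=` V `&` fdom i ->
     (forall p, S p -> poincare_density i p <= W p) ->
     (box_mass T i S <= nu (box_param @^-1` S))%E) /\
  (forall alpha S, test_form alpha -> supported_in alpha (fdom i) ->
     (forall p, fdom i p -> 0 <= alpha i p) -> measurable (box_param @^-1` S) ->
     (forall p, S p -> V p -> fdom i p -> W p <= alpha i p) ->
     (nu (box_param @^-1` S) <= (hc_fun T alpha)%:E)%E).
Proof.
have [N [mN N0 NP]] := hc_good T i.
(* The density is set to 0 outside V and over the null set [N], where continuity and sign of the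
   harmonic functions are not controlled. *)
pose D : set bp := (~` N) `*` base2 i `&` [set q | box_open_dom i V (q.2, q.1)].
pose f (q : bp) := hc_h T q.1 q.2 * in_box W q.2 q.1 * 2.
have mV := measurable_openX (box_open_dom_open (i := i) oV).
have mD1 : measurable ((~` N) `*` base2 i : set bp).
  by apply: measurableX; [exact: measurableC|apply: measurable_open2; exact: base2_open].
have mD : measurable D by exact: measurableI.
have mf : measurable_fun D f.
  apply: measurable_funM; last exact: measurable_cst.
  apply: measurable_funM.
    apply: (measurable_funS mD1); first exact: subIsetl.
    apply: measurable_fun_Caratheodory => //; first exact: base2_open.
      exact: hc_measurable.
    by move=> t u nN; have [h _] := NP t nN; exact: h.
  apply: (measurable_funS mV); first exact: subIsetr.
  apply: (@measurable_fun_openX _ _ _ (fun q : R * R * ftrans i => in_box W q.1 q.2)).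
    exact: box_open_dom_open.
  exact: Wc.
have f0 q : D q -> 0 <= f q.
  case: q => t u [[/= nN bu] [_ Vq]]; have [_ h0] := NP t nN.
  rewrite /f /= mulr_ge0 // mulr_ge0 //; first exact: h0.
  by apply: W0 => //; exact: (finvK _).1.
pose F := (EFin \o f) \_ D.
have F0 q : (0 <= F q)%E by rewrite /F /patch; case: ifP => //; rewrite inE => /f0.
have mF : measurable_fun setT F.
  by apply: (measurable_restrictT _ mD).1; apply/measurable_EFinP.
exists (iterated_density (hc_mu T i) (@leb2 R) mF F0).
have FD t u : ~ N t -> base2 i u -> V (finv (cplx u, t)) -> F (t, u) = (f (t, u))%:E.
  by move=> nN bu Vu; rewrite /F patchE ifT // inE.
have Fout t u : ~ D (t, u) -> F (t, u) = 0%E.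
  by move=> nD; rewrite /F patchE ifF //; apply/negP; rewrite inE.
split.
  move=> S bS mS SV SW; rewrite iterated_densityE.
  apply: (le_integral_ae measurableT mN N0).
    exact: (measurable_iterated_slice (@leb2 R) mF F0 mS).
  move=> t _ nN; split; first exact: integral_ge0.
  have [_ h0] := NP t nN.
  rewrite integral_mkcond [leRHS]integral_mkcond; apply: le_integral_ge0 => u _.
    rewrite /patch; case: ifP => //; rewrite inE => bu; rewrite lee_fin.
    rewrite !mulr_ge0 ?poincare_density_ge0 ?h0 // indicE //.
  rewrite /patch; case: ifP => [|_]; last by case: ifP.
  rewrite inE => bu; rewrite indicE; have [Su|nSu] := pselect (S (finv (cplx u, t))).
    rewrite mem_set // ifT; last by apply/mem_set; rewrite /xsection /= inE /= box_paramE.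
    have [Vu iu] := SV _ Su; rewrite FD // lee_fin mul1r ler_wpM2r // ler_wpM2l ?h0 //.
    exact: SW.
  by rewrite memNset // !mul0r; case: ifP.
move=> alpha S ta sa a0 mS SW; have [islice ->] := hc_box T ta sa.
rewrite iterated_densityE /Rintegral fineK; last exact: integrable_fin_num.
have [/measurable_EFinP/measurable_EFinP mslice _] := integrableP _ _ _ islice.
apply: (le_integral_ae measurableT mN N0) => // t _ nN.
have [hc h0] := NP t nN.
have sl0 : (0 <= \int[@leb2 R]_(u in base2 i) (hc_h T t u * in_box (alpha i) u t * 2)%:E)%E.
  apply: integral_ge0 => u bu; rewrite lee_fin mulr_ge0 // mulr_ge0 ?h0 //.
  by apply: a0; exact: (finvK _).1.
have slE : (\int[@leb2 R]_(u in base2 i) (hc_h T t u * in_box (alpha i) u t * 2))%:E =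
    (\int[@leb2 R]_(u in base2 i) (hc_h T t u * in_box (alpha i) u t * 2)%:E)%E.
  by rewrite /Rintegral fineK // ge0_fin_numE //; exact: slice_fin.
rewrite /= slE; split => //.
rewrite integral_mkcond [leRHS]integral_mkcond; apply: le_integral_ge0 => u _.
  by rewrite /patch; case: ifP.
rewrite /patch; case: ifP => [|_]; last first.
  case: ifP => //; rewrite inE => bu; rewrite lee_fin mulr_ge0 // mulr_ge0 ?h0 //.
  by apply: a0; exact: (finvK _).1.
rewrite inE /xsection /= inE /= => Su.
have [Du|nDu] := pselect (D (t, u)); last first.
  rewrite Fout //; case: ifP => //; rewrite inE => bu; rewrite lee_fin mulr_ge0 // mulr_ge0 ?h0 //.
  by apply: a0; exact: (finvK _).1.
have [[/= _ bu] [_ Vu]] := Du; rewrite box_paramE // in Su.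
rewrite FD // ifT ?inE // lee_fin ler_wpM2r // ler_wpM2l ?h0 //.
by apply: SW => //; exact: (finvK _).1.
Qed.

End WeightedBoxMeasure.

Section BoxInnerRegular.
Variables (R : realType) (k : nat) (M : complexManifold R k) (X : singLamination M).
Let L := lam X.

Lemma sing_closed : closed (sing X).
Proof.
have fX : finite_set (sing X) by case: X.
by apply: compact_closed; [exact: manifold_hausdorff|exact: finite_compact].
Qed.

Lemma supp_compact : compact (supp X). Proof. by case: X. Qed.

(** The part of the box in V is the trace on the compact X of an open set, E being closed, and that
    open set is a countable union of closed ones. *)
Lemma box_exhaustion (i : fbox L) (V : set M) : open V ->
  exists2 K : (set M)^nat, (forall n, compact (K n)) & V `&` fdom i = \bigcup_n K n.
Proof.
move=> oV; have [U oU iU] := fdom_relopen i.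
have oW : open (V `&` U `&` ~` sing X).
  by apply: openI; [exact: openI|rewrite openC; exact: sing_closed].
have [C cC CE] := manifold_Fsigma L oW.
exists (fun n => supp X `&` C n) => [n|].
  by apply: compact_closedI; [exact: supp_compact|exact: cC].
rewrite iU -setI_bigcupr -CE; apply/seteqP; split => [p [Vp [Up [sp np]]]|p [sp [[Vp Up] np]]].
  by split => //; split.
by split => //; split.
Qed.

Variables (i : fbox L) (V : set M) (d : measure_display) (T : measurableType d).
Variables (nu : {measure set T -> \bar R}) (phi : T -> M).
Hypotheses (oV : open V) (mphi : forall U : set M, open U -> measurable (phi @^-1` U)).

(** The measure itself may be infinite. Its bound on compact sets passes to the whole part of the
    box in V by exhaustion, and its restriction to this part is a finite measure. *)
Lemma box_inner_regular (B : R) (S : set M) (e : R) :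
  (forall K, compact K -> K `<=` V `&` fdom i -> (nu (phi @^-1` K) <= B%:E)%E) ->
  <<s @open M >> S -> S `<=` V `&` fdom i -> 0 < e ->
  exists C, [/\ compact C, C `<=` S & (nu (phi @^-1` S) <= nu (phi @^-1` C) + e%:E)%E].
Proof.
move=> KB bS SV e0; have [K cK KE] := box_exhaustion i oV.
have hM := @manifold_hausdorff _ _ M.
have mC (C : set M) : closed C -> measurable (phi @^-1` C).
  move=> cC; have mU := measurableC (mphi (closed_openC cC)).
  by rewrite -(setCK (phi @^-1` C)).
pose Kn N := \bigcup_(n in [set n | (n < N)%N]) K n.
have cKn N : compact (Kn N) by exact: compact_finite_bigcup.
have mKn N : measurable (phi @^-1` Kn N) by apply: mC; apply: compact_closed.
have ZE : phi @^-1` (V `&` fdom i) = \bigcup_N (phi @^-1` Kn N).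
  rewrite KE; apply/seteqP; split => [t [n _ Kt]|t [N _ [n _ Kt]]]; last by exists n.
  by exists n.+1 => //; exists n => /=.
have mZ : measurable (phi @^-1` (V `&` fdom i)) by rewrite ZE; exact: bigcupT_measurable.
have Z_le : (nu (phi @^-1` (V `&` fdom i)) <= B%:E)%E.
  have H := @nondecreasing_cvg_mu _ _ _ nu _ mKn.
  rewrite -ZE in H; have {}H := H mZ.
  have nd : {homo (fun N => phi @^-1` Kn N) : n m / (n <= m)%N >-> (n <= m)%O}.
    by move=> n m nm; apply/subsetPset => t [j /= jn Kj]; exists j => //=; exact: leq_trans jn nm.
  have {}H := H nd; rewrite -(cvg_lim _ H) //.
  apply: lime_le; first by apply/cvg_ex; eexists; exact: H.
  apply: nearW => N; apply: KB => //.
  by rewrite KE => p [n _ Kp]; exists n.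
pose nu' : {measure set T -> \bar R} := mrestr nu mZ.
have nu'E A : nu' A = nu (A `&` phi @^-1` (V `&` fdom i)) by [].
have fin : (nu' setT < +oo)%E by rewrite nu'E setTI (le_lt_trans Z_le) // ltry.
have sub A : A `<=` V `&` fdom i -> nu' (phi @^-1` A) = nu (phi @^-1` A).
  by move=> AV; rewrite nu'E setIidl // => t; exact: AV.
have SK : S `<=` \bigcup_n K n by rewrite -KE.
have [C [cC CS H]] := compact_inner_regular fin mphi (@manifold_Fsigma _ _ _ _ L) hM cK bS SK e0.
exists C; split => //; rewrite -!sub //; exact: subset_trans SV.
Qed.

End BoxInnerRegular.

(** * Smooth forms and bump functions *)

(** If P failed on K, the complements in K of the sets with P would form a base of a proper filter,
    and a cluster point of it would have no neighbourhood with P. *)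
Lemma compact_induction (T : topologicalType) (K : set T) (P : set T -> Prop) :
  compact K -> P set0 -> (forall A B, A `<=` B -> P B -> P A) ->
  (forall A B, P A -> P B -> P (A `|` B)) ->
  (forall x, K x -> exists2 N, nbhs x N & P N) -> P K.
Proof.
move=> cK P0 PS PU Pl; apply: contrapT => nP.
pose F : set_system T := [set A | exists2 B, P B & K `\` B `<=` A].
have fF : Filter F.
  split; first by exists set0.
    move=> A1 A2 [B1 P1 h1] [B2 P2 h2]; exists (B1 `|` B2); first exact: PU.
    by move=> p [Kp nB]; split; [apply: h1|apply: h2]; split => // Bp; apply: nB; [left|right].
  by move=> A1 A2 A12 [B PB h]; exists B => //; exact: subset_trans h A12.
have pF : ProperFilter F.
  split => // -[B PB KB]; apply: nP; apply: PS PB => p Kp.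
  by apply: contrapT => nB; exact: (KB p).
have [|x [Kx cx]] := cK F pF; first by exists set0 => // p [].
have [N nN PN] := Pl x Kx.
have FN : F (K `\` N) by exists N.
by have [p [[_ nNp] Np]] := cx _ _ FN nN.
Qed.

Section SmoothForms.
Variables (R : realType) (k : nat) (M : complexManifold R k) (Y : set M).
Variable L : lamination Y.
Implicit Types (chi : M -> R) (alpha beta : form L).

Definition smooth_fun chi := forall n (i : fbox L),
  csm n (base2 i `*` [set: ftrans i]) (in_box (i := i) chi).

Definition smooth_form alpha :=
  (forall (i j : fbox L) p, fdom i p -> fdom j p ->
     alpha i p = alpha j p * cabs (derive1
       (fun x : Cx R => (fmap j (finv (x, (fmap i p).2))).1) (fmap i p).1) ^+ 2) /\
  forall n (i : fbox L), csm n (base2 i `*` [set: ftrans i]) (in_box (i := i) (alpha i)).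

Lemma base2_setX_open (i : fbox L) : open (base2 i `*` [set: ftrans i]).
Proof.
rewrite openE => -[u t] [/= bu _]; exists (base2 i, setT) => /=; last by [].
by split; [exact: (near_open (@base2_open _ _ _ _ L i) bu)|exact: filterT].
Qed.

Lemma smooth_form_test alpha : smooth_form alpha -> supported_in alpha Y -> test_form alpha.
Proof. by move=> [h1 h2] h3; split => // i; apply: csm_leaf_smooth => n; exact: h2. Qed.

Lemma smooth_formM chi alpha : smooth_fun chi -> smooth_form alpha ->
  smooth_form (fun i p => chi p * alpha i p).
Proof.
move=> cs [h1 h2]; split => [i j p ip jp|n i]; first by rewrite (h1 i j p ip jp) mulrA.
exact: csmM (@base2_setX_open i) (cs n i) (h2 n i).
Qed.

Lemma smooth_formD alpha beta : smooth_form alpha -> smooth_form beta ->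
  smooth_form (fun i p => alpha i p + beta i p).
Proof.
move=> [h1 h2] [g1 g2]; split => [i j p ip jp|n i].
  by rewrite (h1 i j p ip jp) (g1 i j p ip jp) mulrDl.
exact: csmD (@base2_setX_open i) (h2 n i) (g2 n i).
Qed.

Lemma smooth_fun_cst c : smooth_fun (fun=> c).
Proof. by move=> n i; apply: csm_cst; exact: base2_setX_open. Qed.

Lemma smooth_funD chi chi' : smooth_fun chi -> smooth_fun chi' ->
  smooth_fun (fun p => chi p + chi' p).
Proof. by move=> h g n i; apply: csmD (h n i) (g n i); exact: base2_setX_open. Qed.

Lemma smooth_funM chi chi' : smooth_fun chi -> smooth_fun chi' ->
  smooth_fun (fun p => chi p * chi' p).
Proof. by move=> h g n i; apply: csmM (h n i) (g n i); exact: base2_setX_open. Qed.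

Lemma smooth_fun_onem chi : smooth_fun chi -> smooth_fun (fun p => 1 - chi p).
Proof.
move=> h; have := smooth_funD (smooth_fun_cst 1) (smooth_funM (smooth_fun_cst (-1)) h).
by congr smooth_fun; apply/funext => p; rewrite mulN1r.
Qed.

(** The value of the local bump ramp (1/2 - |z|^2) at |z|^2 = 1/4. Bumps are only bounded below by
    it on K, not equal to 1, which costs a constant factor in the mass bound. *)
Definition bump_height : R := ramp (4^-1).

Lemma bump_height_gt0 : 0 < bump_height.
Proof. by rewrite ramp_gt0 // invr_gt0. Qed.

(** Local bumps are joined by 1 - (1 - chi) (1 - chi'), which is smooth, stays in [0, 1] and
    dominates both of them. *)
Lemma bump (K W : set M) : compact K -> open W -> K `<=` W ->
  exists chi, [/\ smooth_fun chi, forall p, 0 <= chi p <= 1,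
    forall p, K p -> bump_height <= chi p &
    exists K', [/\ compact K', K' `<=` W & forall p, ~ K' p -> chi p = 0]].
Proof.
move=> cK oW KW.
pose P (A : set M) := exists chi, [/\ smooth_fun chi, forall p, 0 <= chi p <= 1,
    forall p, A p -> bump_height <= chi p &
    exists K', [/\ compact K', K' `<=` W & forall p, ~ K' p -> chi p = 0]].
apply: (@compact_induction _ K P) => //.
- exists (fun=> 0); split => //; first exact: smooth_fun_cst.
    by move=> p; rewrite lexx ler01.
  by exists set0; split => //; exact: compact0.
- move=> A B AB [chi [h1 h2 h3 h4]]; exists chi; split => // p /AB; exact: h3.
- move=> A B [chi [h1 h2 h3 [K1 [cK1 K1W z1]]]] [chi' [g1 g2 g3 [K2 [cK2 K2W z2]]]].
  exists (fun p => 1 - (1 - chi p) * (1 - chi' p)); split.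
  + by apply: smooth_fun_onem; apply: smooth_funM; exact: smooth_fun_onem.
  + move=> p; have /andP[a1 a2] := h2 p; have /andP[b1 b2] := g2 p.
    rewrite subr_ge0 lerBlDr lerDl mulr_ge0 ?subr_ge0 // andbT.
    by rewrite mulr_ile1 ?subr_ge0 // lerBlDr lerDl.
  + move=> p; have /andP[a1 a2] := h2 p; have /andP[b1 b2] := g2 p.
    have a3 : 0 <= 1 - chi p by rewrite subr_ge0.
    have b3 : 0 <= 1 - chi' p by rewrite subr_ge0.
    case=> [/h3 h|/g3 h]; apply: le_trans h _; rewrite lerBrDr -lerBrDl.
      by rewrite ler_piMr // lerBlDr lerDl.
    by rewrite ler_piMl // lerBlDr lerDl.
  exists (K1 `|` K2); split; first exact: compactU.
    by rewrite subUset.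
  move=> p nK; rewrite z1 ?z2 ?subr0 ?mulr1 ?subrr // => h; apply: nK; by [left|right].
move=> q Kq; have [c cc cq] := manifold_chart q.
have [rho rho0 H] := chart_ballP L (atlas_holo cc) cq oW (KW _ Kq).
have [cb DW Dq _] := H rho rho0 (lexx _); have [oD zc n1 cP _] := cb.
pose z := chart_coord c q rho; pose D := chart_ball c q rho.
have half1 : 2^-1 < 1 :> R by rewrite invf_lt1 // ltr1n.
exists [set p | D p /\ normsq (z p) < 4^-1].
  have nc : {for q, continuous (fun p => normsq (z p))}.
    apply: (@continuous_sum _ _ _ (fun j p => cabs (z p j) ^+ 2)) => j.
    by apply: continuous_cabs2; exact: zc.
  have n2 : \forall p \near q, normsq (z p) < 4^-1.
    by apply: (nc _ (lt_nbhsl _)); rewrite chart_coord0 invr_gt0.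
  by apply: filterS2 (near_open oD Dq) n2 => p h1 h2.
exists (rfun z D (fun s => ramp (2^-1 - s)) 0); split.
- move=> n i; apply: (rfun_csm cb openT half1) => //.
    have Ho : open [set: R] by exact: openT.
    apply: (@rsm_comp _ n setT setT (fun s => 2^-1 - s) (@ramp R)) => //; last exact: rsm_ramp.
    apply: (@rsm_eq _ n setT (fun s => 2^-1 + -1 * s)) => //; first by move=> x _; rewrite mulN1r.
    by apply: rsmD => //; [exact: rsm_cst|apply: rsmZ => //; exact: rsm_id].
  by move=> x _ hx; rewrite ramp_le0 // subr_le0.
- move=> p; rewrite /rfun; case: asboolP => _; last by rewrite lexx ler01.
  rewrite ramp_ge0 ltW // ramp_lt1 // lerBlDr (le_trans (ltW half1)) // lerDl.
  exact: normsq_ge0.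
- move=> p [Dp sp]; rewrite /rfun asboolT // ramp_le // lerBrDr -lerBrDl.
  by apply: le_trans (ltW sp) _; lra.
exists [set p | D p /\ normsq (z p) <= 2^-1]; split; first exact: cP.
  by move=> p [Dp _]; exact: DW.
move=> p np; rewrite /rfun; case: asboolP => // Dp; rewrite ramp_le0 // subr_le0 leNgt.
by apply/negP => /ltW h; exact: np.
Qed.

Lemma supported_scale chi alpha : supported_in alpha Y ->
  supported_in (fun i p => chi p * alpha i p) Y.
Proof. by move=> [K KY K0]; exists K => // i p ip nK; rewrite K0 // mulr0. Qed.

(* Peel off the pieces K j one after the other with bump functions. *)
Lemma mass_pieces (T : harmonicCurrent L) (J : eqType) (b : J -> fbox L) (K : J -> set M)
    (m : J -> R) (beta0 : form L) (s : seq J) (beta : form L) :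
  (forall j, compact (K j) /\ K j `<=` fdom (b j)) ->
  (forall j l, j != l -> K j `&` K l = set0) ->
  (forall j alpha, test_form alpha -> supported_in alpha (fdom (b j)) ->
     (forall i p, fdom i p -> 0 <= alpha i p) ->
     (forall p, K j p -> bump_height * beta0 (b j) p <= alpha (b j) p) ->
     m j <= hc_fun T alpha) ->
  uniq s -> smooth_form beta -> supported_in beta Y ->
  (forall i p, fdom i p -> 0 <= beta i p) ->
  (forall j p, j \in s -> K j p -> beta (b j) p = beta0 (b j) p) ->
  \sum_(j <- s) m j <= hc_fun T beta.
Proof.
move=> Kb Kd mP; elim: s beta => [|j s IH] beta.
  by move=> _ sb ub b0 _; rewrite big_nil; apply: hc_pos => //; exact: smooth_form_test.
move=> /= /andP[js us] sb ub b0 bb; have [cKj Kjb] := Kb j.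
have [U oU iU] := fdom_relopen (b j).
pose Ks := \big[setU/set0]_(l <- s) K l.
have cKs : compact Ks by apply: bigsetU_compact => l _; have [] := Kb l.
have oKs : open (~` Ks).
  by rewrite openC; apply: compact_closed => //; exact: manifold_hausdorff.
have KsE p : Ks p -> exists2 l, l \in s & K l p.
  rewrite /Ks; elim: (s) => [|l s' IHs]; first by rewrite big_nil.
  rewrite big_cons => -[Kl|/IHs [l' l's Kl]]; first by exists l => //; rewrite mem_head.
  by exists l' => //; rewrite in_cons l's orbT.
(* The bump of the piece [K j] has to vanish on the remaining pieces, so that (1 - chi) * beta still
   equals [beta0] on them. *)
have KW : K j `<=` U `&` ~` Ks.
  move=> p Kp; split; first by have := Kjb _ Kp; rewrite iU => -[].
  move=> /KsE [l ls Kl]; have jl : j != l by apply: contraNneq js => ->.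
  by have : (K j `&` K l) p by []; rewrite Kd.
have [chi [cs c01 cK [K' [cK' K'W z']]]] := bump cKj (openI oU oKs) KW.
have E : beta = (fun i p => 1 * (chi p * beta i p) + (1 - chi p) * beta i p).
  by apply/funext => i; apply/funext => p; ring.
have s1 := smooth_formM cs sb; have s2 := smooth_formM (smooth_fun_onem cs) sb.
have u1 := supported_scale chi ub; have u2 := supported_scale (fun p => 1 - chi p) ub.
have t1 := smooth_form_test s1 u1; have t2 := smooth_form_test s2 u2.
rewrite [X in hc_fun T X]E (hc_linear T 1 t1 t2) mul1r big_cons lerD //.
  apply: mP => //.
  - have [B [cB BY] B0] := ub; exists (K' `&` B).
      split; first by apply: compact_closedI => //; apply: compact_closed => //;
        exact: manifold_hausdorff.
      by move=> p [/K'W [Up _] /BY Yp]; rewrite iU.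
    move=> i p ip nKB; have [Kp|/z' ->] := pselect (K' p); last by rewrite mul0r.
    by rewrite B0 ?mulr0 // => Bp; exact: nKB.
  - by move=> i p ip; have /andP[c0 _] := c01 p; rewrite mulr_ge0 // b0.
  - move=> p Kp; rewrite bb ?mem_head //; rewrite ler_wpM2r ?cK //.
    by rewrite -bb ?mem_head // b0 //; exact: Kjb.
apply: IH => //.
- by move=> i p ip; have /andP[_ c1] := c01 p; rewrite mulr_ge0 ?subr_ge0 // b0.
move=> l p ls Kl; rewrite z' ?subr0 ?mul1r; first by rewrite bb // in_cons ls orbT.
move=> /K'W [_ nKs]; apply: nKs; rewrite /Ks (big_rem l) //=; by left.
Qed.

End SmoothForms.

(** * Potentials *)

Section PotentialFunction.
Variable R : realType.
Implicit Types (N s v x : R).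

Let dramp x : R := flat 0 x + flat 1 x.

(* ln(- ln |w|^2) is a potential of the Poincare metric of the punctured disc, up
   to sign; the two ramps make it constant for s >= 1/e and 0 near s = 0. *)
Definition theta N s := ramp (N - ramp (ln (- ln s))).

Lemma ln_oppln_gt0 s : 0 < s < 1 -> 0 < - ln s.
Proof. by move=> Us; rewrite oppr_gt0 ln_lt0. Qed.

Let U : set R := [set s | 0 < s < 1].

Lemma unit_interval_open : open U.
Proof.
rewrite (_ : U = [set s | 0 < s] `&` [set s | s < 1]).
  by apply: openI; [exact: open_gt|exact: open_lt].
by apply/seteqP; split => s /=; [move/andP|move=> ?; apply/andP].
Qed.

Lemma theta_rsm m N : rsm m U (theta N).
Proof.
have oU := unit_interval_open; have oT : open [set: R] by exact: openT.
have oP : open [set x : R | 0 < x] by exact: open_gt.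
have h1 : rsm m U (fun s => -1 * ln s).
  by apply: rsmZ => //; apply: rsm_sub (@rsm_ln R m) => s /andP[].
have h2 : rsm m U (fun s => ln (-1 * ln s)).
  apply: (@rsm_comp _ m U [set x | 0 < x] (fun s => -1 * ln s) (@ln R)) => //.
    by move=> s Us; rewrite /= mulN1r; exact: ln_oppln_gt0.
  exact: rsm_ln.
have h3 : rsm m U (fun s => N + -1 * ramp (ln (-1 * ln s))).
  apply: rsmD => //; first exact: rsm_cst.
  apply: rsmZ => //; apply: (@rsm_comp _ m U setT _ (@ramp R)) => //; exact: rsm_ramp.
have := @rsm_comp _ m U setT _ (@ramp R) oU oT (fun _ _ => I) h3 (@rsm_ramp R m).
by apply: rsm_eq => // s _; rewrite /theta /= !mulN1r.
Qed.

Let V s : R := ln (- ln s).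

Let compose (f g : R -> R) x a b : is_derive (g x) 1 f a -> is_derive x 1 g b ->
  is_derive x 1 (fun x => f (g x)) (b * a).
Proof. by move=> df dg; have := is_derive1_comp df dg; rewrite mulrC. Qed.

Let is_derive_V s : 0 < s < 1 -> is_derive s 1 V ((s * ln s)^-1).
Proof.
move=> Us; have /andP[s0 s1] := Us; have L0 := ln_oppln_gt0 Us.
have d1 : is_derive s 1 (fun s => - ln s) (- s^-1) by apply: is_deriveN; exact: is_derive1_ln.
have d2 := @compose (@ln R) (fun s => - ln s) s _ _ (is_derive1_ln L0) d1.
by apply: is_derive_eq d2 _; rewrite invrN mulrNN invfM.
Qed.

(* With v = ln(-ln s) and w = N - ramp v, the first and second derivatives of
   ramp (N - ramp v) with respect to v. *)
Let w N s := N - ramp (V s).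
Let dH N s := - (dramp (w N s) * dramp (V s)).
Let ddH N s := flat 3 (w N s) * dramp (V s) ^+ 2 - dramp (w N s) * flat 3 (V s).

Let is_derive_w N s : 0 < s < 1 ->
  is_derive s 1 (w N) (- (dramp (V s) * (s * ln s)^-1)).
Proof.
move=> Us; have d := @compose (@ramp R) V s _ _ (is_derive_ramp (V s)) (is_derive_V Us).
have d' := is_deriveB (is_derive_cst N s 1) d.
by apply: is_derive_eq d' _; rewrite sub0r /dramp; ring.
Qed.

Lemma is_derive_theta N s : 0 < s < 1 -> is_derive s 1 (theta N) (dH N s / (s * ln s)).
Proof.
move=> Us; have d := @compose (@ramp R) (w N) s _ _ (is_derive_ramp (w N s)) (is_derive_w N Us).
by apply: is_derive_eq d _; rewrite /dH /dramp; ring.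
Qed.

Lemma derive1_theta N s : 0 < s < 1 -> derive1 (theta N) s = dH N s / (s * ln s).
Proof. by move=> Us; rewrite derive1E; have [_ ->] := is_derive_theta N Us. Qed.

Let is_derive_dH N s : 0 < s < 1 -> is_derive s 1 (dH N) (ddH N s / (s * ln s)).
Proof.
move=> Us; have d1 := @compose dramp (w N) s _ _ (is_derive_ramp' (w N s)) (is_derive_w N Us).
have d2 := @compose dramp V s _ _ (is_derive_ramp' (V s)) (is_derive_V Us).
have d := is_deriveN (is_deriveM d1 d2).
apply: is_derive_eq d _; rewrite /ddH /GRing.scale /=.
have E (a b x y z : R) : - (a * (z * y) + b * (- (b * z) * x)) = (x * b ^+ 2 - a * y) * z.
  by ring.
exact: E.
Qed.

(** The left-hand side is (s theta')'. With v = ln (- ln s) one has s d/ds = (ln s)^-1 d/dv, so s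
    theta' = H' / ln s and its derivative is (H'' - H') / (s (ln s)^2), H' and H'' being derivatives
    in v. *)
Lemma derive2_theta N s : 0 < s < 1 ->
  derive1 (theta N) s + s * derive1 (derive1 (theta N)) s =
  (ddH N s - dH N s) / (s * ln s ^+ 2).
Proof.
move=> Us; have /andP[s0 s1] := Us; have ls : ln s < 0 by exact: ln_lt0.
have sl : s * ln s != 0 by rewrite mulf_neq0 // ?(gt_eqF s0) ?(lt_eqF ls).
have d1 : is_derive s 1 (fun s => s * ln s) (ln s + 1).
  have d := is_deriveM (is_derive_id s 1) (is_derive1_ln s0).
  by apply: is_derive_eq d _; rewrite /GRing.scale /= mulr1 mulfV ?(gt_eqF s0) // addrC.
have d2 := is_deriveM (is_derive_dH N Us) (@is_deriveV R (fun s => s * ln s) s _ 1 sl d1).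
have E : \forall x \near s, (dH N * (fun s => (s * ln s)^-1)) x = derive1 (theta N) x.
  by apply: filterS (near_open unit_interval_open Us) => x Ux; rewrite derive1_theta.
rewrite derive1_theta // [X in _ + s * X]derive1E.
rewrite -(near_eq_derive _ E).
have [_ ->] := d2; rewrite /GRing.scale /=; field.
by rewrite ?(gt_eqF s0) ?(lt_eqF ls).
Qed.

Lemma le_lnln x s : 0 < s < 1 -> (x <= ln (- ln s)) = (s <= expR (- expR x)).
Proof.
move=> Us; have /andP[s0 _] := Us; have L0 := ln_oppln_gt0 Us.
by rewrite -(ler_expR x) lnK // lerNr -(ler_expR (ln s)) lnK.
Qed.

Lemma lnln_le x s : 0 < s < 1 -> (ln (- ln s) <= x) = (expR (- expR x) <= s).
Proof.
move=> Us; have /andP[s0 _] := Us; have L0 := ln_oppln_gt0 Us.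
by rewrite -(ler_expR _ x) lnK // lerNl -(ler_expR _ (ln s)) lnK.
Qed.

Let dramp_ge0 x : 0 <= dramp x. Proof. by rewrite addr_ge0 ?flat_ge0. Qed.

Let sL_gt0 s : 0 < s < 1 -> 0 < s * ln s ^+ 2.
Proof.
by move=> Us; have /andP[s0 _] := Us; rewrite mulr_gt0 // exprn_even_gt0 //= lt_eqF // ln_lt0.
Qed.

Lemma theta_derive_ge0 N s : 0 < s < 1 -> 0 <= derive1 (theta N) s.
Proof.
move=> Us; have /andP[s0 _] := Us; rewrite derive1_theta // /dH mulNr -mulrN -invrN -mulrN.
by rewrite !mulr_ge0 // invr_ge0 mulr_ge0 ?ltW // ln_oppln_gt0.
Qed.

(** The points where ln (- ln s) is 1 and 0. Below the first [ramp_convex_gap] applies, above the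
    second the potential is constant; in between its i ddbar may be negative. *)
Definition theta_low : R := expR (- expR 1).
Definition theta_high : R := expR (- 1).

(** Up to a positive factor, (s theta')' is ramp''(w) ramp'(v)^2 + ramp'(w) (ramp'(v) - ramp''(v)).
    The last difference is positive for v >= 1 and zero for v <= 0. *)
Lemma theta_convex_outside N s : 0 < s < 1 -> s <= theta_low \/ theta_high <= s ->
  0 <= derive1 (theta N) s + s * derive1 (derive1 (theta N)) s.
Proof.
move=> Us Hs; rewrite derive2_theta // divr_ge0 ?(ltW (sL_gt0 Us)) //.
have E : ddH N s - dH N s = flat 3 (w N s) * dramp (V s) ^+ 2 +
    dramp (w N s) * (dramp (V s) - flat 3 (V s)) by rewrite /ddH /dH; ring.
rewrite E addr_ge0 //; first by rewrite mulr_ge0 ?flat_ge0 ?sqr_ge0.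
rewrite mulr_ge0 //; case: Hs => [|Hs].
  rewrite /theta_low -le_lnln // => /ramp_convex_gap; apply: le_trans; exact: expR_ge0.
have V0 : V s <= 0 by rewrite lnln_le // expR0.
by rewrite /dramp !flat_le0 // addr0 subr0.
Qed.

(** The only negative term, - ramp'(w) ramp''(v), is bounded without reference to N by ramp' <= 1
    and ramp'' <= 3!. The denominator s (ln s)^2 is at least [theta_low] because - ln s >= 1 in the
    annulus. *)
Lemma theta_convex_inside N s : 0 < s < 1 -> theta_low <= s -> s <= theta_high ->
  - (3`!%:R / theta_low) <= derive1 (theta N) s + s * derive1 (derive1 (theta N)) s.
Proof.
move=> Us s1 s2; have /andP[s0 _] := Us.
have E : ddH N s - dH N s = flat 3 (w N s) * dramp (V s) ^+ 2 +
    dramp (w N s) * dramp (V s) - dramp (w N s) * flat 3 (V s) by rewrite /ddH /dH; ring.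
have h1 : dramp (w N s) * flat 3 (V s) <= 3`!%:R.
  by rewrite -[leRHS]mul1r ler_pM ?flat_ge0 // ?flat_le // ramp'_le1.
have h2 : theta_low <= s * ln s ^+ 2.
  apply: (le_trans s1); rewrite ler_peMr ?(ltW s0) //.
  have l1 : 1 <= - ln s.
    by rewrite lerNr -(ler_expR (ln s)) lnK.
  by rewrite -sqrrN expr_ge1 // (le_trans ler01).
have t0 : 0 < theta_low by exact: expR_gt0.
rewrite derive2_theta // E lerNl -mulNr.
have -> : - (flat 3 (w N s) * dramp (V s) ^+ 2 + dramp (w N s) * dramp (V s) -
    dramp (w N s) * flat 3 (V s)) = dramp (w N s) * flat 3 (V s) -
    (flat 3 (w N s) * dramp (V s) ^+ 2 + dramp (w N s) * dramp (V s)) by ring.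
apply: (@le_trans _ _ (3`!%:R / (s * ln s ^+ 2))); last first.
  by rewrite ler_wpM2l ?ler0n // lef_pV2 ?posrE // sL_gt0.
rewrite ler_wpM2r ?invr_ge0 ?(ltW (sL_gt0 Us)) // lerBlDr (le_trans h1) // lerDl.
by rewrite addr_ge0 // mulr_ge0 ?flat_ge0 ?sqr_ge0.
Qed.

(** Where v >= 1 and w >= 1, both ramps have slope at least 1/e: hence the constant e^-2, the same
    for all N. *)
Lemma theta_lower N s : 0 < s < 1 -> s <= theta_low -> 1 <= N - ramp (ln (- ln s)) ->
  expR (-1) ^+ 2 / (s * ln s ^+ 2) <= derive1 (theta N) s /\
  expR (-1) ^+ 2 / (s * ln s ^+ 2) <=
    derive1 (theta N) s + s * derive1 (derive1 (theta N)) s.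
Proof.
move=> Us; have /andP[s0 _] := Us; rewrite /theta_low -le_lnln // => V1 w1.
have L0 := ln_oppln_gt0 Us.
have e0 : 0 <= expR (-1) :> R by exact: expR_ge0.
split; last first.
  rewrite derive2_theta // ler_wpM2r ?invr_ge0 ?(ltW (sL_gt0 Us)) //.
  have -> : ddH N s - dH N s = flat 3 (w N s) * dramp (V s) ^+ 2 +
    dramp (w N s) * (dramp (V s) - flat 3 (V s)) by rewrite /ddH /dH; ring.
  rewrite ler_wpDl ?mulr_ge0 ?flat_ge0 ?sqr_ge0 // expr2.
  by rewrite ler_pM // ?ramp'_ge1 // ramp_convex_gap.
rewrite derive1_theta // /dH mulNr -mulrN -invrN -mulrN expr2 ler_pM ?mulr_ge0 //.
- by rewrite invr_ge0 ltW // sL_gt0.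
- by rewrite ler_pM // ramp'_ge1.
have L1 : 1 <= - ln s.
  rewrite -(@lnK _ (- ln s)) // -[leLHS]expR0 ler_expR; exact: le_trans V1.
rewrite lef_pV2 ?posrE ?sL_gt0 ?mulr_gt0 // -sqrrN expr2 ler_pM2l // ler_peMl //.
exact: ltW.
Qed.

Lemma theta_derive0 N s : 0 < s < 1 -> theta_high <= s \/ N - ramp (ln (- ln s)) <= 0 ->
  derive1 (theta N) s = 0 /\ derive1 (derive1 (theta N)) s = 0.
Proof.
move=> Us Hs; have /andP[s0 _] := Us.
have [dH0 ddH0] : dH N s = 0 /\ ddH N s = 0.
  case: Hs => [Hs|w0].
    have V0 : V s <= 0 by rewrite lnln_le // expR0.
    by rewrite /ddH /dH /dramp !(flat_le0 _ V0) addr0 expr0n !mulr0 subr0 oppr0.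
  by rewrite /ddH /dH /dramp !(flat_le0 _ w0) addr0 !mul0r subr0 oppr0.
have A0 : derive1 (theta N) s = 0 by rewrite derive1_theta // dH0 mul0r.
split => //; have := derive2_theta N Us; rewrite A0 dH0 ddH0 subr0 mul0r add0r.
by move=> /eqP; rewrite mulf_eq0 (gt_eqF s0) => /eqP.
Qed.

Lemma theta_cst N s : 0 < s < 1 -> theta_high <= s -> theta N s = ramp N.
Proof.
by move=> Us Hs; rewrite /theta (ramp_le0 (_ : ln (- ln s) <= 0)) ?subr0 // lnln_le // expR0.
Qed.

Lemma theta_vanish N : exists2 e : R, 0 < e < 1 &
  forall s, 0 < s -> s <= e -> N - ramp (ln (- ln s)) <= 0.
Proof.
(* For v >= 1 one has ramp v >= v / e, which is at least N for this v. *)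
pose v := Num.max 1 (N * expR 1); exists (expR (- expR v)).
  by rewrite expR_gt0 /= -[ltRHS]expR0 ltr_expR oppr_lt0 expR_gt0.
move=> s s0 se; have Us : 0 < s < 1.
  by rewrite s0 /= (le_lt_trans se) // -[ltRHS]expR0 ltr_expR oppr_lt0 expR_gt0.
have v1 : 1 <= v by rewrite le_max lexx.
have v0 := lt_le_trans ltr01 v1.
rewrite subr_le0; apply: (@le_trans _ _ (ramp v)); last by apply: ramp_le; rewrite le_lnln.
apply: (@le_trans _ _ (v * expR (-1))).
  by rewrite expRN ler_pdivlMr ?expR_gt0 // le_max lexx orbT.
by rewrite /ramp /flat v0 expr0 mul1r ler_wpM2l ?(ltW v0) // ler_expR lerN2 invf_le1.
Qed.

End PotentialFunction.

(** * Disjoint coordinate balls around the singular points *)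

Lemma separate_seq (T : topologicalType) (q : T) (s : seq T) : hausdorff_space T -> q \notin s ->
  exists A B : set T, [/\ open A, open B, A q, (forall p, p \in s -> B p) & A `&` B = set0].
Proof.
move=> hT; elim: s => [|p s IH].
  move=> _; exists setT, set0; split => //; rewrite ?setI0 //; [exact: openT|exact: open0].
rewrite in_cons negb_or => /andP[qp /IH [A [B [oA oB Aq Bs AB]]]].
have [[C D] /= [Cq Dp] [oC oD CD]] : exists2 CD : set T * set T, q \in CD.1 /\ p \in CD.2 &
    [/\ open CD.1, open CD.2 & CD.1 `&` CD.2 == set0].
  by have := hT; rewrite open_hausdorff => /(_ q p qp).
rewrite inE in Cq; rewrite inE in Dp; move/eqP: CD => CD.
exists (A `&` C), (B `|` D); split; [exact: openI|exact: openU|by []| |].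
  by move=> p'; rewrite in_cons => /orP[/eqP ->|/Bs]; [right|left].
apply/seteqP; split => // p' [[Ap Cp] [Bp|Dp']].
  by have : (A `&` B) p' by []; rewrite AB.
by have : (C `&` D) p' by []; rewrite CD.
Qed.

Section SingularBall.
Variables (R : realType) (k : nat) (M : complexManifold R k) (Y : set M).
Variable L : lamination Y.

Lemma chart_coord_eq0 (c : chart R k M) q rho p : 0 < rho -> cdom c q -> cdom c p ->
  normsq (chart_coord c q rho p) = 0 -> p = q.
Proof.
move=> rho0 cq cp n0; rewrite -(cmapK cq) -(cmapK cp); congr (cinv c _).
apply/rowP => j; apply/eqP; rewrite -subr_eq0; apply: contrapT => /negP d0.
have : 0 < normsq (chart_coord c q rho p).
  apply: (normsq_gt0 (j := j)); rewrite /chart_coord mulf_neq0 //.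
  by rewrite -cabs_gt0 cabsR normr_gt0 invr_eq0 gt_eqF.
by rewrite n0 ltxx.
Qed.

(** Each point is separated from the next ones before its ball is taken in a chart of the atlas, so
    that the balls are disjoint and glue into a single [coord_ball]. *)
Lemma coord_ball_seq (s : seq M) (W : set M) : open W -> (forall p, p \in s -> W p) ->
  exists z D, [/\ coord_ball L z D, D `<=` W, forall p, p \in s -> D p /\ normsq (z p) = 0 &
    forall p, D p -> normsq (z p) = 0 -> p \in s].
Proof.
elim: s W => [|q s IH] W oW sW.
  exists (fun _ _ => 0), set0; split => //; split => //; first exact: open0.
  move=> r _; rewrite (_ : [set _ | _] = set0); first exact: compact0.
  by apply/seteqP; split => // p [].
have [qs|qs] := boolP (q \in s).
  have sE p : (p \in q :: s) = (p \in s).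
    by rewrite in_cons; case: eqP => // ->; rewrite qs.
  have [|z [D [h1 h2 h3 h4]]] := IH W oW; first by move=> p ps; apply: sW; rewrite sE.
  by exists z, D; split => // p; rewrite sE; [exact: h3|exact: h4].
have [A [B [oA oB Aq Bs AB]]] := separate_seq (@manifold_hausdorff _ _ M) qs.
have [||z2 [D2 [cb2 D2W s2 z2s]]] := IH (W `&` B); first exact: openI.
  by move=> p ps; split; [apply: sW; rewrite in_cons ps orbT|exact: Bs].
have [c cc cq] := manifold_chart q.
have WAq : (W `&` A) q by split => //; apply: sW; rewrite mem_head.
have [rho rho0 H] := chart_ballP L (atlas_holo cc) cq (openI oW oA) WAq.
have [cb1 D1W D1q _] := H rho rho0 (lexx _).
set z1 := chart_coord c q rho in cb1; set D1 := chart_ball c q rho in cb1 D1W D1q.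
have D12 : D1 `&` D2 = set0.
  apply/seteqP; split => // p [/D1W [_ Ap] /D2W [_ Bp]].
  by have : (A `&` B) p by []; rewrite AB.
have nD p : D2 p -> ~ D1 p by move=> p2 p1; have : (D1 `&` D2) p by []; rewrite D12.
exists (fun p => if `[< D1 p >] then z1 p else z2 p), (D1 `|` D2); split.
- exact: coord_ballU.
- by move=> p [/D1W []|/D2W []].
- move=> p; rewrite in_cons => /orP[/eqP ->|/s2 [D2p zp]].
    by split; [left|rewrite asboolT // chart_coord0].
  by split; [right|rewrite asboolF //; exact: nD].
move=> p [D1p|D2p].
  rewrite asboolT // => n0; rewrite in_cons; apply/orP; left; apply/eqP.
  by apply: chart_coord_eq0 n0 => //; have [] := D1p.
rewrite asboolF; last exact: nD.
by move=> n0; rewrite in_cons z2s ?orbT.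
Qed.

Lemma kahler_near (z1 z2 : M -> 'I_k -> Cx R) (D : set M) (i : fbox L) p : open D -> D p ->
  (forall p, D p -> z1 p = z2 p) -> fdom i p -> kahler z1 i p = kahler z2 i p.
Proof.
move=> oD Dp E ip; rewrite /kahler.
suff -> : dcoord z1 i p = dcoord z2 i p by [].
apply/funext => j; rewrite /dcoord !derive1E; apply: near_eq_derive.
by apply: filterS (leaf_near ip oD Dp) => x [_ Dx]; rewrite E.
Qed.

End SingularBall.

(** At a the ball is taken in the given chart, at the other points of E in charts of the atlas. *)
Lemma singular_ball (R : realType) (k : nat) (M : complexManifold R k) (X : singLamination M)
    (a : M) (c : chart R k M) : sing X a -> holo_coordinates c -> cdom c a -> cmap c a = 0 ->
  exists rho z D, [/\ 0 < rho, coord_ball (lam X) z D,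
    (forall p, sing X p -> D p) /\ (forall p, D p -> (sing X p <-> normsq (z p) = 0)),
    (open (chart_ball c a rho) /\ chart_ball c a rho a /\ chart_ball c a rho `<=` D) /\
      (forall p, chart_ball c a rho p -> z p = chart_coord c a rho p) &
    (forall v : 'rV[Cx R]_k, \sum_j cabs (v 0 j) ^+ 2 < rho ^+ 2 -> (cmap c @` cdom c) v) /\
    (forall p, sing X p -> chart_ball c a rho p -> p = a)].
Proof.
move=> Ea hc ca c0; have /finite_seqP [s0 Es0] : finite_set (sing X) by case: X Ea.
pose s := [seq p <- s0 | p != a].
have sE p : sing X p -> p != a -> p \in s.
  by rewrite Es0 /= => ps pa; rewrite mem_filter pa.
have sS p : p \in s -> sing X p by rewrite mem_filter Es0 => /andP[].
have as_ : a \notin s by rewrite mem_filter eqxx.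
have [A [B [oA oB Aa Bs AB]]] := separate_seq (@manifold_hausdorff _ _ M) as_.
have [z2 [D2 [cb2 D2B s2 z2s]]] := coord_ball_seq (lam X) oB Bs.
have [rho rho0 H] := chart_ballP (lam X) hc ca oA Aa.
have [cb1 D1A D1a img] := H rho rho0 (lexx _).
exists rho; set z1 := chart_coord c a rho in cb1 *; set D1 := chart_ball c a rho in cb1 D1A D1a *.
have D12 : D1 `&` D2 = set0.
  apply/seteqP; split => // p [/D1A Ap /D2B Bp].
  by have : (A `&` B) p by []; rewrite AB.
have nD p : D2 p -> ~ D1 p by move=> p2 p1; have : (D1 `&` D2) p by []; rewrite D12.
have singD1 p : sing X p -> D1 p -> p = a.
  move=> sp /D1A Ap; apply: contrapT => /eqP pa.
  by have : (A `&` B) p by [split => //; apply: Bs; exact: sE]; rewrite AB.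
exists (fun p => if `[< D1 p >] then z1 p else z2 p), (D1 `|` D2); split => //.
- exact: coord_ballU.
- split => [p sp|p].
    by have [->|pa] := eqVneq p a; [left|right; have [] := s2 _ (sE _ sp pa)].
  case=> [D1p|D2p].
    rewrite asboolT //; split => [sp|n0]; first by rewrite (singD1 _ sp D1p) /z1 chart_coord0.
    by rewrite (chart_coord_eq0 rho0 ca _ n0) //; have [] := D1p.
  rewrite asboolF; last exact: nD.
  split => [sp|n0]; last exact/sS/z2s.
  have [pa|pa] := eqVneq p a; last by have [] := s2 _ (sE _ sp pa).
  by exfalso; apply: (nD p) => //; rewrite pa.
- split; first by split; [by have [] := cb1|split => //; left].
  by move=> p D1p; rewrite asboolT.
split => // v vr; apply: img; rewrite c0; under eq_bigr do rewrite mxE subr0.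
exact: vr.
Qed.

(** * Positive test forms of bounded T-mass built from the potentials *)

Section PotentialForms.
Variables (R : realType) (k : nat) (M : complexManifold R k) (X : singLamination M).
Variables (z : M -> 'I_k -> Cx R) (D : set M).
Let L := lam X.
Let Y := supp X `\` sing X.
Hypotheses (cb : coord_ball L z D) (singD : forall p, sing X p -> D p)
  (sing0 : forall p, D p -> (sing X p <-> normsq (z p) = 0)).
Let U : set R := [set s | 0 < s < 1].
Local Notation s_ p := (normsq (z p)).

Let YU p : Y p -> D p -> U (s_ p).
Proof.
move=> [_ ns] Dp; have [_ _ n1 _ _] := cb; rewrite /U /= n1 // andbT lt_neqAle normsq_ge0 andbT.
by apply/eqP => E; apply: ns; apply/(sing0 Dp).
Qed.

Lemma coord_ball_small_open lo : open [set p | D p /\ s_ p < lo].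
Proof.
have [oD zc _ _ _] := cb; rewrite openE => p [Dp sp].
have nc : {for p, continuous (fun p => s_ p)}.
  apply: (@continuous_sum _ _ _ (fun j p => cabs (z p j) ^+ 2)) => j.
  by apply: continuous_cabs2; exact: zc.
by apply: filterS2 (near_open oD Dp) (nc _ (lt_nbhsl sp)) => p' h1 h2.
Qed.

Lemma outer_compact lo : 0 < lo ->
  compact [set p | supp X p /\ ~ (D p /\ s_ p < lo)] /\
  [set p | supp X p /\ ~ (D p /\ s_ p < lo)] `<=` Y.
Proof.
move=> lo0; split.
  rewrite (_ : [set _ | _] = supp X `&` ~` [set p | D p /\ s_ p < lo]) //.
  apply: compact_closedI; first exact: supp_compact.
  by rewrite closedC; exact: coord_ball_small_open.
move=> p [Xp np]; split => // sp; apply: np; have Dp := singD sp; split => //.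
by rewrite ((sing0 Dp).1 sp).
Qed.

Lemma annulus_compact lo hi : 0 < lo -> hi < 1 ->
  compact [set p | supp X p /\ [/\ D p, lo <= s_ p & s_ p <= hi]] /\
  [set p | supp X p /\ [/\ D p, lo <= s_ p & s_ p <= hi]] `<=` Y.
Proof.
move=> lo0 hi1; have [cO OY] := outer_compact lo0; split.
  have [_ _ _ cK _] := cb.
  rewrite (_ : [set _ | _] = [set p | supp X p /\ ~ (D p /\ s_ p < lo)] `&`
      [set p | D p /\ s_ p <= hi]).
    apply: compact_closedI => //; apply: compact_closed; first exact: manifold_hausdorff.
    exact: cK.
  apply/seteqP; split => p; first by move=> [Xp [Dp h1 h2]]; split => //; split => // -[_];
    rewrite ltNge h1.
  move=> [[Xp np] [Dp h2]]; split => //; split => //.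
  by rewrite leNgt; apply/negP => h; apply: np.
move=> p [Xp [Dp h1 _]]; split => // /(sing0 Dp) s0.
by move: h1; rewrite s0 leNgt lo0.
Qed.

Lemma rform_smooth (A B : R -> R) r : r < 1 -> (forall n, rsm n U A) -> (forall n, rsm n U B) ->
  (forall x, U x -> r <= x -> A x = 0 /\ B x = 0) -> smooth_form (rform (L := L) z D A B).
Proof.
move=> r1 hA hB AB0; split => [i j p ip jp|n i]; first exact: rform_change.
exact: (rform_csm cb (@unit_interval_open R) r1 YU i (hA n) (hB n) AB0).
Qed.

Lemma rform_supported (A B : R -> R) lo hi : 0 < lo -> hi < 1 ->
  (forall x, U x -> x < lo \/ hi < x -> A x = 0 /\ B x = 0) ->
  supported_in (rform (L := L) z D A B) Y.
Proof.
move=> lo0 hi1 AB0; have [cK KY] := annulus_compact lo0 hi1.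
eexists; first by split; [exact: cK|exact: KY].
move=> i p ip nK; rewrite /rform; case: asboolP => // Dp.
have Yp := fdom_sub ip.
have [-> ->] : A (s_ p) = 0 /\ B (s_ p) = 0; last by rewrite !mul0r addr0.
apply: AB0; first exact: YU.
have [h1|h1] := ltP (s_ p) lo; first by left.
have [h2|h2] := ltP hi (s_ p); first by right.
by exfalso; apply: nK; split; [have [] := Yp|split].
Qed.

(** By the Cauchy-Schwarz inequality the radial form lies between 0 and s times the Kahler one, so
    the expression is at least A or A + s B times the latter, according to the sign of B. *)
Lemma rform_ge (A B : R -> R) (i : fbox L) p (m : R) : D p ->
  m <= A (s_ p) -> m <= A (s_ p) + s_ p * B (s_ p) ->
  m * kahler z i p <= rform z D A B i p.
Proof.
move=> Dp h1 h2; rewrite /rform asboolT //.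
have k0 : 0 <= kahler z i p by exact: normsq_ge0.
have r0 : 0 <= radial z i p by exact: sqr_ge0.
have rk : radial z i p <= s_ p * kahler z i p by exact: herm_Cauchy_Schwarz.
have [B0|B0] := leP 0 (B (s_ p)).
  by rewrite -[leLHS]addr0 lerD ?ler_wpM2r // mulr_ge0.
apply: (@le_trans _ _ ((A (s_ p) + s_ p * B (s_ p)) * kahler z i p)); first by rewrite ler_wpM2r.
by rewrite mulrDl lerD2l [_ * B _]mulrC -mulrA ler_wnM2l // ltW.
Qed.

(** The potential vanishes near E and is constant away from the balls, so it is a test function
    because X is compact; its i ddbar is supported in a compact annulus. *)
Lemma ddbar_smooth N : smooth_form (ddbar (L := L) (rfun z D (theta N) (ramp N))) /\
  supported_in (ddbar (L := L) (rfun z D (theta N) (ramp N))) Y /\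
  (forall i p, fdom i p -> ddbar (L := L) (rfun z D (theta N) (ramp N)) i p =
     rform z D (derive1 (theta N)) (derive1 (derive1 (theta N))) i p) /\
  test_function L (rfun z D (theta N) (ramp N)).
Proof.
have h1 : theta_high R < 1 by rewrite /theta_high -[ltRHS]expR0 ltr_expR oppr_lt0.
have tc x : U x -> theta_high R <= x -> theta N x = ramp N by exact: theta_cst.
have E i p : fdom i p -> ddbar (L := L) (rfun z D (theta N) (ramp N)) i p =
     rform z D (derive1 (theta N)) (derive1 (derive1 (theta N))) i p.
  move=> ip; exact: (ddbar_rfun cb h1 YU (theta_rsm 2 N) tc ip).
have dr n : rsm n U (derive1 (theta N)) by have [] := theta_rsm n.+1 N.
have ddr n : rsm n U (derive1 (derive1 (theta N))) by have [] := dr n.+1.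
have AB0 x : U x -> theta_high R <= x ->
    derive1 (theta N) x = 0 /\ derive1 (derive1 (theta N)) x = 0.
  by move=> Ux hx; apply: theta_derive0 => //; left.
have [e /andP[e0 e1] He] := theta_vanish N.
have [sc ss] := rform_smooth h1 dr ddr AB0.
have [K KY K0] : supported_in (rform (L := L) z D (derive1 (theta N))
    (derive1 (derive1 (theta N)))) Y.
  apply: (rform_supported e0 h1) => x Ux [xe|hx]; apply: theta_derive0 => //.
    by right; apply: He; [have /andP[] := Ux|exact: ltW].
  by left; exact: ltW.
split; last split; last split.
- split => [i j p ip jp|n i]; first by rewrite !E //; exact: sc.
  apply: csm_eq (ss n i); first exact: base2_setX_open.
  by move=> q [/= bq _]; rewrite /in_box E //; exact: (finvK _).1.
- by exists K => // i p ip nK; rewrite E // K0.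
- exact: E.
split.
  move=> i; apply: csm_leaf_smooth => n.
  exact: (rfun_csm cb (@unit_interval_open R) h1 YU i (theta_rsm n N) tc).
have [cO OY] := outer_compact e0; eexists; first by split; [exact: cO|exact: OY].
move=> i p ip np; have [Xp _] := fdom_sub ip.
have [Dp sp] : D p /\ s_ p < e by apply: contrapT => h; apply: np.
rewrite /rfun asboolT // /theta ramp_le0 //; apply: He; last exact: ltW.
by have /andP[] := YU (fdom_sub ip) Dp.
Qed.

(** The profile of the correcting form eta: at least C * [cut_min] for s between [theta_low] and
    [theta_high], and zero outside the slightly larger interval from [lo2] to [hi2]. *)
Let lo2 : R := theta_low R / 2.
Let hi2 : R := (1 + theta_high R) / 2.
Let cut (C s : R) : R := C * (ramp (s - lo2) * ramp (hi2 - s)).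
Let cut_min : R := ramp lo2 * ramp ((1 - theta_high R) / 2).

Let low0 : 0 < theta_low R. Proof. exact: expR_gt0. Qed.
Let high1 : theta_high R < 1.
Proof. by rewrite /theta_high -[ltRHS]expR0 ltr_expR oppr_lt0. Qed.

Let cut_min_gt0 : 0 < cut_min.
Proof. by rewrite mulr_gt0 // ramp_gt0 // divr_gt0 // subr_gt0. Qed.

Let cut_ge0 C s : 0 <= C -> 0 <= cut C s.
Proof. by move=> C0; rewrite /cut mulr_ge0 // mulr_ge0 ?ramp_ge0. Qed.

Let cut_ge C s : 0 <= C -> theta_low R <= s -> s <= theta_high R -> C * cut_min <= cut C s.
Proof.
move=> C0 s1 s2; rewrite ler_wpM2l // ler_pM ?ramp_ge0 // ramp_le //.
  by rewrite lerBrDr /lo2 -splitr.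
by rewrite /hi2 lerBrDr (le_trans (lerD (lexx _) s2)) // /theta_high; lra.
Qed.

Let cut_rsm C n : rsm n U (cut C).
Proof.
have oT : open [set: R] by exact: openT.
apply: (@rsm_sub _ n setT) => //; apply: rsmZ => //; apply: rsmM => //.
  apply: (@rsm_comp _ n setT setT (fun s => s - lo2) (@ramp R)) => //; last exact: rsm_ramp.
  by apply: rsmD => //; [exact: rsm_id|exact: rsm_cst].
apply: (@rsm_comp _ n setT setT (fun s => hi2 - s) (@ramp R)) => //; last exact: rsm_ramp.
apply: (@rsm_eq _ n setT (fun s => hi2 + -1 * s)) => //; first by move=> x _; rewrite mulN1r.
by apply: rsmD => //; [exact: rsm_cst|apply: rsmZ => //; exact: rsm_id].
Qed.

(** The integral of beta does not depend on lo: i ddbar of the potential contributes 0, so the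
    integral is that of eta, which is fixed before N. *)
Lemma potential_forms (T : harmonicCurrent L) (C : R) : 0 < C ->
  exists B : R, forall lo, 0 < lo -> exists beta : form L,
    [/\ smooth_form beta, supported_in beta Y,
        forall i p, fdom i p -> 0 <= beta i p, hc_fun T beta = B &
        forall i p, fdom i p -> D p -> lo <= s_ p -> s_ p <= theta_low R ->
          C * (kahler z i p / (s_ p * ln (s_ p) ^+ 2)) <= beta i p].
Proof.
move=> C0; pose e2 : R := expR (-1) ^+ 2.
have e20 : 0 < e2 by rewrite exprn_gt0 // expR_gt0.
(* [e2] is the constant of [theta_lower], so c2 times the potential yields the constant C. *)
pose c2 := C / e2; have c20 : 0 < c2 by rewrite divr_gt0.
pose K0 : R := 3`!%:R / theta_low R.
have K00 : 0 <= K0 by rewrite divr_ge0 // ltW.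
(* With this factor eta exceeds, on the annulus, the loss c2 * K0 allowed by
   [theta_convex_inside]. *)
pose Ce := c2 * K0 / cut_min.
have Ce0 : 0 <= Ce by exact: (divr_ge0 (mulr_ge0 (ltW c20) K00) (ltW cut_min_gt0)).
pose eta := rform (L := L) z D (cut Ce) (fun=> 0).
have hi21 : hi2 < 1 by rewrite /hi2 ltr_pdivrMr // mul1r mulr2n ltrD2l.
have lo20 : 0 < lo2 by rewrite divr_gt0.
have z0 n : rsm n U (fun=> 0 : R) by apply: rsm_cst; exact: unit_interval_open.
have eta_s : smooth_form eta.
  apply: (rform_smooth hi21 (cut_rsm Ce) z0) => x _ hx.
  by rewrite /cut (ramp_le0 (_ : hi2 - x <= 0)) ?subr_le0 // !mulr0.
have eta_k : supported_in eta Y.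
  apply: (rform_supported lo20 hi21) => x _ [hx|hx]; rewrite /cut.
    by rewrite (ramp_le0 (_ : x - lo2 <= 0)) ?subr_le0 ?(ltW hx) // mul0r mulr0.
  by rewrite (ramp_le0 (_ : hi2 - x <= 0)) ?subr_le0 ?(ltW hx) // !mulr0.
exists (hc_fun T eta) => lo lo0.
(* Large enough for the outer ramp to have argument at least 1 at every s >= lo. *)
pose N : R := 1 + ramp (ln (- ln lo)).
have [dS [dK [dE dT]]] := ddbar_smooth N.
pose f := rfun z D (theta N) (ramp N).
pose beta : form L := fun i p => c2 * ddbar f i p + eta i p.
have etaE i p : D p -> eta i p = cut Ce (s_ p) * kahler z i p.
  by move=> Dp; rewrite /eta /rform asboolT // mul0r addr0.
have k0 i p : 0 <= kahler z i p by exact: normsq_ge0.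
exists beta; split.
- exact: (smooth_formD (smooth_formM (@smooth_fun_cst _ _ _ _ L c2) dS) eta_s).
- have [K1 [cK1 K1Y] z1] := dK; have [K2 [cK2 K2Y] z2] := eta_k.
  exists (K1 `|` K2); first by split; [exact: compactU|rewrite subUset].
  move=> i p ip nK; rewrite /beta z1 // ?z2 // ?mulr0 ?addr0 // => h; apply: nK; by [left|right].
- move=> i p ip; rewrite /beta dE //.
  have [Dp|nDp] := pselect (D p); last first.
    by rewrite /eta /rform asboolF // mulr0 addr0.
  have Us := YU (fdom_sub ip) Dp; rewrite etaE //.
  have A0 := theta_derive_ge0 N Us.
  have pos : (s_ p <= theta_low R) || (theta_high R <= s_ p) ->
      0 <= rform z D (derive1 (theta N)) (derive1 (derive1 (theta N))) i p.
    move=> /orP H; have := rform_ge i Dp A0 (theta_convex_outside N Us H).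
    by rewrite mul0r.
  have [H|] := boolP ((s_ p <= theta_low R) || (theta_high R <= s_ p)).
    exact: (addr_ge0 (mulr_ge0 (ltW c20) (pos H)) (mulr_ge0 (cut_ge0 (s_ p) Ce0) (normsq_ge0 _))).
  rewrite negb_or -!ltNge => /andP[/ltW h1 /ltW h2].
  have H : - K0 * kahler z i p <=
      rform z D (derive1 (theta N)) (derive1 (derive1 (theta N))) i p.
    apply: rform_ge => //; first by rewrite (le_trans _ A0) // oppr_le0.
    exact: theta_convex_inside.
  have H2 : c2 * K0 <= cut Ce (s_ p).
    by apply: le_trans (cut_ge Ce0 h1 h2); rewrite /Ce divfK // gt_eqF.
  apply: (@le_trans _ _ (c2 * (- K0 * kahler z i p) + c2 * K0 * kahler z i p)).
    by rewrite mulrA mulrN mulNr addNr.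
  by rewrite lerD // ?ler_wpM2r // ler_wpM2l // ltW.
- have t1 := smooth_form_test dS dK; have t2 := smooth_form_test eta_s eta_k.
  by rewrite /beta (hc_linear T c2 t1 t2) (hc_ddbar T dT) mulr0 add0r.
move=> i p ip Dp sl sh; have Us := YU (fdom_sub ip) Dp.
have Ulo : 0 < lo < 1 by rewrite lo0 (le_lt_trans sl) //; have /andP[] := Us.
have w1 : 1 <= N - ramp (ln (- ln (s_ p))).
  rewrite /N -addrA lerDl subr_ge0 ramp_le // ler_ln ?posrE ?ln_oppln_gt0 // lerN2.
  by rewrite ler_ln ?posrE //; have /andP[] := Us.
have [h1 h2] := theta_lower Us sh w1.
have H := rform_ge i Dp h1 h2.
rewrite /beta dE // etaE // -[leLHS]addr0; apply: lerD; last first.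
  exact: (mulr_ge0 (cut_ge0 (s_ p) Ce0) (normsq_ge0 _)).
apply: le_trans (ler_wpM2l (ltW c20) H); rewrite le_eqVlt; apply/orP; left; apply/eqP.
have E (u x y : R) : C * (y * x) = C / u * (u * x * y) + (C - C / u * u) * (x * y) by ring.
by rewrite /c2 (E e2) divfK ?gt_eqF // subrr mul0r addr0.
Qed.

End PotentialForms.

(** * The mass near the singularity *)

(** An explicit bound, which also exists for n = 0, where there is no minimum. *)
Lemma positive_lower_bound (R : realType) n (x : 'I_n -> R) : (forall j, 0 < x j) ->
  exists2 m, 0 < m & forall j, m <= x j.
Proof.
move=> x0; have S0 (P : pred 'I_n) : 0 <= \sum_(j | P j) (x j)^-1.
  by apply: sumr_ge0 => j _; rewrite invr_ge0 ltW.
exists (1 + \sum_j (x j)^-1)^-1; first by rewrite invr_gt0 ltr_pwDl.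
move=> j; rewrite -[leRHS]invrK lef_pV2 ?posrE ?invr_gt0 //; last by rewrite ltr_pwDl.
by rewrite (bigD1 j) //= addrCA lerDl addr_ge0.
Qed.

Section MassBound.
Variables (R : realType) (k : nat) (M : complexManifold R k) (X : singLamination M).
Variables (z : M -> 'I_k -> Cx R) (D : set M).
Let L := lam X.
Let Y := supp X `\` sing X.
Hypotheses (cb : coord_ball L z D) (singD : forall p, sing X p -> D p)
  (sing0 : forall p, D p -> (sing X p <-> normsq (z p) = 0)).
Variables (T : harmonicCurrent L) (V : set M) (C : R) (a : M).
Hypotheses (oV : open V) (VD : forall p, V p -> D p /\ normsq (z p) <= theta_low R) (C0 : 0 < C).
Let W (i : fbox L) p := C * (kahler z i p / (normsq (z p) * ln (normsq (z p)) ^+ 2)).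
Hypothesis dens : forall (i : fbox L) p, fdom i p -> V p -> poincare_density i p <= W i p.

Let s_gt0 p : Y p -> D p -> 0 < normsq (z p) < 1.
Proof.
move=> [_ ns] Dp; have [_ _ n1 _ _] := cb; rewrite n1 // andbT lt_neqAle normsq_ge0 andbT.
by apply/eqP => E; apply: ns; apply/(sing0 Dp).
Qed.

Let W_ge0 i p : 0 <= W i p.
Proof.
by rewrite mulr_ge0 ?(ltW C0) // divr_ge0 ?normsq_ge0 // mulr_ge0 ?normsq_ge0 // sqr_ge0.
Qed.

Let W_cont i q : box_open_dom i V q ->
  {for q, continuous (fun q : R * R * ftrans i => in_box (W i) q.1 q.2)}.
Proof.
move=> [bq Vq].
have oc := @coord_dom2_open _ _ _ _ _ _ _ cb i.
pose phi (s : R) := (s * ln s ^+ 2)^-1.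
have pc : rsm 0 [set s | 0 < s < 1] phi.
  move=> s /= Us; have /andP[s0 _] := Us.
  apply: cvgV; first by rewrite mulf_neq0 ?(gt_eqF s0) // expf_neq0 // lt_eqF // ln_lt0.
  apply: cvgM; first exact: cvg_id.
  by apply: (@continuous_comp _ _ _ (@ln R) (fun x => x ^+ 2)); [exact: continuous_ln|
    exact: exprn_continuous].
have Uq (q' : R * R * ftrans i) : coord_dom2 D q' ->
    [set s : R | 0 < s < 1] (in_box (fun p => normsq (z p)) q'.1 q'.2).
  by move=> [bq' Dq']; apply: s_gt0 => //; exact: (fdom_sub (finvK bq').1).
have h := csm_comp oc (@unit_interval_open R) Uq pc (normsq_csm cb 0 i).
have h2 := csmZ C oc (csmM oc (kahler_csm cb 0 i) h).
apply: (csm_cont h2); split => //; exact: (VD Vq).1.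
Qed.

(** This is what selects the truncation: a compact set away from E stays at a positive distance from
    the zeros of z. *)
Let lower_bound (K : set M) (i : fbox L) : compact K -> K `<=` V `&` fdom i ->
  exists2 lo, 0 < lo & forall p, K p -> lo <= normsq (z p).
Proof.
move=> cK KV.
have : exists2 lo, 0 < lo & forall p, K p -> D p -> lo <= normsq (z p).
  apply: (@compact_induction _ K (fun A => exists2 lo, 0 < lo &
    forall p, A p -> D p -> lo <= normsq (z p))) => //.
  - by exists 1.
  - by move=> A B AB [lo lo0 H]; exists lo => // p /AB; exact: H.
  - move=> A B [l1 l10 H1] [l2 l20 H2]; exists (Num.min l1 l2); first by rewrite lt_min l10.
    by move=> p [/H1 H|/H2 H] /H {}H; rewrite ge_min H ?orbT.
  move=> p Kp; have [Vp ip] := KV _ Kp; have [Dp _] := VD Vp.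
  have /andP[s0 _] := s_gt0 (fdom_sub ip) Dp.
  have [oD zc _ _ _] := cb.
  have nc : {for p, continuous (fun p => normsq (z p))}.
    apply: (@continuous_sum _ _ _ (fun j p => cabs (z p j) ^+ 2)) => j.
    by apply: continuous_cabs2; exact: zc.
  have h : normsq (z p) / 2 < normsq (z p) by rewrite ltr_pdivrMr // ltr_pMr // ltr1n.
  exists [set p' | normsq (z p) / 2 < normsq (z p')]; first exact: (nc _ (lt_nbhsr h)).
  by exists (normsq (z p) / 2); [rewrite divr_gt0|move=> p' /ltW].
move=> [lo lo0 H]; exists lo => // p Kp; apply: H => //.
by have [Vp _] := KV _ Kp; exact: (VD Vp).1.
Qed.

Let phi (i : fbox L) := box_param (i := i) a.
Arguments phi : clear implicits.
Let box_measure (i : fbox L) := box_measure_exists T a oV (@W_cont i) (fun p _ _ => W_ge0 i p).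
Let nu i := projT1 (cid (box_measure i)).

Let nu_upper (i : fbox L) S : <<s @open M >> S -> measurable (phi i @^-1` S) ->
  S `<=` V `&` fdom i -> (box_mass T i S <= nu i (phi i @^-1` S))%E.
Proof.
have [h _] := projT2 (cid (box_measure i)) => bS mS SV.
by apply: h => // p /SV [Vp ip]; exact: dens.
Qed.

Let nu_lower (i : fbox L) := (projT2 (cid (box_measure i))).2.

Let mphi (i : fbox L) (K : set M) : compact K -> measurable (phi i @^-1` K).
Proof.
move=> cK; have cl : closed K by apply: compact_closed => //; exact: manifold_hausdorff.
have mU := measurableC (measurable_box_param a (i := i) (closed_openC cl)).
by rewrite -(setCK (_ @^-1` K)).
Qed.

Let bh0 : 0 < bump_height R. Proof. exact: bump_height_gt0. Qed.

(** The bound is common to all finite families of disjoint compact pieces: a family only fixes how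
    small lo must be, and the integral of the form beta does not depend on lo. *)
Let compact_mass : exists B : R, forall n (b : 'I_n -> fbox L) (K : 'I_n -> set M),
  (forall j, compact (K j) /\ K j `<=` V `&` fdom (b j)) ->
  (forall j l, j != l -> K j `&` K l = set0) ->
  (forall j, nu (b j) (phi (b j) @^-1` K j) \is a fin_num) /\
  \sum_(j < n) fine (nu (b j) (phi (b j) @^-1` K j)) <= B.
Proof.
(* The bumps used to separate the pieces are only bounded below by [bump_height], hence the
   division. *)
have [B HB] := potential_forms cb singD sing0 T (divr_gt0 C0 bh0).
exists B => n b K Kb Kd.
have /choice [lo lo_] j : exists lo, 0 < lo /\ forall p, K j p -> lo <= normsq (z p).
  by have [cK KV] := Kb j; have [lo h1 h2] := lower_bound cK KV; exists lo.
have [m m0 mlo] := positive_lower_bound (fun j => (lo_ j).1).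
have [beta [bs bk b0 <- bW]] := HB m m0.
have Kb' j : compact (K j) /\ K j `<=` fdom (b j).
  by have [h1 h2] := Kb j; split => // p /h2 [].
have Wb j p : K j p -> W (b j) p <= bump_height R * beta (b j) p.
  move=> Kp; have [Vp ip] := (Kb j).2 _ Kp; have [Dp sp] := VD Vp.
  rewrite mulrC -ler_pdivrMr // /W mulrAC; apply: bW => //.
  by rewrite (le_trans (mlo j)) // (lo_ j).2.
have low j alpha : test_form alpha -> supported_in alpha (fdom (b j)) ->
     (forall i p, fdom i p -> 0 <= alpha i p) ->
     (forall p, K j p -> bump_height R * beta (b j) p <= alpha (b j) p) ->
     (nu (b j) (phi (b j) @^-1` K j) <= (hc_fun T alpha)%:E)%E.
  move=> ta sa a0 H; apply: nu_lower => //; first exact: (a0 (b j)).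
    by apply: mphi; exact: (Kb j).1.
  by move=> p Kp _ _; apply: le_trans (H _ Kp); exact: Wb.
(* Finiteness comes separately, since [fine] would turn an infinite mass into 0. *)
have fin j : nu (b j) (phi (b j) @^-1` K j) \is a fin_num.
  have [U oU iU] := fdom_relopen (b j).
  have [cK Kj] := Kb' j.
  have KU : K j `<=` U by move=> p /Kj; rewrite iU => -[].
  have [chi [cs c01 cK' [K' [cK'' K'U z']]]] := bump L cK oU KU.
  have ts := smooth_formM cs bs; have tk := supported_scale chi bk.
  rewrite ge0_fin_numE //; apply: le_lt_trans (low j (fun i p => chi p * beta i p) _ _ _ _) _.
  - exact: smooth_form_test.
  - have [A [cA AY] A0] := bk; exists (K' `&` A).
      split; first by apply: compact_closedI => //; apply: compact_closed => //;
        exact: manifold_hausdorff.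
      by move=> p [/K'U Up /AY Yp]; rewrite iU.
    move=> i p ip nKA; have [Kp|/z' ->] := pselect (K' p); last by rewrite mul0r.
    by rewrite A0 ?mulr0 // => Ap; exact: nKA.
  - by move=> i p ip; have /andP[h _] := c01 p; rewrite mulr_ge0 // b0.
  - by move=> p Kp; rewrite ler_wpM2r ?cK' // b0 //; exact: Kj.
  - exact: ltry.
split => //; rewrite -big_enum /=.
apply: (@mass_pieces _ _ _ _ L T _ b K _ beta _ beta) => //; last exact: enum_uniq.
move=> j alpha ta sa a0 H.
rewrite -lee_fin fineK; last exact: fin.
exact: (low j alpha ta sa a0 H).
Qed.

Lemma poincare_mass_finite : (poincare_mass T V < +oo)%E.
Proof.
have [B HB] := compact_mass; apply: (@le_lt_trans _ _ B%:E); last exact: ltry.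
apply: ge_ereal_sup => _ [n [b [S [HS tS ->]]]].
(* Families with one piece provide the bound on compact sets that inner regularity requires. *)
have KB i K : compact K -> K `<=` V `&` fdom i -> (nu i (phi i @^-1` K) <= B%:E)%E.
  move=> cK KV; have [] := HB 1%N (fun=> i) (fun=> K) (fun _ => conj cK KV).
    by move=> j l; rewrite !ord1.
  move=> /(_ ord0) f; rewrite big_ord1 => h.
  by rewrite -(fineK f) lee_fin.
apply/lee_addgt0Pr => e e0.
(* n + 1 instead of n, as the family may be empty. *)
pose d := e / n.+1%:R; have d0 : 0 < d by rewrite divr_gt0.
have /choice [K HK] j : exists K, [/\ compact K, K `<=` S j &
    (nu (b j) (phi (b j) @^-1` S j) <= nu (b j) (phi (b j) @^-1` K) + d%:E)%E].
  have [bS SV] := HS j.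
  exact: (box_inner_regular oV (@measurable_box_param _ _ _ _ L (b j) a) (@KB (b j)) bS SV d0).
have mS j : measurable (phi (b j) @^-1` S j).
  have [bS _] := HS j; move: (S j) bS.
  apply: smallest_sub; last by move=> U oU; exact: measurable_box_param.
  split; first by rewrite /= preimage_set0.
    by move=> A mA; rewrite setTD; exact: (measurableC mA).
  by move=> A mA; rewrite /= preimage_bigcup; exact: bigcupT_measurable.
have [|j l jl|fin sumB] := HB n b K.
- move=> j; have [cK KS _] := HK j; have [_ SV] := HS j.
  by split => //; exact: subset_trans SV.
- apply/seteqP; split => // p [Kj Kl]; move/eqP: jl; apply.
  apply: tS => //; exists p; split.
    by have [_ KS _] := HK j; exact: KS.
  by have [_ KS _] := HK l; exact: KS.
apply: (@le_trans _ _ (\sum_(j < n) (nu (b j) (phi (b j) @^-1` K j) + d%:E))%E).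
  apply: lee_sum => j _; have [bS SV] := HS j; have [_ _ h] := HK j.
  by apply: le_trans h; exact: nu_upper.
have -> : (\sum_(j < n) (nu (b j) (phi (b j) @^-1` K j) + d%:E))%E =
    (\sum_(j < n) (fine (nu (b j) (phi (b j) @^-1` K j)) + d))%:E.
  by rewrite -sumEFin; apply: eq_bigr => j _; rewrite EFinD fineK.
rewrite big_split /= -EFinD lee_fin lerD // sumr_const card_ord -mulr_natr /d.
by rewrite -mulrA ger_pMr // mulrC ler_pdivrMr // mul1r ler_nat.
Qed.

End MassBound.

Theorem proposition4p2 (R : realType) (k : nat) (hk : (0 < k)%N)
    (M : complexManifold R k) (X : singLamination M)
    (a : M) (Ea : sing X a) (lin : linearizable X a)
    (T : harmonicCurrent (lam X)) :
  exists2 V : set M, nbhs a V & (poincare_mass T V < +oo)%E.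
Proof.
have [c [lambda [hc ca c0 lam0 flowP]]] := lin.
have [rho [z [D [rho0 cb [singD sing0] [[oV0 [V0a V0D]] zE] [img singa]]]]] :=
  singular_ball Ea hc ca c0.
have l0 j : 0 < cabs (lambda 0 j) ^+ 2 by rewrite exprn_gt0 // cabs_gt0.
have [m m0 lamm] := positive_lower_bound l0.
(* The summand 1 makes the positivity of [Lam] immediate. *)
pose Lam : R := 1 + \sum_j cabs (lambda 0 j).
have S0 (P : pred 'I_k) : 0 <= \sum_(j | P j) cabs (lambda 0 j).
  by apply: sumr_ge0 => j _; exact: cabs_ge0.
have Lam0 : 0 < Lam by rewrite ltr_pwDl.
have lamL j : cabs (lambda 0 j) <= Lam.
  by rewrite /Lam (bigD1 j) //= addrCA lerDl addr_ge0.
pose C := 2 * (64 * Lam) ^+ 2 / m.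
have C0 : 0 < C by rewrite divr_gt0 // mulr_gt0 // exprn_gt0 // mulr_gt0.
(* In the ball z is the linearizing chart, which gives the bound on the density; for |z|^2 <
   [theta_low] the potentials dominate that bound. *)
pose V := chart_ball c a rho `&` [set p | D p /\ normsq (z p) < theta_low R].
have oV : open V by apply: openI => //; exact: (coord_ball_small_open cb).
exists V.
  apply: near_open => //; split => //; split; first exact: V0D.
  by rewrite zE // chart_coord0; exact: expR_gt0.
apply: (@poincare_mass_finite _ _ _ _ _ _ cb singD sing0 T V C a oV _ C0).
  by move=> p [_ [Dp /ltW sp]].
move=> i p ip [Vp _]; rewrite (kahler_near oV0 Vp zE ip) zE //.
exact: (poincare_density_linear Ea hc ca c0 flowP rho0 img singa (fdom_sub ip) Vp Lam0 lamL
  m0 lamm ip).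
Qed.
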